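(* Let $n\ge2$, $1\le k\le n$, let $\Omega\subset\mathbb{R}^n$ be a bounded domain and let $f$ be a positive $C^2$ function on $\overline{\Omega}\times\mathbb{R}\times\mathbb{R}^n$. Let $\varphi\in C^4(\Omega)\cap C^0(\overline{\Omega})$ with $\|\varphi\|_{C^1}<\infty$ be an $(\eta,k)$-convex solution of the Dirichlet problem $$\begin{cases}\sigma_k(\lambda(\eta))=f(x,\varphi,\nabla\varphi)&\text{in }\Omega,\\ \varphi=0&\text{on }\partial\Omega,\end{cases}\qquad \eta_{ij}=(\Delta\varphi)\delta_{ij}-\varphi_{ij}.$$ Then there exist constants $C$ and $\beta$ depending only on $n$, $k$, $\|\varphi\|_{C^1}$, $\inf f$, $\|f\|_{C^2}$ and $\Omega$ such that $$\sup_\Omega\big[(-\varphi)^\beta\Delta\varphi\big]\le C.$$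
   Context: $\lambda(\eta)=(\lambda_1,\dots,\lambda_n)$ denotes the eigenvalues of the symmetric matrix $(\eta_{ij})$, $\sigma_k(\lambda)=\sum_{i_1<\dots<i_k}\lambda_{i_1}\cdots\lambda_{i_k}$ is the $k$-th elementary symmetric function, and $\Gamma_k=\{\lambda\in\mathbb{R}^n : \sigma_j(\lambda)>0,\ j=1,\dots,k\}$. The function $\varphi$ is called $(\eta,k)$-convex if $\lambda(\eta)\in\Gamma_k$ at every $x\in\Omega$. (Then $\Delta\varphi>0$, so $\varphi<0$ in $\Omega$ by the maximum principle and $(-\varphi)^\beta$ is well defined.) Here $\|\varphi\|_{C^1}=\|\varphi\|_{C^1(\Omega)}$, and the quantities $\inf f$ and $\|f\|_{C^2}$ are taken over the compact set $\{(x,z,p)\in\overline{\Omega}\times\mathbb{R}\times\mathbb{R}^n : |z|\le\|\varphi\|_{C^1},\ |p|\le\|\varphi\|_{C^1}\}$. *)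

(* Defs.v *)
From HB Require Import structures.
From mathcomp Require Import all_boot all_order all_algebra.
From mathcomp Require Import all_classical all_reals all_analysis.
From mathcomp Require complex.

Set Implicit Arguments.
Unset Strict Implicit.
Unset Printing Implicit Defensive.

Import Order.TTheory GRing.Theory Num.Theory.
Import numFieldNormedType.Exports.

Local Open Scope classical_set_scope.
Local Open Scope ring_scope.

Section Smoothness.
Context {R : realType} {V : normedModType R} {I : finType}.
Variable e : I -> V.
Implicit Types (W A : set V) (g : V -> R) (s : seq I) (m : nat).

(* [partial [:: i1; ..; ij] g] is D_{i1} ( .. (D_{ij} g)), where D_i is the
   derivative along the coordinate vector [e i]. *)
Definition partial s g : V -> R := foldr (fun i h => 'D_(e i) h) g s.

Definition Cm m W g : Prop :=
  forall s, (size s <= m)%N -> forall x, W x ->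
    {for x, continuous (partial s g)} /\
    ((size s < m)%N -> forall i, derivable (partial s g) x (e i)).

(* The value at x of the continuous extension of h from W to its closure;
   when W is open and h is continuous on W, it is h x for x in W. *)
Definition ext W (h : V -> R) (x : V) : R :=
  lim (h y @[y --> within W (nbhs x)]).

(* g is C^m on the closure of the open set W: it is C^m on W and its
   derivatives of order at most m extend continuously to the closure. *)
Definition Cm_closure m W g : Prop :=
  [/\ Cm m W g,
      {within closure W, continuous g} &
      forall s, (size s <= m)%N -> forall x, closure W x ->
        cvg (partial s g y @[y --> within W (nbhs x)])].

(* The C^m norm over A of a function whose partial derivatives are given on A
   by D: the sum over j <= m of sup_A |D^j|, with |D^j| the Euclidean norm of
   the array of the j-th order derivatives. *)
Definition Cnorm m A (D : seq I -> V -> R) : \bar R :=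
  (\sum_(j < m.+1) ereal_sup
     [set (Num.sqrt (\sum_(s : j.-tuple I) D s x ^+ 2))%:E | x in A])%E.

End Smoothness.

Section RealSymmetric.
Import complex.

Lemma char_poly_conj (F : fieldType) n (P D : 'M[F]_n) : P \in unitmx ->
  char_poly (invmx P *m D *m P) = char_poly D.
Proof.
move=> uP; pose Q := map_mx (@polyC F) P; pose Q' := map_mx (@polyC F) (invmx P).
have QQ : Q' *m Q = 1%:M by rewrite -map_mxM mulVmx // map_mx1.
rewrite /char_poly.
have -> : char_poly_mx (invmx P *m D *m P) = Q' *m char_poly_mx D *m Q.
  rewrite /char_poly_mx mulmxBr mulmxBl !map_mxM scalar_mxC -(mulmxA _ Q' Q) QQ.
  by rewrite mulmx1.
rewrite !det_mulmx mulrAC -det_mulmx QQ det1 mul1r //.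
Qed.

Lemma real_sym_split (R : rcfType) n (A : 'M[R]_n) : A^T = A ->
  exists l : 'rV[R]_n, char_poly A = \prod_(i < n) ('X - (l 0 i)%:P).
Proof.
move=> sA; pose rc := real_complex R; pose B : 'M[R[i]]_n := map_mx rc A.
have hB : B \is hermsymmx.
  apply: realsym_hermsym.
    by apply/is_hermitianmxP; rewrite scale1r map_mx_id // map_trmx sA.
  by apply/mxOverP => i j; rewrite mxE complex_real.
have /orthomx_spectralP eB := hermitian_normalmx hB.
have rB := hermitian_spectral_diag_real hB.
exists (map_mx (@complex.Re R) (spectral_diag B)).
apply: (map_poly_inj rc).
rewrite map_char_poly -/B [in LHS]eB char_poly_conj ?spectral_unit //.
rewrite char_poly_trig ?diag_mx_is_trig // rmorph_prod /=.
apply: eq_bigr => i _; rewrite rmorphB /= map_polyX map_polyC /= !mxE eqxx mulr1n.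
congr (_ - _).
by rewrite (RRe_real (mxOverP rB 0 i)).
Qed.

End RealSymmetric.

Section Eigenvalues.
Context {R : realType} {n : nat}.

(* The eigenvalues of A, repeated according to multiplicity, in some order
   (0 if A does not have n real eigenvalues; never so for symmetric A). *)
Definition eigenvals (A : 'M[R]_n) : 'rV[R]_n :=
  xget 0 [set l : 'rV[R]_n | char_poly A = \prod_(i < n) ('X - (l 0 i)%:P)].

Lemma eigenvalsP (A : 'M[R]_n) : A^T = A ->
  char_poly A = \prod_(i < n) ('X - (eigenvals A 0 i)%:P).
Proof.
move=> /real_sym_split [l hl].
by have := @xgetPex _ 0
  [set l : 'rV[R]_n | char_poly A = \prod_(i < n) ('X - (l 0 i)%:P)]
  (ex_intro _ l hl).
Qed.

Definition sigma (k : nat) (l : 'rV[R]_n) : R :=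
  \sum_(J : {set 'I_n} | #|J| == k) \prod_(i in J) l 0 i.

Definition Gamma (k : nat) : set 'rV[R]_n :=
  [set l | forall j, (1 <= j <= k)%N -> 0 < sigma j l].

End Eigenvalues.

Section Problem.
Context {R : realType} {n : nat}.
Implicit Types (Omega : set 'rV[R]_n) (phi : 'rV[R]_n -> R).

Definition bounded_domain Omega : Prop :=
  [/\ Omega !=set0, open Omega, connected Omega & bounded_set Omega].

Definition boundary Omega : set 'rV[R]_n := closure Omega `\` interior Omega.

Definition enorm (p : 'rV[R]_n) : R := Num.sqrt (\sum_i p 0 i ^+ 2).

Definition evec (i : 'I_n) : 'rV[R]_n := delta_mx 0 i.

Definition grad phi x : 'rV[R]_n := \row_i partial evec [:: i] phi x.

Definition hess phi x : 'M[R]_n := \matrix_(i, j) partial evec [:: i; j] phi x.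

Definition laplacian phi x : R := \sum_i partial evec [:: i; i] phi x.

Definition eta_mx phi x : 'M[R]_n := (laplacian phi x)%:M - hess phi x.

Definition eta_convex (k : nat) Omega phi : Prop :=
  forall x, Omega x -> Gamma k (eigenvals (eta_mx phi x)).

(* The coordinate vectors of the space of the variables (x, z, p). *)
Definition jvec (i : 'I_n + unit + 'I_n) : 'rV[R]_n * R * 'rV[R]_n :=
  match i with
  | inl (inl a) => (evec a, 0, 0)
  | inl (inr _) => (0, 1, 0)
  | inr b => (0, 0, evec b)
  end.

Definition jet Omega : set ('rV[R]_n * R * 'rV[R]_n) :=
  Omega `*` setT `*` setT.

Definition jetK Omega (M : R) : set ('rV[R]_n * R * 'rV[R]_n) :=
  closure Omega `*` [set z | `|z| <= M] `*` [set p | enorm p <= M].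

Definition C1norm Omega phi : \bar R :=
  Cnorm 1 Omega (fun s => partial evec s phi).

Definition C2norm Omega (M : R) (f : 'rV[R]_n * R * 'rV[R]_n -> R) : \bar R :=
  Cnorm 2 (jetK Omega M) (fun s => ext (jet Omega) (partial jvec s f)).

End Problem.

(* Main.v *)
(* Write [u] for [phi]. On [{u < - delta}] consider, with [K = M ^ 2 + 1],
     [W = be * ln (- u - delta) + ln (Lap u) - 1/3 * ln (K - |grad u|^2) + B/2 * |x|^2].
   At a maximum point, in an orthonormal eigenframe of [D^2 u], the conditions
   [grad W = 0] and [D^2 W <= 0] are combined with the equation differentiated
   once and twice.  Differentiability of the eigenvalues is not required: the
   concavity of [ln sigma_k] bounds [ln f] along each line by a function with
   the same value at the point, which compares first and second derivatives.

   Let [kap 1] be the largest eigenvalue of [D^2 u].  If another eigenvalue has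
   size at least [eps * Lap u], the term in [K - |grad u|^2] dominates all
   others.  Otherwise [D^2 u] almost has rank one.  For [k < n] this gives
   [sigma_k (lambda (eta)) >= (Lap u)^k / 2], so that [Lap u] is bounded.  For
   [k = n] Hadamard's inequality recovers the second-order part of the
   concavity of [ln det], which absorbs the third derivatives in the directions
   [l <> 1], while the trace of the linearized operator is at least a multiple
   of [Lap u], so that a large [B] controls the remaining terms.

   In all cases [(- u - delta) * Lap u <= C] at the maximum point; for a given
   [x], the choice [delta = - u x / 2] transfers the bound to [x]. *)

Require Import Defs.
From HB Require Import structures.
From mathcomp Require Import all_boot all_order all_algebra all_fingroup.
From mathcomp Require Import reals exp.
From mathcomp Require Import ring lra.
Set Implicit Arguments.
Unset Strict Implicit.
Unset Printing Implicit Defensive.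
Import Order.TTheory GRing.Theory Num.Theory.
Local Open Scope ring_scope.

(** Since [phi] is only continuous up to the boundary, [delta] keeps the maximum in a compact subset
    of [Omega], and every constant must be independent of [delta]. The constants are fixed in the
    order [C0] (from [n], [M], [m], [A], which control [ln f] to second order), [B] (from [A] and
    [C0]), [be] (from [B]), while [eps] depends on [n] alone.

    Along a line the frame stays frozen at the eigenvectors of the maximum point. In any orthonormal
    frame the diagonal of a symmetric matrix is a doubly stochastic average of its eigenvalues; a
    rearrangement inequality thus carries the tangent bound of [ln sigma_k] over to this diagonal,
    which is linear in the second derivatives of [phi].

    The factor 1/3 answers to the first-order condition: it writes the derivative of [ln (Lap u)] as
    a sum of three terms, whose square costs a factor 3, and the gradient logarithm returns exactly
    three times the square of its own term.

    The case [k = 1] stands apart: it is [sigma_2 > 0] that bounds the Hessian eigenvalues by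
    [n * Lap u]. *)

Lemma eq_leW (disp : Order.disp_t) (T : porderType disp) (x y : T) : x = y -> (x <= y)%O.
Proof. by move=> ->. Qed.

(** * Log-concavity of elementary symmetric polynomials *)

Section ElementarySymmetric.
Context {R : realFieldType} {T : finType}.
Implicit Types (S : {set T}) (x y : T -> R).

(** The subset [S] is a parameter so that deleting a variable stays within one type:
    [esf (S :\ i) k] is the partial derivative of [esf S k.+1] in [x i]. *)
Definition esf S k x : R :=
  \sum_(J : {set T} | (J \subset S) && (#|J| == k)) \prod_(i in J) x i.

Lemma esf0 S x : esf S 0 x = 1.
Proof.
rewrite /esf (big_pred1 set0) ?big_set0 // => J /=.
rewrite cards_eq0; case: eqP => [->|_]; rewrite ?sub0set ?andbF //.
Qed.

Lemma esf_oversize S k x : (#|S| < k)%N -> esf S k x = 0.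
Proof.
move=> hk; rewrite /esf big_pred0 // => J.
apply/negP => /andP[/subset_leq_card hJ /eqP eJ].
by move: hk; rewrite -eJ ltnNge hJ.
Qed.

Lemma esfS S k x i : i \in S ->
  esf S k.+1 x = esf (S :\ i) k.+1 x + x i * esf (S :\ i) k x.
Proof.
move=> iS; rewrite /esf (bigID (fun J : {set T} => i \in J)) /= addrC; congr (_ + _).
  by apply: eq_bigl => J; rewrite subsetD1 -!andbA; congr (_ && _); rewrite andbC.
rewrite mulr_sumr (reindex_onto (fun J : {set T} => i |: J) (fun J => J :\ i)) /=; last first.
  by move=> J /andP[_ iJ]; rewrite setD1K.
apply: eq_big => [J|J /andP[_ /eqP hJ]].
  rewrite setU11 andbT subUset sub1set iS /= subsetD1.
  have [iJ|iJ] := boolP (i \in J); rewrite ?andbF /=.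
    by apply/negbTE/negP => /andP[_ /eqP h]; move: iJ; rewrite -h !inE eqxx.
  by rewrite cardsU1 iJ setU1K // eqxx !andbT add1n eqSS.
have iJ : i \notin J by rewrite -hJ !inE eqxx.
by rewrite big_setU1.
Qed.

(** Each [k]-subset [J] of [S] is counted once for every [i] in [S :\: J]. *)
Lemma sum_esfD1 S k x :
  \sum_(i in S) esf (S :\ i) k x = (#|S|%:R - k%:R) * esf S k x.
Proof.
rewrite /esf (exchange_big_dep (fun J : {set T} => (J \subset S) && (#|J| == k))) /=; last first.
  by move=> i J _ /andP[]; rewrite subsetD1 => /andP[-> _] ->.
rewrite mulr_sumr; apply: eq_bigr => J /andP[JS /eqP kJ].
rewrite (eq_bigl (fun i => i \in S :\: J)) ?sumr_const; last first.
  by move=> i; rewrite subsetD1 JS kJ eqxx !inE andbT andbC.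
rewrite cardsD (setIidPr JS) -[LHS]mulr_natl natrB ?kJ //.
  by rewrite -kJ subset_leq_card.
Qed.

(** Euler's identity for a homogeneous polynomial: sum [esfS] over [i] and count with
    [sum_esfD1]. *)
Lemma esf_euler S k x :
  \sum_(i in S) x i * esf (S :\ i) k x = k.+1%:R * esf S k.+1 x.
Proof.
have h : \sum_(i in S) esf S k.+1 x =
  \sum_(i in S) esf (S :\ i) k.+1 x + \sum_(i in S) x i * esf (S :\ i) k x.
  by rewrite -big_split /=; apply: eq_bigr => i iS; rewrite -esfS.
move: h; rewrite sumr_const sum_esfD1 -[_ *+ _]mulr_natl.
set e := esf _ _ _; set s := \sum_(_ in _) _; lra.
Qed.

Lemma sum_dispersion (A : {set T}) (a b : T -> R) :
  \sum_(i in A) \sum_(j in A) (a i - a j) * (b i - b j) =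
  2 * (#|A|%:R * \sum_(i in A) a i * b i - (\sum_(i in A) a i) * (\sum_(i in A) b i)).
Proof.
transitivity (\sum_(i in A) (#|A|%:R * (a i * b i) - a i * (\sum_(j in A) b j)
   - (\sum_(j in A) a j) * b i + \sum_(j in A) a j * b j)).
  apply: eq_bigr => i _.
  rewrite mulr_sumr mulr_suml mulr_natl -sumr_const -!sumrB -big_split /=.
  by apply: eq_bigr => j _; ring.
rewrite big_split !sumrB /= sumr_const -mulr_sumr -mulr_suml -mulr_sumr -[_ *+ _]mulr_natl.
by ring.
Qed.

(** By [esfS] the terms in [x i] cancel in [esf S r.+1 x * esf (S :\ i) r.+1 x - esf S r.+2 x * esf
    (S :\ i) r x], which leaves the summand; this form is linear in the reduced functions, so
    [sum_esfD1] sums it. *)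
Lemma esf_newton_aux S r x :
  \sum_(i in S) (esf (S :\ i) r.+1 x ^+ 2 - esf (S :\ i) r x * esf (S :\ i) r.+2 x) =
  (#|S|%:R - r.+1%:R) * esf S r.+1 x ^+ 2 - (#|S|%:R - r%:R) * (esf S r x * esf S r.+2 x).
Proof.
transitivity (\sum_(i in S) (esf S r.+1 x * esf (S :\ i) r.+1 x - esf S r.+2 x * esf (S :\ i) r x)).
  apply: eq_bigr => i iS; rewrite (esfS r.+1 x iS) (esfS r x iS); ring.
by rewrite sumrB -!mulr_sumr !sum_esfD1; ring.
Qed.

(* Both second-order differences below are [x i - x j] times the symmetric
   functions of the variables other than [i] and [j], so that Newton's
   inequality for [n - 2] variables implies the one for [n] variables. *)
Lemma esf_newton S r x : esf S r x * esf S r.+2 x <= esf S r.+1 x ^+ 2.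
Proof.
have [m] := ubnP #|S|; elim: m S r => // m IH S r hS.
have [hc|hc] := leqP #|S| r.+1.
  by rewrite (@esf_oversize S r.+2) ?mulr0 ?sqr_ge0.
have : 0 <= \sum_(i in S) \sum_(j in S)
   ((esf (S :\ i) r.+1 x - esf (S :\ j) r.+1 x) * (esf (S :\ i) r.+1 x - esf (S :\ j) r.+1 x)
  - (esf (S :\ i) r x - esf (S :\ j) r x) * (esf (S :\ i) r.+2 x - esf (S :\ j) r.+2 x)).
  apply: sumr_ge0 => i iS; apply: sumr_ge0 => j jS.
  have [->|ij] := eqVneq i j; first by rewrite !subrr.
  have jSi : j \in S :\ i by rewrite !inE eq_sym ij.
  have iSj : i \in S :\ j by rewrite !inE ij.
  have e0 : S :\ j :\ i = S :\ i :\ j by rewrite !setDDl setUC.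
  have d k : esf (S :\ i) k.+1 x - esf (S :\ j) k.+1 x = (x j - x i) * esf (S :\ i :\ j) k x.
    by rewrite (esfS k x jSi) (esfS k x iSj) e0; ring.
  rewrite !d; case: r {hc} d => [|r] d.
    by rewrite !esf0 subrr mul0r subr0 -expr2 sqr_ge0.
  rewrite !d; set e1 := esf _ r.+1 x; set e0' := esf _ r x; set e2 := esf _ r.+2 x.
  have : e0' * e2 <= e1 ^+ 2.
    apply: IH; rewrite (cardsD1 i S) iS in hS; rewrite (cardsD1 j (S :\ i)) jSi in hS.
    by move: hS; rewrite !add1n ltnS => /ltnW.
  move=> h; rewrite [leRHS](_ : _ = (x j - x i) ^+ 2 * (e1 ^+ 2 - e0' * e2)); last by ring.
  by rewrite mulr_ge0 ?sqr_ge0 // subr_ge0.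
rewrite (eq_bigr (fun i => \sum_(j in S) (esf (S :\ i) r.+1 x - esf (S :\ j) r.+1 x) *
   (esf (S :\ i) r.+1 x - esf (S :\ j) r.+1 x) -
  \sum_(j in S) (esf (S :\ i) r x - esf (S :\ j) r x) * (esf (S :\ i) r.+2 x - esf (S :\ j) r.+2 x))); last first.
  by move=> i _; rewrite sumrB.
rewrite sumrB !sum_dispersion !sum_esfD1.
have := esf_newton_aux S r x; rewrite sumrB.
under eq_bigr do rewrite expr2.
set s1 := \sum_(_ in _) _; set s2 := \sum_(_ in _) _.
set e0 := esf S r x; set e1 := esf S r.+1 x; set e2 := esf S r.+2 x.
set N : R := #|S|%:R.
have hr : (0 : R) <= r%:R by [].
have hN : r%:R + 2 <= N by rewrite -natrD ler_nat addn2.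
rewrite -(natr1 r.+1) -(natr1 r); set t : R := r%:R in hr hN *.
move=> h1 h2.
(* Newton's inequality with its sharp constant; the conclusion follows from [(t + 1) * (N - t - 1)
   <= (t + 2) * (N - t)]. *)
have h3 : (t + 2) * (N - t) * (e0 * e2) <= (t + 1) * (N - t - 1) * e1 ^+ 2 by nra.
have [h|h] := lerP (e0 * e2) 0; first by rewrite (le_trans h) ?sqr_ge0.
have c0 : 0 < (t + 1) * (N - t - 1) by rewrite mulr_gt0; lra.
rewrite -(ler_pM2l c0); apply: le_trans h3.
by rewrite ler_wpM2r ?ltW //; nra.
Qed.

(** The Garding cone. Starting at [j = 0], where [esf] is 1, makes every quotient of consecutive
    functions available without a special case. *)
Definition gcone S k x := forall j, (j <= k)%N -> 0 < esf S j x.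

Lemma gcone_le S k l x : (k <= l)%N -> gcone S l x -> gcone S k x.
Proof. by move=> kl h j jk; apply/h/(leq_trans jk). Qed.

(** Induction on the degree: if [esf (S :\ i) j.+1 x <= 0], positivity of [esf S] in degrees [j.+1]
    and [j.+2] gives [e0 * e2 > - e0 * x i * e1 >= e1 ^+ 2], against Newton's inequality. *)
Lemma gconeD1 S k x i : i \in S -> gcone S k.+1 x -> gcone (S :\ i) k x.
Proof.
move=> iS hS; elim=> [|j IH] hj; first by rewrite esf0.
have h0 := IH (ltnW hj); rewrite ltNge; apply/negP => h1.
have := esf_newton (S :\ i) j x.
have := hS j.+1 (leqW hj); have := hS j.+2 hj.
rewrite !(esfS _ x iS).
move: h0 h1; set e0 := esf _ j x; set e1 := esf _ j.+1 x; set e2 := esf _ j.+2 x.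
move=> h0 h1 h2 h3; apply/negP; rewrite -ltNge.
have h4 : e0 * e2 > - e0 * x i * e1 by nra.
nra.
Qed.

Definition quot S k x := esf S k.+1 x / esf S k x.

Lemma quot_gt0 S k x : gcone S k.+1 x -> 0 < quot S k x.
Proof. by move=> h; rewrite divr_gt0 // h. Qed.

(** Dividing [esfS] by [esf (S :\ i) k x] turns the [i]-th term of Euler's identity for
    [esf S k.+2], normalized by [esf S k.+1], into a parallel sum. *)
Lemma quot_recurrence S k x i : i \in S -> gcone S k.+2 x ->
  0 < x i + quot (S :\ i) k x /\
  x i * esf (S :\ i) k.+1 x / esf S k.+1 x =
  x i * quot (S :\ i) k x / (x i + quot (S :\ i) k x).
Proof.
move=> iS h; have h' := gconeD1 iS h.
have e0 : 0 < esf (S :\ i) k x by apply: h'.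
have e1 : 0 < esf S k.+1 x by apply: h.
have -> : x i + quot (S :\ i) k x = esf S k.+1 x / esf (S :\ i) k x.
  by rewrite (esfS _ _ iS) /quot; field; rewrite gt_eqF.
split; first by rewrite divr_gt0.
by rewrite /quot; field; rewrite !gt_eqF.
Qed.

(** The parallel sum [a * b / (a + b)] is concave on [a + b > 0], whatever the individual signs, and
    homogeneous of degree one, so its tangents are linear. The gap is the square of
    [b * a' - a * b'] over a positive quantity. *)
Lemma parallel_sum_tangent (a b a' b' : R) : 0 < a + b -> 0 < a' + b' ->
  a' * b' / (a' + b') <= (b ^+ 2 * a' + a ^+ 2 * b') / (a + b) ^+ 2.
Proof.
move=> h h'; rewrite ler_pdivrMr // mulrAC ler_pdivlMr ?exprn_gt0 //.
rewrite -subr_ge0 [leRHS](_ : _ = (b * a' - a * b') ^+ 2) ?sqr_ge0 //; ring.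
Qed.

(* Marcus-Lopes: [quot S k] is concave because it is an average of the
   parallel sums of [x i] and [quot (S :\ i) (k - 1)]. *)
Lemma quot_tangent k S x : gcone S k.+1 x ->
  exists2 c : T -> R, quot S k x = \sum_(i in S) c i * x i &
    forall y, gcone S k.+1 y -> quot S k y <= \sum_(i in S) c i * y i.
Proof.
elim: k S x => [|k IH] S x hx.
  have e1 z : quot S 0 z = \sum_(i in S) 1 * z i.
    rewrite /quot esf0 divr1 -[esf _ _ _]mul1r -(esf_euler S 0 z).
    by apply: eq_bigr => i _; rewrite esf0 mulrC.
  by exists (fun=> 1) => [|y _]; rewrite e1.
pose b i y := quot (S :\ i) k y.
have qE y : gcone S k.+2 y ->
    quot S k.+1 y = k.+2%:R^-1 * \sum_(i in S) y i * b i y / (y i + b i y).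
  move=> hy.
  have e1 : 0 < esf S k.+1 y by apply: hy.
  rewrite [RHS](_ : _ = k.+2%:R^-1 * \sum_(i in S) y i * esf (S :\ i) k.+1 y / esf S k.+1 y).
    by rewrite -mulr_suml esf_euler /quot; field; rewrite gt_eqF //= (_ : 2 + k%:R = k.+2%:R) ?pnatr_eq0 // -natrD.
  by congr (_ * _); apply: eq_bigr => i iS; have [_ ->] := quot_recurrence iS hy.
have /fin_all_exists[c hc] : forall i, exists c : T -> R, i \in S ->
    b i x = \sum_(l in S :\ i) c l * x l /\
    forall y, gcone (S :\ i) k.+1 y -> b i y <= \sum_(l in S :\ i) c l * y l.
  move=> i; have [iS|_] := boolP (i \in S); last by exists (fun=> 0).
  by have [c c1 c2] := IH _ _ (gconeD1 iS hx); exists c.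
(* [p i] and [q i] are the partial derivatives of the parallel sum at [(x i, b i x)]; [C l] below
   collects what multiplies [y l], directly and through the inductive bounds on the [b i y]. *)
pose p i := b i x ^+ 2 / (x i + b i x) ^+ 2.
pose q i := x i ^+ 2 / (x i + b i x) ^+ 2.
have q0 i : 0 <= q i by rewrite divr_ge0 ?sqr_ge0.
pose C l := k.+2%:R^-1 * (p l + \sum_(i in S | i != l) q i * c i l).
have CE y : \sum_(l in S) C l * y l =
    k.+2%:R^-1 * \sum_(i in S) (p i * y i + q i * \sum_(l in S :\ i) c i l * y l).
  rewrite big_split /= mulrDr.
  under [X in _ = _ + _ * X]eq_bigr do rewrite mulr_sumr.
  rewrite (exchange_big_dep (mem S)) /=; last by move=> i l iS; rewrite !inE => /andP[].
  rewrite !mulr_sumr -big_split /=; apply: eq_bigr => l lS.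
  rewrite /C -mulrA -mulrDr; congr (_ * _).
  rewrite mulrDl mulr_suml; congr (_ + _); apply: eq_big => [i|i _]; last by rewrite mulrA.
  by rewrite !inE lS andbT eq_sym.
exists C => [|y hy].
  rewrite qE // CE; congr (_ * _); apply: eq_bigr => i iS.
  have [<- _] := hc i iS; have [h _] := quot_recurrence iS hx.
  by rewrite /p /q /b; field; rewrite gt_eqF.
rewrite qE // CE ler_wpM2l ?invr_ge0 //; apply: ler_sum => i iS.
have [h _] := quot_recurrence iS hx; have [h' _] := quot_recurrence iS hy.
apply: le_trans (parallel_sum_tangent h h') _.
rewrite mulrDl mulrAC lerD2l mulrAC; apply: ler_wpM2l; first exact: q0.
by have [_] := hc i iS; apply; exact: gconeD1.
Qed.

Lemma esf1 S x : esf S 1 x = \sum_(i in S) x i.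
Proof.
rewrite -[LHS]mul1r -(esf_euler S 0 x).
by apply: eq_bigr => i _; rewrite esf0 mulr1.
Qed.

(** The squares sum to [esf S 1 x ^+ 2 - 2 * esf S 2 x], which is less than [esf S 1 x ^+ 2]. *)
Lemma norm_le_esf1 S x i : i \in S -> gcone S 2 x -> `|x i| <= \sum_(j in S) x j.
Proof.
move=> iS h.
have h1 : 0 < \sum_(j in S) x j by rewrite -esf1; apply: h.
have : \sum_(j in S) x j ^+ 2 = (\sum_(j in S) x j) ^+ 2 - 2 * esf S 2 x.
  rewrite -(esf_euler S 1 x) expr2 mulr_suml -sumrB; apply: eq_bigr => j jS.
  by rewrite -!esf1 (esfS 0 x jS) esf0; ring.
rewrite (bigD1 i) //= => e.
have : 0 <= \sum_(j in S | j != i) x j ^+ 2 by apply: sumr_ge0 => j _; apply: sqr_ge0.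
have h2 : 0 < esf S 2 x by apply: h.
move=> h3; rewrite -ler_sqr ?nnegrE //; last exact: ltW.
by rewrite real_normK ?num_real //; lra.
Qed.

(** For [0 < k], the derivative of [ln (esf S k x)] in [x i]. *)
Definition dlog_esf S k x i := esf (S :\ i) k.-1 x / esf S k x.

Lemma dlog_esf_gt0 S k x i : (0 < k)%N -> i \in S -> gcone S k x -> 0 < dlog_esf S k x i.
Proof.
by case: k => // k _ iS h; rewrite divr_gt0 //; [apply: (gconeD1 iS h)|apply: h].
Qed.

Lemma sum_dlog_esf S k x : (0 < k)%N -> gcone S k x ->
  \sum_(i in S) dlog_esf S k x i * x i = k%:R.
Proof.
case: k => // k _ h; have h0 : 0 < esf S k.+1 x by apply: h.
under eq_bigr do rewrite /dlog_esf mulrAC mulrC [_ * x _]mulrC.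
by rewrite -mulr_sumr esf_euler mulrCA mulVf ?mulr1 // gt_eqF.
Qed.

(** The numerators differ by [x j - x i] times a symmetric function without both variables, positive
    on the cone. Hence the largest Hessian eigenvalue, which gives the smallest entry of [eta],
    carries the largest weight. *)
Lemma dlog_esf_anti S k x i j : (0 < k)%N -> i \in S -> j \in S -> gcone S k x ->
  x i <= x j -> dlog_esf S k x j <= dlog_esf S k x i.
Proof.
case: k => // k _ iS jS h; have h0 : 0 < esf S k.+1 x by apply: h.
move=> xij; have [->//|ij] := eqVneq i j.
rewrite /dlog_esf /= ler_pM2r ?invr_gt0 //; case: k h {h0} => [|k] h.
  by rewrite !esf0.
have jSi : j \in S :\ i by rewrite !inE eq_sym ij.
have iSj : i \in S :\ j by rewrite !inE ij.
have e0 : S :\ j :\ i = S :\ i :\ j by rewrite !setDDl setUC.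
rewrite (esfS _ x jSi) (esfS _ x iSj) e0 lerD2l ler_wpM2r // ltW //.
by have := gconeD1 iS h => /(gconeD1 jSi); apply.
Qed.

End ElementarySymmetric.

(** * Tangent bounds for the logarithm of an elementary symmetric polynomial *)

Section LogConcavity.
Context {R : realType} {T : finType}.
Implicit Types (S : {set T}) (x y : T -> R).

Lemma ln_le_subr1 (z : R) : 0 < z -> ln z <= z - 1.
Proof.
by move=> z0; rewrite -[in leLHS](subrKC 1 z) (le_trans (@le_ln1Dx _ (z - 1) _)) //; lra.
Qed.

(** [esf] telescopes into a product of the quotients [quot]. For each factor, [ln z <= z - 1] at
    [z = quot S k y / quot S k x] converts the tangent of the concave [quot] into one of its
    logarithm. *)
Lemma ln_esf_supergradient k S x : gcone S k x ->
  exists c : T -> R, forall y, gcone S k y ->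
    ln (esf S k y) <= ln (esf S k x) + \sum_(i in S) c i * (y i - x i).
Proof.
elim: k => [|k IH] hx.
  by exists (fun=> 0) => y _; rewrite !esf0 big1 ?addr0 // => i _; rewrite mul0r.
have [c hc] := IH (gcone_le (leqnSn k) hx); have [e ex he] := quot_tangent hx.
have qx := quot_gt0 hx.
have lnE y : gcone S k.+1 y -> ln (esf S k.+1 y) = ln (esf S k y) + ln (quot S k y).
  move=> hy; rewrite -lnM ?posrE ?quot_gt0 //; last by apply: hy.
  by rewrite mulrC divfK // gt_eqF //; apply: hy.
exists (fun i => c i + e i / quot S k x) => y hy.
rewrite !lnE //.
under eq_bigr do rewrite mulrDl.
rewrite big_split /= addrACA lerD //; first exact/hc/(gcone_le (leqnSn k)).
rewrite -lerBlDl -ln_div ?posrE ?quot_gt0 //.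
apply: le_trans (ln_le_subr1 _) _; first by rewrite divr_gt0 // quot_gt0.
rewrite (_ : \sum_(i in S) _ = (\sum_(i in S) e i * y i - \sum_(i in S) e i * x i) / quot S k x).
  by rewrite -ex mulrBl divff ?gt_eqF // lerD2r ler_pM2r ?invr_gt0 // he.
by rewrite -sumrB mulr_suml; apply: eq_bigr => i _; ring.
Qed.

Lemma eq_esf S k x y : {in S, x =1 y} -> esf S k x = esf S k y.
Proof.
move=> h; apply: eq_bigr => J /andP[JS _]; apply: eq_bigr => i iJ.
exact/h/(fintype.subsetP JS).
Qed.

Lemma esf_bump S k x i (t : R) : i \in S ->
  esf S k.+1 (fun j => x j + (j == i)%:R * t) = esf S k.+1 x + t * esf (S :\ i) k x.
Proof.
move=> iS; rewrite !(esfS _ _ iS) eqxx mul1r.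
have h l : esf (S :\ i) l (fun j => x j + (j == i)%:R * t) = esf (S :\ i) l x.
  by apply: eq_esf => j; rewrite !inE => /andP[/negbTE -> _]; rewrite mul0r addr0.
by rewrite !h; ring.
Qed.

(** By [ln z <= z - 1] at [z = (1 + t * s)^-1], the hypothesis at [t = d] and [t = - d] gives
    [|c - s| <= d * |c * s|], which fails for the small [d] chosen below unless [c = s]. *)
Lemma ln1D_subgradient_unique (s c e : R) : 0 < e ->
  (forall t, `|t| < e -> 0 < 1 + t * s /\ ln (1 + t * s) <= c * t) -> c = s.
Proof.
move=> e0 h.
have key t : `|t| < e -> t * s / (1 + t * s) <= c * t.
  move=> te; have [p le] := h t te; apply: le_trans le.
  have := @ln_le_subr1 (1 + t * s)^-1; rewrite invr_gt0 lnV ?posrE // => /(_ p).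
  have -> : t * s / (1 + t * s) = 1 - (1 + t * s)^-1 by field; rewrite gt_eqF.
  lra.
have key2 t : `|t| < e -> t * s <= c * t * (1 + t * s).
  by move=> te; rewrite -ler_pdivrMr; [exact: key|have [] := h t te].
apply/eqP; rewrite -subr_eq0; apply/negPn/negP => ne.
pose d := Num.min (e / 2) (`|c - s| / (2 * (`|c * s| + 1))).
have p1 : 0 < `|c * s| + 1 by rewrite ltr_wpDl.
have d0 : 0 < d by rewrite lt_min !divr_gt0 ?normr_gt0 // mulr_gt0.
have de : d < e by rewrite gt_min; apply/orP; left; lra.
have d1 : d * (`|c * s| + 1) <= `|c - s| / 2.
  rewrite -ler_pdivlMr // ge_min; apply/orP; right.
  by apply: eq_leW; field; rewrite gt_eqF.
have := key2 d; have := key2 (- d); rewrite normrN gtr0_norm // => /(_ de) h1 /(_ de) h2.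
have h3 : `|c - s| > 0 by rewrite normr_gt0.
have h1' : - s <= - c * (1 - d * s) by rewrite -(ler_pM2l d0); nra.
have h2' : s <= c * (1 + d * s) by rewrite -(ler_pM2l d0); nra.
have h5 : d * `|c * s| < `|c - s| by nra.
have [h6 h7] : d * (c * s) <= d * `|c * s| /\ - (d * `|c * s|) <= d * (c * s).
  by split; [rewrite ler_pM2l // ler_norm | rewrite -mulrN ler_pM2l // lerNnormlW].
by move: h5; case: (ger0P (c - s)) => h8 h5; lra.
Qed.

Lemma gcone_bump S k x i : i \in S -> gcone S k x ->
  exists2 e : R, 0 < e & forall t, `|t| < e -> gcone S k (fun j => x j + (j == i)%:R * t).
Proof.
move=> iS; elim: k => [|k IH] h.
  by exists 1 => // t _ j; rewrite leqn0 => /eqP ->; rewrite esf0.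
have [e e0 he] := IH (gcone_le (leqnSn k) h).
have h1 : 0 < esf S k.+1 x by apply: h.
set a := esf (S :\ i) k x.
have a1 : 0 < `|a| + 1 by rewrite ltr_wpDl.
exists (Num.min e (esf S k.+1 x / (`|a| + 1))); first by rewrite lt_min e0 divr_gt0.
move=> t; rewrite lt_min => /andP[te ta] j; rewrite leq_eqVlt => /predU1P[->|]; last exact: he.
rewrite esf_bump // -/a; move: ta; rewrite ltr_pdivlMr // => ta.
have : `|t * a| <= `|t| * (`|a| + 1) by rewrite normrM ler_wpM2l // lerDl.
by have := lerNnormlW (lexx `|t * a|); lra.
Qed.

(** Along a coordinate axis [esf] is affine ([esf_bump]), so [ln1D_subgradient_unique] identifies
    the coefficients of the supergradient. *)
Lemma ln_esf_tangent k S x y : (0 < k)%N -> gcone S k x -> gcone S k y ->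
  ln (esf S k y) <= ln (esf S k x) + \sum_(i in S) dlog_esf S k x i * (y i - x i).
Proof.
case: k => // k _ hx hy; have [c hc] := ln_esf_supergradient hx.
have e0 : 0 < esf S k.+1 x by apply: hx.
rewrite (eq_bigr (fun i => c i * (y i - x i))); first exact: hc.
move=> i iS; congr (_ * _); apply/esym.
have [e he0 he] := gcone_bump iS hx.
apply: (@ln1D_subgradient_unique _ _ _ he0) => t te.
have h := he _ te; have := hc _ h; rewrite esf_bump //.
have e1 : 1 + t * dlog_esf S k.+1 x i = (esf S k.+1 x + t * esf (S :\ i) k x) / esf S k.+1 x.
  by rewrite /dlog_esf /=; field; rewrite gt_eqF.
have e2 : 0 < esf S k.+1 x + t * esf (S :\ i) k x by rewrite -esf_bump //; apply: h.
rewrite e1 ln_div ?posrE // lerBlDl divr_gt0 //.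
rewrite (bigD1 i) //= eqxx big1 ?addr0; last first.
  by move=> j /andP[_ /negbTE ->]; rewrite mul0r addr0 subrr mulr0.
by rewrite mul1r addrAC subrr add0r.
Qed.

Lemma esf_perm k (s : {perm T}) x : esf [set: T] k (x \o s) = esf [set: T] k x.
Proof.
rewrite /esf [RHS](reindex_inj (@imset_inj _ _ s perm_inj)) /=.
apply: eq_big => [J|J _]; first by rewrite !finset.subsetT card_imset //; exact: perm_inj.
by rewrite big_imset //= => i j _ _; apply: perm_inj.
Qed.

Lemma esf_full x : esf [set: T] #|T| x = \prod_i x i.
Proof.
rewrite /esf (big_pred1 [set: T]%SET) => [|J /=].
  by apply: eq_bigl => i; rewrite inE.
by rewrite eqEcard cardsT !finset.subsetT /= eqn_leq max_card.
Qed.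

(** In top degree [esf] of the remaining variables vanishes, so [esf] factors as [x i] times a
    function that is positive by [gconeD1]. *)
Lemma gcone_full_gt0 x i : gcone [set: T] #|T| x -> 0 < x i.
Proof.
have T0 : (0 < #|T|)%N by apply/card_gt0P; exists i.
rewrite -(prednK T0) => h.
have h1 := gconeD1 (finset.in_setT i) h; have := h _ (leqnn _).
rewrite (esfS _ _ (finset.in_setT i)) esf_oversize ?add0r; last first.
  by rewrite prednK // cardsDS ?finset.subsetT // cards1 cardsT ltn_subrL.
by rewrite pmulr_lgt0 //; apply: h1.
Qed.

Lemma esf_ge0 S k x : {in S, forall i, 0 <= x i} -> 0 <= esf S k x.
Proof.
move=> h; apply: sumr_ge0 => J /andP[JS _]; apply: prodr_ge0 => i iJ.
exact/h/(fintype.subsetP JS).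
Qed.

Lemma esf_gt0 S k x : (k <= #|S|)%N -> {in S, forall i, 0 < x i} -> 0 < esf S k x.
Proof.
elim: k S => [|k IH] S hk h; first by rewrite esf0.
have /card_gt0P[i iS] : (0 < #|S|)%N by apply: leq_trans hk.
have hS j : j \in S :\ i -> 0 < x j by rewrite !inE => /andP[_]; apply: h.
rewrite (esfS _ _ iS) ltr_wpDl ?esf_ge0 // => [j /hS /ltW //|].
by rewrite mulr_gt0 ?h // IH //; move: hk; rewrite (cardsD1 i S) iS.
Qed.

End LogConcavity.

(** * The estimate at a maximum point *)

Ltac nonneg := repeat first
  [ done | exact: sqr_ge0 | exact: ltW | apply: addr_ge0 | apply: mulr_ge0
  | rewrite invr_ge0 | apply: exprn_ge0 ].

Section EsfBounds.
Context {R : realFieldType} {T : finType}.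
Implicit Types (S : {set T}) (x : T -> R).

Lemma esf_ge_exp S k x (c : R) : 0 <= c -> (k <= #|S|)%N -> {in S, forall i, c <= x i} ->
  c ^+ k <= esf S k x.
Proof.
move=> c0; elim: k S => [|k IH] S hk h; first by rewrite esf0.
have /card_gt0P[i iS] : (0 < #|S|)%N by apply: leq_trans hk.
have hS j : j \in S :\ i -> c <= x j by rewrite !inE => /andP[_]; apply: h.
rewrite (esfS _ _ iS) exprS ler_wpDl //.
  apply: sumr_ge0 => J /andP[JS _]; apply: prodr_ge0 => j jJ.
  by apply: le_trans c0 _; apply/hS/(subsetP JS).
apply: ler_pM; rewrite ?exprn_ge0 ?h // IH //.
by move: hk; rewrite (cardsD1 i S) iS.
Qed.

Lemma esf_le_exp S k x (c : R) : {in S, forall i, 0 <= x i <= c} -> 0 <= c ->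
  esf S k x <= 2 ^+ #|S| * c ^+ k.
Proof.
move=> h c0; have [m] := ubnP #|S|; elim: m S k h => // m IH S k h hm.
have [S0|/set0Pn[i iS]] := eqVneq S set0.
  case: k => [|k]; first by rewrite esf0 mulr1 exprn_ege1 // ler1n.
  by rewrite S0 esf_oversize ?cards0 // expr0 mul1r exprn_ge0.
have c1 : #|S| = #|S :\ i|.+1 by rewrite (cardsD1 i S) iS.
have hS : {in S :\ i, forall j, 0 <= x j <= c}.
  by move=> j; rewrite !inE => /andP[_]; apply: h.
have mS : (#|S :\ i| < m)%N by move: hm; rewrite c1 ltnS.
case: k => [|k]; first by rewrite esf0 mulr1 exprn_ege1 // ler1n.
rewrite (esfS _ _ iS) c1.
have /andP[x0 xc] := h i iS.
have e0 : 0 <= esf (S :\ i) k x.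
  apply: sumr_ge0 => J /andP[JS _]; apply: prodr_ge0 => j jJ.
  by have /andP[] := hS j (subsetP JS j jJ).
have h1 := IH _ k.+1 hS mS; have h2 := IH _ k hS mS.
have h3 := ler_pM x0 e0 xc h2.
rewrite exprS -mulrA mulrDl mul1r lerD //.
by apply: le_trans h3 _; rewrite mulrCA -exprS.
Qed.

Lemma dlog_esf_full x i : (forall j, 0 < x j) ->
  dlog_esf [set: T] #|T| x i = (x i)^-1.
Proof.
move=> xp; have T0 : (0 < #|T|)%N by apply/card_gt0P; exists i.
have cS : #|[set: T] :\ i| = #|T|.-1 by rewrite cardsDS ?subsetT // cards1 cardsT subn1.
have e : esf [set: T] #|T| x = x i * esf ([set: T] :\ i) #|T|.-1 x.
  by rewrite -[in LHS](prednK T0) (esfS _ _ (in_setT i)) esf_oversize ?add0r // cS prednK.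
rewrite /dlog_esf e invfM mulrCA divff ?mulr1 // gt_eqF // -cS.
apply: lt_le_trans (esf_ge_exp (c := \big[Num.min/1]_j x j) _ (leqnn _) _).
- apply: exprn_gt0; elim/big_ind: _ => // a b a0 b0; by rewrite lt_min a0.
- apply: ltW; elim/big_ind: _ => // a b a0 b0; by rewrite lt_min a0.
- by move=> j _; rewrite (bigD1 j) //= ge_min lexx.
Qed.

End EsfBounds.

Section QuadraticBound.
Context {R : realFieldType}.

Lemma quadratic_bound (a b c z : R) : 0 < c -> 0 <= a -> 0 <= b -> 0 <= z ->
  c * z ^+ 2 <= a + b * z -> z <= (a + b) / c + 1.
Proof.
move=> c0 a0 b0 z0 h; have ab : 0 <= (a + b) / c by rewrite divr_ge0 ?addr_ge0 // ltW.
have [z1|z1] := leP z 1; first by lra.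
rewrite ler_wpDr // ler_pdivlMr // mulrC.
have zp : 0 < z by lra.
rewrite -(ler_pM2r zp); nra.
Qed.

Lemma sqrD3_le (a b c : R) : (a + b + c) ^+ 2 <= 3 * (a ^+ 2 + b ^+ 2 + c ^+ 2).
Proof.
by rewrite -subr_ge0 [X in 0 <= X](_ : _ = (a - b) ^+ 2 + (b - c) ^+ 2 + (a - c) ^+ 2); [rewrite !addr_ge0 // sqr_ge0 | ring].
Qed.

End QuadraticBound.

Section PointwiseEstimate.
Context {R : realFieldType} {n : nat}.
Implicit Types (kap u y S F L X : 'I_n -> R).

(* The condition [D^2 W <= 0] contracted with the coefficients [F] of the
   linearized operator; [Tex] is the gain from the concavity of the operator. *)
Lemma master_inequality (k w q be B D C0 M Y Tex g : R) F kap u y (D1 : 'I_n -> R) S L X (T3 : 'I_n -> 'I_n -> R) :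
  0 < w -> 0 < q <= 1 -> 0 < be -> 0 < B -> 1 <= D -> 0 <= C0 -> 0 <= M -> 0 <= Y ->
  (forall a, 0 <= F a) -> \sum_a F a * kap a = k -> \sum_a F a = g ->
  (forall a, `|u a| <= M) -> (forall a, `|y a| <= Y) ->
  (forall l, `|L l| <= C0) -> (forall l, `|X l| <= C0) ->
  (forall a, D1 a / D = be * u a / w - 2 / 3 * q * (u a * kap a) - B * y a) ->
  (forall a, be * (- kap a / w - (u a / w) ^+ 2) + (S a / D - (D1 a / D) ^+ 2)
     + 1 / 3 * (q * (2 * kap a ^+ 2 + 2 * \sum_l u l * T3 l a) + (q * (2 * u a * kap a)) ^+ 2)
     + B <= 0) ->
  (forall l, \sum_a F a * T3 l a = X l + L l * kap l) ->
  \sum_l L l * D1 l - C0 * (1 + D ^+ 2) + Tex <= \sum_a F a * S a ->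
  2 / 3 * q * (\sum_a F a * kap a ^+ 2) + 4 / 3 * q ^+ 2 * (\sum_a F a * (u a * kap a) ^+ 2)
    + B * g + Tex / D <=
  be / w ^+ 2 * (\sum_a F a * u a ^+ 2) + \sum_a F a * (D1 a / D) ^+ 2
    + be / w * (k + n%:R * C0 * M) + 2 * C0 * D + n%:R * C0 * (B * Y + M).
Proof.
move=> w0 /andP[q0 q1] be0 B0 D1' C00 M0 Y0 F0 Fk Fg uM yY LC XC H1 H2 H3 H4.
have D0 : 0 < D by lra.
have sumn (f : 'I_n -> R) c : (forall l, `|f l| <= c) -> `|\sum_l f l| <= n%:R * c.
  move=> h; apply: le_trans (ler_norm_sum _ _ _) _.
  by rewrite mulr_natl -[X in _ *+ X]card_ord -sumr_const ler_sum.
have : \sum_a F a * (be * (- kap a / w - (u a / w) ^+ 2) + (S a / D - (D1 a / D) ^+ 2)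
     + 1 / 3 * (q * (2 * kap a ^+ 2 + 2 * \sum_l u l * T3 l a) + (q * (2 * u a * kap a)) ^+ 2)
     + B) <= 0.
  by apply: sumr_le0 => a _; rewrite mulr_ge0_le0.
rewrite (eq_bigr (fun a => - (be / w) * (F a * kap a) - be / w ^+ 2 * (F a * u a ^+ 2) +
   D^-1 * (F a * S a) - F a * (D1 a / D) ^+ 2 + 2 / 3 * q * (F a * kap a ^+ 2) +
   2 / 3 * q * (\sum_l u l * (F a * T3 l a)) + 4 / 3 * q ^+ 2 * (F a * (u a * kap a) ^+ 2) + B * F a)); last first.
  move=> a _; have -> : \sum_l u l * (F a * T3 l a) = F a * (\sum_l u l * T3 l a).
    by rewrite mulr_sumr; apply: eq_bigr => l _; ring.
  set s := \sum_(_ <- _) _; field; by rewrite !gt_eqF.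
rewrite !big_split /= !sumrN -!mulr_sumr -!/(_ - _) Fk Fg.
rewrite exchange_big /=.
have -> : \sum_l \sum_a u l * (F a * T3 l a) = \sum_l u l * X l + \sum_l L l * (u l * kap l).
  rewrite -big_split /=; apply: eq_bigr => l _; rewrite -mulr_sumr H3; ring.
(* The sum over [L l * (u l * kap l)] appears here with the sign opposite to that left by the once
   differentiated equation, and the two cancel. *)
have e : D^-1 * (\sum_l L l * D1 l) =
    be / w * (\sum_l L l * u l) - 2 / 3 * q * (\sum_l L l * (u l * kap l)) - B * (\sum_l L l * y l).
  rewrite !mulr_sumr -!sumrB; apply: eq_bigr => l _.
  transitivity (L l * (D1 l / D)); first by ring.
  by rewrite H1; ring.
have h4 : D^-1 * (\sum_l L l * D1 l) - C0 * (2 * D) + Tex / D <= D^-1 * (\sum_a F a * S a).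
  apply: le_trans (_ : D^-1 * (\sum_l L l * D1 l - C0 * (1 + D ^+ 2) + Tex) <= _); last first.
    by rewrite ler_pM2l ?invr_gt0.
  have hD : (1 + D ^+ 2) / D <= 2 * D by rewrite ler_pdivrMr //; nra.
  have := ler_wpM2l C00 hD; set s := \sum_l _.
  rewrite !mulrDr mulrN [Tex / D]mulrC lerD2r lerD2l lerN2 => h; apply: le_trans h.
  by apply: eq_leW; ring.
have b1 : `|\sum_l L l * u l| <= n%:R * (C0 * M).
  by apply: sumn => l; rewrite normrM ler_pM.
have b2 : `|\sum_l L l * y l| <= n%:R * (C0 * Y).
  by apply: sumn => l; rewrite normrM ler_pM.
have b3 : `|\sum_l u l * X l| <= n%:R * (M * C0).
  by apply: sumn => l; rewrite normrM ler_pM.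
move: b1 b2 b3; rewrite !ler_norml => /andP[b1 _] /andP[_ b2] /andP[b3 _].
have bw : 0 < be / w by rewrite divr_gt0.
have c1 := ler_wpM2l (ltW bw) b1; have c2 := ler_wpM2l (ltW B0) b2.
have c3 : - (n%:R * (M * C0)) <= 2 / 3 * q * (\sum_l u l * X l).
  have := ler_wpM2l (_ : 0 <= 2 / 3 * q) b3; have N0 : (0 : R) <= n%:R by [].
  move=> /(_ ltac:(nra)) h; apply: le_trans h.
  have : 0 <= n%:R * (M * C0) by rewrite !mulr_ge0.
  set z := n%:R * _ => z0; nra.
rewrite e in h4; move: h4 c1 c2 c3.
set s1 := \sum_l L l * u l; set s2 := \sum_l L l * (u l * kap l); set s3 := \sum_l L l * y l.
set s4 := \sum_l u l * X l; set s5 := \sum_i F i * kap i ^+ 2; set s6 := \sum_i F i * u i ^+ 2.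
set s7 := \sum_a F a * S a; set s8 := \sum_i F i * (D1 i / D) ^+ 2; set s9 := \sum_i F i * (u i * kap i) ^+ 2.
rewrite !mulrDr; set bw' := be / w; set bw2 := be / w ^+ 2; lra.
Qed.

End PointwiseEstimate.

(** * The regimes of the Hessian eigenvalues at a maximum point *)

Section Regimes.
Context {R : realFieldType} {n : nat}.
Implicit Types (kap u y F G e z : 'I_n -> R).

Lemma sqr_le_bound (a b : R) : `|a| <= b -> a ^+ 2 <= b ^+ 2.
Proof.
move=> h; rewrite -real_normK ?num_real //; apply: lerXn2r; rewrite ?nnegrE //.
exact: le_trans h.
Qed.

(** The term [F i * kap i ^+ 2] is at least a multiple of [g * D ^+ 2]. Of the three squares coming
    from the first-order condition, the one in [u a * kap a] is absorbed exactly by the second term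
    on the left of the hypothesis; the others are at most of order [g / w ^+ 2]. A quadratic
    inequality in [w * D] remains. *)
Lemma noncritical_bound (k w q q0 be B D C0 M Y g g0 eps : R) F kap u y (D1 : 'I_n -> R) i :
  0 < w <= M -> 0 < q0 <= q -> q <= 1 -> 0 < be -> 0 < B -> 1 <= D -> 0 <= C0 -> 0 <= Y ->
  0 < g0 <= g -> 0 < eps -> 0 <= k ->
  (forall a, 0 <= F a <= g) -> (forall a, `|u a| <= M) -> (forall a, `|y a| <= Y) ->
  (forall a, D1 a / D = be * u a / w - 2 / 3 * q * (u a * kap a) - B * y a) ->
  eps * D <= `|kap i| -> g <= n%:R * F i ->
  2 / 3 * q * (\sum_a F a * kap a ^+ 2) + 4 / 3 * q ^+ 2 * (\sum_a F a * (u a * kap a) ^+ 2) <=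
  be / w ^+ 2 * (\sum_a F a * u a ^+ 2) + \sum_a F a * (D1 a / D) ^+ 2
    + be / w * (k + n%:R * C0 * M) + 2 * C0 * D + n%:R * C0 * (B * Y + M) ->
  w * D <= (((be + 3 * be ^+ 2) * n%:R * M ^+ 2 + 3 * B ^+ 2 * n%:R * Y ^+ 2 * M ^+ 2
      + (be * M * (k + n%:R * C0 * M) + n%:R * C0 * (B * Y + M) * M ^+ 2) / g0)
      + 2 * C0 * M / g0) / (2 / 3 * q0 * eps ^+ 2 / n%:R) + 1.
Proof.
move=> /andP[w0 wM] /andP[q00 q0q] q1 be0 B0 D1' C00 Y0 /andP[g00 g0g] e0 k0 Fg uM yY H1 ki Fi E1.
have D0 : 0 < D by lra.
have M0 : 0 < M by lra.
have N0 : (0 : R) < n%:R by rewrite ltr0n; case: (n) i {Fg uM yY H1 ki Fi E1} => // -[].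
have g1 : 0 < g by lra.
have good : 2 / 3 * q0 * eps ^+ 2 / n%:R * g * D ^+ 2 <= 2 / 3 * q * (\sum_a F a * kap a ^+ 2).
  rewrite [leLHS](_ : _ = 2 / 3 * q0 * ((g / n%:R) * (eps * D) ^+ 2)); last by field; rewrite gt_eqF.
  apply: ler_pM; [nra | | lra |].
    by rewrite mulr_ge0 ?sqr_ge0 // divr_ge0 // ltW.
  rewrite (bigD1 i) //= ler_wpDr //.
    by apply: sumr_ge0 => a _; rewrite mulr_ge0 ?sqr_ge0 //; have /andP[] := Fg a.
  apply: ler_pM; rewrite ?sqr_ge0 ?divr_ge0 ?(ltW g1) //.
    by rewrite ler_pdivrMr // mulrC.
  rewrite -(real_normK (num_real (kap i))); apply: lerXn2r; rewrite ?nnegrE // ?mulr_ge0 // ltW //.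
have b1 : \sum_a F a * u a ^+ 2 <= n%:R * g * M ^+ 2.
  rewrite -mulrA [n%:R * _]mulr_natl -[X in _ *+ X]card_ord -sumr_const; apply: ler_sum => a _.
  by have /andP[? ?] := Fg a; apply: ler_pM; rewrite ?sqr_ge0 // sqr_le_bound.
have b2 : \sum_a F a * (D1 a / D) ^+ 2 <= 3 * be ^+ 2 / w ^+ 2 * (\sum_a F a * u a ^+ 2) +
   4 / 3 * q ^+ 2 * (\sum_a F a * (u a * kap a) ^+ 2) + 3 * B ^+ 2 * n%:R * Y ^+ 2 * g.
  have : \sum_a F a * (D1 a / D) ^+ 2 <= \sum_a (3 * be ^+ 2 / w ^+ 2 * (F a * u a ^+ 2) +
     4 / 3 * q ^+ 2 * (F a * (u a * kap a) ^+ 2) + 3 * B ^+ 2 * Y ^+ 2 * g).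
    apply: ler_sum => a _; have /andP[Fa0 Fag] := Fg a; rewrite H1.
    have h := sqrD3_le (be * u a / w) (- (2 / 3 * q * (u a * kap a))) (- (B * y a)).
    have h2 : F a * y a ^+ 2 <= g * Y ^+ 2 by apply: ler_pM; rewrite ?sqr_ge0 // sqr_le_bound.
    have h3 := ler_wpM2l Fa0 h; have B2 : 0 <= 3 * B ^+ 2 by rewrite mulr_ge0 ?sqr_ge0.
    have h4 := ler_wpM2l B2 h2.
    apply: le_trans h3 _.
    rewrite [leLHS](_ : _ = 3 * be ^+ 2 / w ^+ 2 * (F a * u a ^+ 2) +
     4 / 3 * q ^+ 2 * (F a * (u a * kap a) ^+ 2) + 3 * B ^+ 2 * (F a * y a ^+ 2)); last by field; rewrite gt_eqF.
    by rewrite lerD2l; apply: le_trans h4 _; apply: eq_leW; ring.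
  rewrite !big_split /= -!mulr_sumr sumr_const card_ord -[_ *+ _]mulr_natl => h.
  by apply: le_trans h _; rewrite lerD2l; apply: eq_leW; ring.
set c := 2 / 3 * q0 * eps ^+ 2 / n%:R in good *.
have c0 : 0 < c by rewrite /c !mulr_gt0 ?exprn_gt0 ?invr_gt0.
set P := k + n%:R * C0 * M in E1 *; set Q := n%:R * C0 * (B * Y + M) in E1 *.
have P0 : 0 <= P by rewrite /P addr_ge0 // !mulr_ge0 // ltW.
have Q0 : 0 <= Q by rewrite /Q !mulr_ge0 // ?addr_ge0 ?mulr_ge0 // ltW.
have step : c * g * D ^+ 2 <= (be + 3 * be ^+ 2) / w ^+ 2 * (n%:R * g * M ^+ 2) +
   3 * B ^+ 2 * n%:R * Y ^+ 2 * g + be / w * P + 2 * C0 * D + Q.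
  have bw : 0 <= (be + 3 * be ^+ 2) / w ^+ 2.
    by rewrite divr_ge0 ?sqr_ge0 // addr_ge0 ?mulr_ge0 ?sqr_ge0 // ltW.
  have := ler_wpM2l bw b1; move: E1 b2 good.
  set s1 := \sum_a F a * u a ^+ 2; set s2 := \sum_a F a * (D1 a / D) ^+ 2.
  have -> : (be + 3 * be ^+ 2) / w ^+ 2 * s1 = be / w ^+ 2 * s1 + 3 * be ^+ 2 / w ^+ 2 * s1.
    by rewrite -mulrDl -mulrDl.
  lra.
have w2 : 0 < w ^+ 2 by rewrite exprn_gt0.
have step2 : c * g * (w * D) ^+ 2 <= ((be + 3 * be ^+ 2) * n%:R * M ^+ 2 +
   3 * B ^+ 2 * n%:R * Y ^+ 2 * M ^+ 2) * g + (be * M * P + Q * M ^+ 2) + 2 * C0 * M * (w * D).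
  have := ler_wpM2l (ltW w2) step.
  rewrite [leLHS](_ : _ = c * g * (w * D) ^+ 2); last by ring.
  move=> h; apply: le_trans h _.
  rewrite [leLHS](_ : _ = (be + 3 * be ^+ 2) * n%:R * M ^+ 2 * g + 3 * B ^+ 2 * n%:R * Y ^+ 2 * g * w ^+ 2
     + be * P * w + 2 * C0 * D * w * w + Q * w ^+ 2); last by field; rewrite gt_eqF.
  have wM2 : w ^+ 2 <= M ^+ 2 by apply: sqr_le_bound; rewrite gtr0_norm.
  have t1 : 3 * B ^+ 2 * n%:R * Y ^+ 2 * g * w ^+ 2 <= 3 * B ^+ 2 * n%:R * Y ^+ 2 * g * M ^+ 2.
    by rewrite ler_wpM2l // !mulr_ge0 ?sqr_ge0 // ltW.
  have t2 : be * P * w <= be * P * M by rewrite ler_wpM2l // mulr_ge0 // ltW.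
  have t3 : 2 * C0 * D * w * w <= 2 * C0 * D * w * M by rewrite ler_wpM2l // !mulr_ge0 // ltW.
  have t4 : Q * w ^+ 2 <= Q * M ^+ 2 by rewrite ler_wpM2l.
  lra.
apply: quadratic_bound c0 _ _ _ _.
- rewrite !addr_ge0 //.
  + have bb : 0 <= be + 3 * be ^+ 2 by rewrite addr_ge0 ?mulr_ge0 ?sqr_ge0 // ltW.
    by rewrite mulr_ge0 ?sqr_ge0 // mulr_ge0.
  + by rewrite !mulr_ge0 ?sqr_ge0 // ltW.
  + nonneg.
- nonneg.
- by rewrite mulr_ge0 // ltW.
rewrite -(ler_pM2r g1) mulrAC; apply: le_trans step2 _.
set X1 := (be + _) * _ * _ + _; set X2 := be * M * P + _.
rewrite [leRHS](_ : _ = X1 * g + X2 / g0 * g + (2 * C0 * M * (w * D)) / g0 * g); last by ring.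
(* Terms without the factor [g] become multiples of [g] through [g0 <= g], after which [g] divides
   out. *)
have gg : 1 <= g / g0 by rewrite ler_pdivlMr // mul1r.
have r1 (t : R) : 0 <= t -> t <= t / g0 * g.
  by move=> t0; rewrite mulrAC -mulrA ler_peMr.
by apply: lerD; [apply: lerD; rewrite ?r1 // /X2 | apply: r1]; nonneg.
Qed.

Lemma bernoulli_sub (c : R) k : 0 <= c <= 1 -> 1 - k%:R * c <= (1 - c) ^+ k.
Proof.
move=> /andP[c0 c1]; elim: k => [|k IH]; first by rewrite expr0 mul0r subr0.
rewrite exprS -natr1; have h : 0 <= 1 - c by lra.
have := ler_wpM2l h IH; have : 0 <= k%:R * c ^+ 2 by rewrite mulr_ge0 ?sqr_ge0.
set p := (1 - c) ^+ k; nra.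
Qed.

Lemma critical_eta_small (D eps : R) kap i1 : \sum_i kap i = D ->
  0 <= D -> 0 <= eps -> (forall i, i != i1 -> `|kap i| <= eps * D) ->
  `|D - kap i1| <= n%:R * eps * D.
Proof.
move=> kD D0 e0 h.
have -> : D - kap i1 = \sum_(i < n | i != i1) kap i by rewrite -kD (bigD1 i1) //= addrAC subrr add0r.
apply: le_trans (ler_norm_sum _ _ _) _.
apply: (@le_trans _ _ (\sum_(i < n) eps * D)).
  rewrite [leRHS](bigD1 i1) //= ler_wpDl ?mulr_ge0 //; exact: ler_sum.
by rewrite sumr_const card_ord -[_ *+ _]mulr_natl mulrA.
Qed.

(** All [D - kap i] with [i != i1] are close to [D], and as [k < n] there are at least [k] of them:
    their [k]-fold products alone give nearly [D ^+ k]. The products containing the small entry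
    [D - kap i1] lose at most a quarter of [D ^+ k]; [4 ^+ n] combines the count [2 ^+ n] of subsets
    with the powers of 2 from [D - kap i <= 2 * D]. *)
Lemma critical_intermediate (k : nat) (D eps A : R) kap i1 :
  (0 < k < n)%N -> \sum_i kap i = D -> 1 <= D -> 0 < eps -> 4 * n%:R * 4 ^+ n * eps <= 1 ->
  (forall i, i != i1 -> `|kap i| <= eps * D) ->
  esf [set: 'I_n] k (fun i => D - kap i) <= A -> D <= 2 * A.
Proof.
case: k => // k /andP[_ kn] kD D1 e0 en h.
rewrite (esfS _ _ (in_setT i1)); set S := _ :\ i1; set x := (fun i => D - kap i).
have N0 : (1 : R) <= n%:R by rewrite ler1n; apply: leq_ltn_trans kn.
have p4 : (1 : R) <= 4 ^+ n by rewrite exprn_ege1 // ler1n.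
have e1 : n%:R * eps <= 1 / 4 by nra.
have e2 : eps <= 1 / 4 by nra.
have D0 : 0 <= D by lra.
have cS : #|S| = n.-1 by rewrite /S cardsDS ?subsetT // cards1 cardsT card_ord subn1.
have xS i : i \in S -> (1 - eps) * D <= x i <= 2 * D.
  rewrite !inE andbT => /h; rewrite ler_norml /x => /andP[h1 h2].
  by apply/andP; split; nra.
have l1 : ((1 - eps) * D) ^+ k.+1 <= esf S k.+1 x.
  apply: esf_ge_exp => [||i /xS/andP[] //]; first by nra.
  by rewrite cS -ltnS prednK //; apply: leq_ltn_trans kn.
have l2 : esf S k x <= 2 ^+ n * (2 * D) ^+ k.
  apply: le_trans (esf_le_exp (c := 2 * D) _ _ _) _; last 2 first.
  - by lra.
  - rewrite ler_wpM2r ?exprn_ge0 //; first by lra.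
    by rewrite ler_weXn2l ?ler1n // cS leq_pred.
  - by move=> i /xS/andP[h1 h2]; apply/andP; split => //; apply: le_trans h1; nra.
have l3 : 0 <= esf S k x.
  apply: sumr_ge0 => J /andP[JS _]; apply: prodr_ge0 => j jJ.
  by have /andP[h1 _] := xS j (subsetP JS j jJ); apply: le_trans h1; nra.
have l4 := critical_eta_small kD D0 (ltW e0) h.
have l5 := bernoulli_sub k.+1 (_ : 0 <= eps <= 1).
have {}l5 : 1 - n%:R * eps <= (1 - eps) ^+ k.+1.
  apply: le_trans (l5 _); last by apply/andP; split; lra.
  by rewrite lerD2l lerN2 (ler_wpM2r (ltW e0)) // ler_nat ltnW.
have l6 : - (n%:R * eps * D) * (2 ^+ n * (2 * D) ^+ k) <= x i1 * esf S k x.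
  have c0 : 0 <= n%:R * eps * D by rewrite !mulr_ge0 // ltW.
  have := lerNnormlW l4; rewrite -/(x i1) => h1.
  by have := ler_wpM2r l3 h1; have := ler_wpM2l c0 l2; lra.
have pk : 1 <= D ^+ k by rewrite exprn_ege1.
have l7 : (2 : R) ^+ n * 2 ^+ k <= 4 ^+ n.
  rewrite (_ : (4 : R) = 2 * 2); last by ring.
  by rewrite exprMn ler_wpM2l ?exprn_ge0 // ler_weXn2l ?ler1n // ltnW // ltnW.
move=> hA; have : D ^+ k.+1 / 2 <= A.
  apply: le_trans hA; apply: le_trans (lerD l1 l6).
  rewrite !exprMn [X in _ <= _ + X](_ : _ = - (n%:R * eps * (2 ^+ n * 2 ^+ k) * D ^+ k.+1)); last by rewrite exprS; ring.
  rewrite -mulNr -mulrDl mulrC ler_wpM2r ?exprn_ge0 //.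
  have : n%:R * eps * (2 ^+ n * 2 ^+ k) <= n%:R * eps * 4 ^+ n by rewrite ler_wpM2l // mulr_ge0 // ltW.
  nra.
rewrite exprS; nra.
Qed.

(** For [k = n], dividing the full product, at most [A], by this bound forces [D - kap i1] below
    [2 * A / D]. *)
Lemma critical_prod_ge (D eps : R) kap i1 : (2 <= n)%N -> 1 <= D -> 0 < eps -> n%:R * eps <= 1 / 200 ->
  (forall i, i != i1 -> `|kap i| <= eps * D) -> D / 2 <= \prod_(i < n | i != i1) (D - kap i).
Proof.
move=> n2 D1 e0 en h; have D0 : 0 < D by lra.
have N1 : (1 : R) <= n%:R by rewrite ler1n ltnW.
have e1 : eps <= 1 / 200 by apply: le_trans en; rewrite ler_peMl // ltW.
apply: (@le_trans _ _ (\prod_(i < n | i != i1) ((1 - eps) * D))).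
  rewrite prodr_const; set c := #|_|.
  have cE : c = n.-1 by rewrite /c cardC1 card_ord.
  have hb : 1 - c%:R * eps <= (1 - eps) ^+ c by apply: bernoulli_sub; apply/andP; split; lra.
  have cn : c%:R * eps <= n%:R * eps by rewrite (ler_wpM2r (ltW e0)) // ler_nat cE leq_pred.
  have c1 : (0 < c)%N by rewrite cE -subn1 subn_gt0.
  have Dc : D <= D ^+ c by rewrite -(prednK c1) exprS; apply: ler_peMr; [exact: ltW | exact: exprn_ege1].
  rewrite exprMn mulrC; apply: ler_pM => //; lra.
apply: ler_prod => i /h; rewrite ler_norml => /andP[h1 h2]; apply/andP; split; last by lra.
by rewrite mulr_ge0 //; lra.
Qed.

Lemma sum_le_lincomb (P : pred 'I_n) (f1 f2 t h : 'I_n -> R) (a d b c : R) :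
  (forall l, P l -> a * f1 l + f2 l <= t l / d + b * h l + c) ->
  a * (\sum_(l | P l) f1 l) + \sum_(l | P l) f2 l <=
  (\sum_(l | P l) t l) / d + b * (\sum_(l | P l) h l) + \sum_(l < n | P l) c.
Proof. by move=> H; rewrite !mulr_sumr mulr_suml -!big_split /=; apply: ler_sum. Qed.

(* The third-order terms [G i1 ^ 2 * e l ^ 2 + 2 * G i1 * G l * z l ^ 2] come
   from the concavity of [ln det]; in this regime they dominate the gradient
   terms in the directions [l != i1], where [F l] is large. *)
Lemma critical_full (k w q be B D C0 M Y A eps : R) F G kap u y (D1 : 'I_n -> R) e z i1 :
  (2 <= n)%N -> 0 < w <= M -> 0 < q <= 1 -> 1 <= D -> 0 <= C0 -> 0 <= Y -> 0 < A -> 0 <= k ->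
  B = 4 * A * (2 * C0 + 1) -> 12 <= be -> 6 * n%:R * B * Y ^+ 2 <= be ->
  0 < eps -> 100 * n%:R ^+ 2 * eps <= 1 ->
  \sum_i kap i = D -> (forall i, i != i1 -> `|kap i| <= eps * D) ->
  (forall i, 0 < D - kap i) -> \prod_i (D - kap i) <= A ->
  (forall i, G i = (D - kap i)^-1) -> (forall a, F a = \sum_i G i - G a) ->
  (forall a, `|u a| <= M) -> (forall a, `|y a| <= Y) ->
  (forall a, D1 a / D = be * u a / w - 2 / 3 * q * (u a * kap a) - B * y a) ->
  (forall l, l != i1 -> D1 l = z l + e l) ->
  2 / 3 * q * (\sum_a F a * kap a ^+ 2) + 4 / 3 * q ^+ 2 * (\sum_a F a * (u a * kap a) ^+ 2)
    + B * (\sum_a F a) + (\sum_(l < n | l != i1) (G i1 ^+ 2 * e l ^+ 2 + 2 * G i1 * G l * z l ^+ 2)) / D <=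
  be / w ^+ 2 * (\sum_a F a * u a ^+ 2) + \sum_a F a * (D1 a / D) ^+ 2
    + be / w * (k + n%:R * C0 * M) + 2 * C0 * D + n%:R * C0 * (B * Y + M) ->
  w * D <= (2 * n%:R * ((be + 3 * be ^+ 2) * M ^+ 2 + 3 * B ^+ 2 * Y ^+ 2 * M ^+ 2) +
     (be * (k + n%:R * C0 * M) + n%:R * C0 * (B * Y + M) * M)) / 1 + 1.
Proof.
move=> n2 /andP[w0 wM] /andP[q0 q1] D1' C00 Y0 A0 k0 Bdef be12 beB e0 en kD hk etap etaA GE FE uM yY H1 Dze.
have D0 : 0 < D by lra.
have M0 : 0 < M by lra.
have B0 : 0 < B by rewrite Bdef !mulr_gt0 //; lra.
have be0 : 0 < be by lra.
have N2 : (2 : R) <= n%:R by rewrite ler_nat.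
have e1 : n%:R * eps <= 1 / 200 by nra.
have e2 : eps <= 1 / 400 by nra.
have Gp i : 0 < G i by rewrite GE invr_gt0.
set g := \sum_i G i in FE.
have gE : g = G i1 + \sum_(i < n | i != i1) G i by rewrite /g (bigD1 i1).
have eta1 : D - kap i1 <= n%:R * eps * D.
  by apply: le_trans (ler_norm _) _; apply: critical_eta_small; rewrite ?ltW.
have G1 : (n%:R * eps * D)^-1 <= G i1.
  by rewrite GE lef_pV2 ?posrE // !mulr_gt0 //; lra.
have Gl l : l != i1 -> ((1 + eps) * D)^-1 <= G l <= ((1 - eps) * D)^-1.
  move=> /hk; rewrite ler_norml => /andP[h1 h2]; rewrite GE !lef_pV2 ?posrE ?mulr_gt0 //; lra.
have sG (P : pred 'I_n) : (forall i, P i -> i != i1) -> \sum_(i < n | P i) G i <= n%:R * ((1 - eps) * D)^-1.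
  move=> hP; apply: (@le_trans _ _ (\sum_(i < n) ((1 - eps) * D)^-1)).
    rewrite big_mkcond; apply: ler_sum => i _; case: ifP => [/hP/Gl/andP[] //|_].
    by rewrite invr_ge0 mulr_ge0 //; lra.
  by rewrite sumr_const card_ord -[_ *+ _]mulr_natl.
have sD : n%:R * ((1 - eps) * D)^-1 <= 2 * n%:R / D.
  rewrite invfM mulrA ler_pM2r ?invr_gt0 // mulrC ler_pM2r; last by lra.
  by rewrite -[leRHS]invrK lef_pV2 ?posrE ?invr_gt0 //; lra.
have F0 a : 0 <= F a.
  rewrite FE /g (bigD1 a) //= addrAC subrr add0r; apply: sumr_ge0 => i _; exact: ltW.
have Fg a : F a <= g by rewrite FE lerBlDr lerDl ltW.
have F1 : F i1 <= 2 * n%:R / D.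
  by apply: le_trans sD; rewrite FE gE addrAC subrr add0r; apply: sG.
(* [G i1] dominates: by the smallness of [eps] the other weights sum to at most a tenth of it. *)
have Fl l : l != i1 -> F l <= 11 / 10 * G i1.
  move=> li; rewrite FE gE (bigD1 l) //= [G l + _]addrC addrA addrK.
  have h1 : \sum_(i < n | (i != i1) && (i != l)) G i <= n%:R * ((1 - eps) * D)^-1.
    by apply: sG => i /andP[].
  have h2 : n%:R * ((1 - eps) * D)^-1 <= 1 / 10 * (n%:R * eps * D)^-1.
    rewrite -(ler_pM2r (_ : 0 < D)) // -(ler_pM2r (_ : 0 < n%:R * eps)); last by rewrite mulr_gt0 //; lra.
    rewrite [leRHS](_ : _ = 1 / 10); last by field; rewrite !gt_eqF //; lra.
    rewrite [leLHS](_ : _ = n%:R ^+ 2 * eps / (1 - eps)); last by field; rewrite !gt_eqF //; lra.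
    rewrite ler_pdivrMr; lra.
  by move: h1 h2 G1; set t := (n%:R * eps * D)^-1; lra.
(* The factor [5 / 4] leaves a surplus of one quarter, spent below on a term with coefficient
   [3 / be <= 1 / 4]. *)
have third l : l != i1 -> 5 / 4 * (F l * (D1 l / D) ^+ 2) <=
    (G i1 ^+ 2 * e l ^+ 2 + 2 * G i1 * G l * z l ^+ 2) / D.
  move=> li; rewrite Dze // -(ler_pM2r (_ : 0 < D ^+ 2)) ?exprn_gt0 //.
  rewrite [leLHS](_ : _ = 5 / 4 * F l * (z l + e l) ^+ 2); last by field; rewrite gt_eqF.
  rewrite [leRHS](_ : _ = G i1 * ((G i1 * D) * e l ^+ 2 + 2 * (G l * D) * z l ^+ 2)); last by field; rewrite gt_eqF.
  have g1 : 20 <= G i1 * D.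
    rewrite -ler_pdivrMr // (le_trans _ G1) // invfM ler_pM2r ?invr_gt0 //.
    rewrite -[leLHS]invrK lef_pV2 ?posrE ?invr_gt0 ?mulr_gt0 //; lra.
  have g2 : 9 / 10 <= G l * D.
    have /andP[h _] := Gl l li; rewrite -ler_pdivrMr // (le_trans _ h) // invfM ler_pM2r ?invr_gt0 //.
    rewrite -[leLHS]invrK lef_pV2 ?posrE ?invr_gt0 //; lra.
  (* The weights fit the two gains: [5/4 * 11/10 * 6/5 = 33/20] is below [2 * 9/10], and
     [5/4 * 11/10 * 6 = 33/4] is below 20. *)
  have h1 : (z l + e l) ^+ 2 <= 6 / 5 * z l ^+ 2 + 6 * e l ^+ 2.
    have : 0 <= 1 / 5 * (z l - 5 * e l) ^+ 2 by nonneg.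
    lra.
  have G1p := Gp i1.
  apply: (@le_trans _ _ (5 / 4 * (11 / 10 * G i1) * (6 / 5 * z l ^+ 2 + 6 * e l ^+ 2))).
    have f1 : 5 / 4 * F l <= 5 / 4 * (11 / 10 * G i1) by have := Fl l li; lra.
    by apply: (ler_pM _ _ f1 h1); nonneg.
  rewrite [leLHS](_ : _ = G i1 * (5 / 4 * (11 / 10) * (6 / 5 * z l ^+ 2 + 6 * e l ^+ 2))); last by ring.
  rewrite ler_pM2l //.
  have := ler_wpM2r (sqr_ge0 (e l)) g1; have := ler_wpM2r (sqr_ge0 (z l)) g2.
  have := sqr_ge0 (e l); have := sqr_ge0 (z l); set zz := z l ^+ 2; set ee := e l ^+ 2; lra.
have dir l : l != i1 -> be / w ^+ 2 * (F l * u l ^+ 2) + F l * (D1 l / D) ^+ 2 <=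
    (G i1 ^+ 2 * e l ^+ 2 + 2 * G i1 * G l * z l ^+ 2) / D + 4 / 3 * q ^+ 2 * (F l * (u l * kap l) ^+ 2)
    + B / (2 * n%:R) * g.
  move=> li; set r := D1 l / D.
  (* The critical point equation turns [be / w ^+ 2 * (F l * u l ^+ 2)] into squares with the small
     coefficient [3 / be], free of [w]. *)
  have uE : be * u l / w = r + 2 / 3 * q * (u l * kap l) + B * y l by rewrite /r H1; ring.
  have h1 : be / w ^+ 2 * (F l * u l ^+ 2) <= 3 / be * F l * (r ^+ 2 + (2 / 3 * q * (u l * kap l)) ^+ 2 + (B * y l) ^+ 2).
    rewrite [leLHS](_ : _ = 1 / be * F l * (be * u l / w) ^+ 2); last by field; rewrite !gt_eqF.
    rewrite uE [leRHS](_ : _ = 1 / be * F l * (3 * (r ^+ 2 + (2 / 3 * q * (u l * kap l)) ^+ 2 + (B * y l) ^+ 2))); last by ring.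
    by rewrite ler_wpM2l ?sqrD3_le // mulr_ge0 // divr_ge0 // ltW.
  have b3 : 3 / be <= 1 / 4 by rewrite ler_pdivrMr //; lra.
  have Fr : 0 <= F l * r ^+ 2 by rewrite mulr_ge0 ?sqr_ge0.
  have Fq : 0 <= F l * (2 / 3 * q * (u l * kap l)) ^+ 2 by rewrite mulr_ge0 ?sqr_ge0.
  have h2 := ler_wpM2r Fr b3; have h3 := ler_wpM2r Fq b3.
  have h4 : 3 / be * (F l * (B * y l) ^+ 2) <= B / (2 * n%:R) * g.
    apply: (@le_trans _ _ (3 / be * (g * (B * Y) ^+ 2))).
      rewrite ler_wpM2l ?divr_ge0 ?(ltW be0) //; apply: ler_pM; rewrite ?sqr_ge0 //.
      by apply: sqr_le_bound; rewrite normrM gtr0_norm // ler_pM2l.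
    rewrite [leLHS](_ : _ = (6 * n%:R * B * Y ^+ 2) / be * (B / (2 * n%:R) * g)); last by field; rewrite !gt_eqF //; lra.
    rewrite -[leRHS]mul1r ler_wpM2r //; last by rewrite ler_pdivrMr // mul1r.
    by rewrite mulr_ge0 ?sumr_ge0 ?divr_ge0 ?ltW // => [|i _]; [lra | exact: ltW].
  have h5 := third l li; rewrite -/r in h5.
  move: h1 h2 h3 h4 h5; rewrite !mulrDr.
  rewrite [3 / be * F l * r ^+ 2](_ : _ = 3 / be * (F l * r ^+ 2)); last by ring.
  rewrite [3 / be * F l * (2 / 3 * q * _) ^+ 2](_ : _ = 3 / be * (F l * (2 / 3 * q * (u l * kap l)) ^+ 2)); last by ring.
  rewrite [3 / be * F l * (B * y l) ^+ 2](_ : _ = 3 / be * (F l * (B * y l) ^+ 2)); last by ring.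
  rewrite [4 / 3 * q ^+ 2 * _](_ : _ = 3 * (F l * (2 / 3 * q * (u l * kap l)) ^+ 2)); last by field.
  lra.
have sum_dir : be / w ^+ 2 * (\sum_(l < n | l != i1) F l * u l ^+ 2) + \sum_(l < n | l != i1) F l * (D1 l / D) ^+ 2 <=
    (\sum_(l < n | l != i1) (G i1 ^+ 2 * e l ^+ 2 + 2 * G i1 * G l * z l ^+ 2)) / D +
    4 / 3 * q ^+ 2 * (\sum_(l < n | l != i1) F l * (u l * kap l) ^+ 2) + B / 2 * g.
  have h : \sum_(l < n | l != i1) B / (2 * n%:R) * g <= B / 2 * g.
    apply: (@le_trans _ _ (\sum_(l < n) B / (2 * n%:R) * g)).
      rewrite [leRHS](bigD1 i1) //= lerDr mulr_ge0 ?sumr_ge0 ?divr_ge0 ?ltW // => [|i _]; [lra | exact: ltW].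
    rewrite sumr_const card_ord -[_ *+ _]mulr_natl; apply: eq_leW.
    by field; rewrite gt_eqF //; lra.
  apply: (le_trans _ (lerD (lexx _) h)).
  move: dir; set c := B / (2 * n%:R) * g; clearbody c => dir.
  exact: sum_le_lincomb dir.
(* In the direction [i1] there is no third-order gain, but [F i1] omits the weight [G i1] and is
   only of order [1 / D]. *)
have first_dir : be / w ^+ 2 * (F i1 * u i1 ^+ 2) + F i1 * (D1 i1 / D) ^+ 2 <=
    4 / 3 * q ^+ 2 * (F i1 * (u i1 * kap i1) ^+ 2) +
    2 * n%:R / D * ((be + 3 * be ^+ 2) / w ^+ 2 * M ^+ 2 + 3 * B ^+ 2 * Y ^+ 2).
  have := sqrD3_le (be * u i1 / w) (- (2 / 3 * q * (u i1 * kap i1))) (- (B * y i1)).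
  rewrite -H1 => h; have h1 := ler_wpM2l (F0 i1) h.
  have bb : 0 <= (be + 3 * be ^+ 2) / w ^+ 2.
    by rewrite divr_ge0 ?sqr_ge0 // addr_ge0 ?mulr_ge0 ?sqr_ge0 // ltW.
  have h2 : F i1 * ((be + 3 * be ^+ 2) / w ^+ 2 * u i1 ^+ 2 + 3 * B ^+ 2 * y i1 ^+ 2) <=
     2 * n%:R / D * ((be + 3 * be ^+ 2) / w ^+ 2 * M ^+ 2 + 3 * B ^+ 2 * Y ^+ 2).
    apply: ler_pM => //; first by nonneg.
    apply: lerD; first by rewrite ler_wpM2l // sqr_le_bound.
    by apply: ler_wpM2l; [nonneg | exact: sqr_le_bound].
  apply: le_trans (lerD (lexx _) h1) _; rewrite [leLHS](_ : _ = 4 / 3 * q ^+ 2 * (F i1 * (u i1 * kap i1) ^+ 2) +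
     F i1 * ((be + 3 * be ^+ 2) / w ^+ 2 * u i1 ^+ 2 + 3 * B ^+ 2 * y i1 ^+ 2)); last by field; rewrite gt_eqF.
  by rewrite lerD2l.
have gD : D / (2 * A) <= g.
  have hp := critical_prod_ge n2 D1' e0 e1 hk.
  have h1 : (D - kap i1) * (D / 2) <= A.
    by apply: le_trans etaA; rewrite (bigD1 i1) //= ler_wpM2l // ltW.
  apply: (@le_trans _ _ (G i1)).
    rewrite GE -[leRHS]mul1r ler_pdivlMr // mulrC mulrA ler_pdivrMr ?mulr_gt0 //; lra.
  by rewrite gE lerDl sumr_ge0 // => i _; exact: ltW.
have sumF : g <= \sum_a F a.
  under eq_bigr do rewrite FE.
  rewrite sumrB sumr_const card_ord -/g -[_ *+ _]mulr_natl.
  have g0 : 0 <= g by rewrite /g sumr_ge0 // => i _; exact: ltW.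
  nra.
have A1 : 0 <= 2 / 3 * q * (\sum_a F a * kap a ^+ 2).
  by rewrite mulr_ge0 ?sumr_ge0 //; [lra | move=> i _; rewrite mulr_ge0 ?sqr_ge0].
set P := k + n%:R * C0 * M; set Q := n%:R * C0 * (B * Y + M).
have P0 : 0 <= P by rewrite /P addr_ge0 // !mulr_ge0 // ltW.
have Q0 : 0 <= Q by rewrite /Q !mulr_ge0 // ?addr_ge0 ?mulr_ge0 // ltW.
move=> E1; have main : D <= 2 * n%:R / D * ((be + 3 * be ^+ 2) / w ^+ 2 * M ^+ 2 + 3 * B ^+ 2 * Y ^+ 2) + be / w * P + Q.
  (* Half of [B * g] was spent on the directions [l != i1]. By [gD] the other half is at least
     [B * D / (4 * A)], which the choice of [B] makes equal to [2 * C0 * D] plus one spare [D]. *)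
  have Bg : (2 * C0 + 1) * D <= B / 2 * g.
    have := ler_wpM2l (_ : 0 <= B / 2) gD => /(_ ltac:(lra)) h; apply: le_trans h.
    by rewrite Bdef; apply: eq_leW; field; rewrite gt_eqF.
  have BF := ler_wpM2l (ltW B0) sumF.
  move: E1; rewrite [\sum_a F a * u a ^+ 2](bigD1 i1) //= [\sum_a F a * (D1 a / D) ^+ 2](bigD1 i1) //=.
  rewrite [\sum_a F a * (u a * kap a) ^+ 2](bigD1 i1) //= !(mulrDr (be / w ^+ 2)) (mulrDr (4 / 3 * q ^+ 2)).
  lra.
have w2D : 0 < w ^+ 2 * D by rewrite mulr_gt0 // exprn_gt0.
have step : 1 * (w * D) ^+ 2 <= 2 * n%:R * ((be + 3 * be ^+ 2) * M ^+ 2 + 3 * B ^+ 2 * Y ^+ 2 * M ^+ 2)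
    + (be * P + Q * M) * (w * D).
  have := ler_wpM2l (ltW w2D) main.
  rewrite [leLHS](_ : _ = 1 * (w * D) ^+ 2); last by ring.
  move=> h; apply: le_trans h _.
  rewrite [leLHS](_ : _ = 2 * n%:R * ((be + 3 * be ^+ 2) * M ^+ 2 + 3 * B ^+ 2 * Y ^+ 2 * w ^+ 2)
     + be * P * (w * D) + Q * (w * D) * w); last by field; rewrite !gt_eqF.
  have wM2 : w ^+ 2 <= M ^+ 2 by apply: sqr_le_bound; rewrite gtr0_norm.
  have t1 : 2 * n%:R * ((be + 3 * be ^+ 2) * M ^+ 2 + 3 * B ^+ 2 * Y ^+ 2 * w ^+ 2) <=
     2 * n%:R * ((be + 3 * be ^+ 2) * M ^+ 2 + 3 * B ^+ 2 * Y ^+ 2 * M ^+ 2).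
    apply: ler_wpM2l; first by nonneg.
    by rewrite lerD2l; apply: ler_wpM2l => //; nonneg.
  have t2 : Q * (w * D) * w <= Q * (w * D) * M by apply: ler_wpM2l => //; nonneg.
  lra.
apply: quadratic_bound step; rewrite ?ltr01 //.
- nonneg.
- nonneg.
- by rewrite mulr_ge0 // ltW.
Qed.

End Regimes.

(** * Choice of the constants and distinction of the regimes *)

Section Combination.
Context {R : realType} {n : nat}.
Implicit Types (kap u y z e S X L : 'I_n -> R).

Lemma sum_setT (T : finType) (f : T -> R) : \sum_(i in [set: T]) f i = \sum_i f i.
Proof. by apply: eq_bigl => i; rewrite in_setT. Qed.

(** Compare [x] with the constant vector [t = Num.max 1 A]: there [esf] is at least [t ^+ k], hence
    at least its value at [x], so the tangent inequality at [x] yields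
    [k <= t * \sum_i dlog_esf i]. *)
Lemma sum_dlog_esf_ge (T : finType) k (x : T -> R) (A : R) : (0 < k <= #|T|)%N ->
  gcone [set: T] k x -> esf [set: T] k x <= A ->
  (Num.max 1 A)^-1 <= \sum_i dlog_esf [set: T] k x i.
Proof.
move=> /andP[k0 kT] hx xA; set t := Num.max 1 A.
have t1 : 1 <= t by rewrite le_max lexx.
have tA : A <= t by rewrite le_max lexx orbT.
have t0 : 0 < t by apply: lt_le_trans t1.
have x0 : 0 < esf [set: T] k x by apply: hx.
have ht j : (j <= k)%N -> t ^+ j <= esf [set: T] j (fun=> t).
  by move=> jk; apply: esf_ge_exp => //; rewrite ?(ltW t0) // cardsT (leq_trans jk).
have ct : gcone [set: T] k (fun=> t).
  by move=> j jk; apply: lt_le_trans (ht j jk); rewrite exprn_gt0.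
have := ln_esf_tangent k0 hx ct.
have h1 : ln (esf [set: T] k x) <= ln (esf [set: T] k (fun=> t)).
  rewrite ler_ln ?posrE //; last by apply: ct.
  apply: le_trans xA (le_trans tA _); apply: le_trans (ht k (leqnn k)).
  by rewrite -(prednK k0) exprS ler_peMr ?(ltW t0) // exprn_ege1.
have e1 : \sum_(i in [set: T]) dlog_esf [set: T] k x i * (t - x i) = t * \sum_i dlog_esf [set: T] k x i - k%:R.
  rewrite -(sum_dlog_esf k0 hx) !sum_setT mulr_sumr -sumrB.
  by apply: eq_bigr => i _; rewrite mulrBr mulrC.
rewrite e1 => h2; have h3 : (1 : R) <= k%:R by rewrite ler1n.
rewrite -[leLHS]mulr1 mulrC ler_pdivrMr // mulrC; lra.
Qed.

(** All data of the maximum point are quantified after [C], [B] and [be]. The four entries of the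
    maximum defining [C] belong, in order, to [D <= 1], to an almost rank one Hessian with [k < n],
    to a second large eigenvalue, and to an almost rank one Hessian with [k = n]. *)
Lemma regimes_bound (k : nat) (M A C0 Y : R) : (2 <= k <= n)%N -> 0 < M -> 0 < A -> 0 <= C0 -> 0 <= Y ->
  exists (C B : R) (be : nat), [/\ 0 < B, (0 < be)%N & forall (w q D : R) kap u y (D1 : 'I_n -> R) S X L (T3 : 'I_n -> 'I_n -> R),
    let G := dlog_esf [set: 'I_n] k (fun i => D - kap i) in
    let F a := \sum_i G i - G a in
    0 < w <= M -> (M ^+ 2 + 1)^-1 <= q <= 1 -> \sum_i kap i = D ->
    gcone [set: 'I_n] k (fun i => D - kap i) -> esf [set: 'I_n] k (fun i => D - kap i) <= A ->
    (forall a, `|u a| <= M) -> (forall a, `|y a| <= Y) ->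
    (forall l, `|L l| <= C0) -> (forall l, `|X l| <= C0) ->
    (forall a, D1 a / D = be%:R * u a / w - 2 / 3 * q * (u a * kap a) - B * y a) ->
    (forall a, be%:R * (- kap a / w - (u a / w) ^+ 2) + (S a / D - (D1 a / D) ^+ 2)
     + 1 / 3 * (q * (2 * kap a ^+ 2 + 2 * \sum_l u l * T3 l a) + (q * (2 * u a * kap a)) ^+ 2)
     + B <= 0) ->
    (forall l, \sum_a F a * T3 l a = X l + L l * kap l) ->
    (1 <= D -> \sum_l L l * D1 l - C0 * (1 + D ^+ 2) <= \sum_a F a * S a) ->
    (1 <= D -> k = n -> forall i1, exists z, exists2 e, (forall l, l != i1 -> D1 l = z l + e l) &
      \sum_l L l * D1 l - C0 * (1 + D ^+ 2)
        + \sum_(l < n | l != i1) (G i1 ^+ 2 * e l ^+ 2 + 2 * G i1 * G l * z l ^+ 2) <= \sum_a F a * S a) ->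
    w * D <= C].
Proof.
move=> /andP[k2 kn] M0 A0 C00 Y0.
have n2 : (2 <= n)%N by apply: leq_trans kn.
have k0 : (0 < k)%N by apply: leq_trans k2.
have N0 : (0 : R) < n%:R by rewrite ltr0n; apply: leq_trans n2.
have N1 : (1 : R) <= n%:R by rewrite ler1n; apply: leq_trans n2.
pose B := 4 * A * (2 * C0 + 1).
have B0 : 0 < B by rewrite /B !mulr_gt0 //; lra.
have [be be0 [be1 be2]] : exists2 be : nat, (0 < be)%N & (12 : R) <= be%:R /\ 6 * n%:R * B * Y ^+ 2 <= be%:R.
  pose t := 12 + 6 * n%:R * B * Y ^+ 2.
  have t0 : 0 <= 6 * n%:R * B * Y ^+ 2 by nonneg.
  exists (Num.truncn t).+1 => //.
  have := truncnS_gt t; rewrite /t => h; split; lra.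
(* Small enough for [critical_full] through [en1] and for [critical_intermediate] through [en2]. *)
pose eps : R := (100 * n%:R ^+ 2 * 4 ^+ n)^-1.
have p4 : (1 : R) <= 4 ^+ n by rewrite exprn_ege1 // ler1n.
have e0 : 0 < eps by rewrite invr_gt0 !mulr_gt0 ?exprn_gt0.
have en1 : 100 * n%:R ^+ 2 * eps <= 1.
  by rewrite /eps ler_pdivrMr ?mul1r ?ler_peMr ?mulr_gt0 ?exprn_gt0 // mulr_ge0 ?sqr_ge0.
have en2 : 4 * n%:R * 4 ^+ n * eps <= 1.
  rewrite /eps ler_pdivrMr ?mul1r ?mulr_gt0 ?exprn_gt0 // ler_pM2r ?exprn_gt0 //; nra.
pose q0 : R := (M ^+ 2 + 1)^-1.
have q00 : 0 < q0 by rewrite invr_gt0 ltr_wpDl ?sqr_ge0.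
pose g0 : R := (Num.max 1 A)^-1.
have g00 : 0 < g0 by rewrite invr_gt0 lt_max ltr01.
pose b : R := be%:R.
pose C1 := (((b + 3 * b ^+ 2) * n%:R * M ^+ 2 + 3 * B ^+ 2 * n%:R * Y ^+ 2 * M ^+ 2
      + (b * M * (k%:R + n%:R * C0 * M) + n%:R * C0 * (B * Y + M) * M ^+ 2) / g0)
      + 2 * C0 * M / g0) / (2 / 3 * q0 * eps ^+ 2 / n%:R) + 1.
pose C2 := (2 * n%:R * ((b + 3 * b ^+ 2) * M ^+ 2 + 3 * B ^+ 2 * Y ^+ 2 * M ^+ 2) +
     (b * (k%:R + n%:R * C0 * M) + n%:R * C0 * (B * Y + M) * M)) / 1 + 1.
exists (Num.max (Num.max M (M * (2 * A))) (Num.max C1 C2)), B, be; split=> //.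
move=> w q D kap u y D1 S X L T3 G F /andP[w0 wM] /andP[q0q q1] kD gc eA uM yY LC XC H1 H2 H3 H4 H5.
rewrite !le_max -!orbA; have [Dle|D1'] := lerP D 1.
  by rewrite (le_trans (_ : _ <= w)) ?wM // ger_pMr.
have {}D1' := ltW D1'; have D0 : 0 < D by lra.
have qp : 0 < q by apply: lt_le_trans q0q.
have Gp i : 0 < G i by apply: dlog_esf_gt0.
pose g := \sum_i G i.
have F0 a : 0 <= F a.
  by rewrite /F (bigD1 a) //= addrAC subrr add0r sumr_ge0 // => i _; exact: ltW.
have Fg a : F a <= g by rewrite lerBlDr lerDl ltW.
have gg : g0 <= g by apply: sum_dlog_esf_ge => //; rewrite card_ord k0.
have Gk : \sum_i G i * kap i = g * D - k%:R.
  rewrite -(sum_dlog_esf k0 gc) sum_setT mulr_suml -sumrB.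
  by apply: eq_bigr => i _; rewrite -/G; ring.
have Fk : \sum_a F a * kap a = k%:R.
  transitivity (g * (\sum_i kap i) - (g * D - k%:R)); last by rewrite kD; ring.
  by rewrite -Gk mulr_sumr -sumrB; apply: eq_bigr => a _; rewrite -mulrBl.
have be0' : 0 < b by rewrite ltr0n.
have main Tex : \sum_l L l * D1 l - C0 * (1 + D ^+ 2) + Tex <= \sum_a F a * S a ->
  2 / 3 * q * (\sum_a F a * kap a ^+ 2) + 4 / 3 * q ^+ 2 * (\sum_a F a * (u a * kap a) ^+ 2)
    + B * (\sum_a F a) + Tex / D <=
  b / w ^+ 2 * (\sum_a F a * u a ^+ 2) + \sum_a F a * (D1 a / D) ^+ 2
    + b / w * (k%:R + n%:R * C0 * M) + 2 * C0 * D + n%:R * C0 * (B * Y + M).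
  move=> H; have qq : 0 < q <= 1 by rewrite qp.
  exact: (master_inequality w0 qq be0' B0 D1' C00 (ltW M0) Y0 F0 Fk erefl uM yY LC XC H1 H2 H3 H).
have E0 : 2 / 3 * q * (\sum_a F a * kap a ^+ 2) + 4 / 3 * q ^+ 2 * (\sum_a F a * (u a * kap a) ^+ 2) <=
  b / w ^+ 2 * (\sum_a F a * u a ^+ 2) + \sum_a F a * (D1 a / D) ^+ 2
    + b / w * (k%:R + n%:R * C0 * M) + 2 * C0 * D + n%:R * C0 * (B * Y + M).
  have h := main 0; rewrite mul0r !addr0 in h; apply: le_trans (h (H4 D1')).
  by rewrite lerDl mulr_ge0 ?(ltW B0) // sumr_ge0.
have i0 : 'I_n by exists 0; apply: leq_trans n2.
have [i1 _ hi1] := @arg_maxP _ _ _ i0 xpredT kap isT.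
have [/existsP[i /andP[ii1 ki]]|] := boolP [exists i, (i != i1) && (eps * D <= `|kap i|)].
  apply/orP; right; apply/orP; right; apply/orP; left.
  apply: (@noncritical_bound _ _ k%:R w q q0 b B D C0 M Y g g0 eps F kap u y D1 i) => //.
  - by rewrite w0.
  - by rewrite q00.
  - by rewrite g00.
  - by move=> a; rewrite F0 Fg.
  (* [kap i1] is the largest eigenvalue, so [G i1] is the largest weight; since [i != i1], it is
     among the terms of [F i]. *)
  have G1 j : G j <= G i1.
    by apply: dlog_esf_anti => //; rewrite lerD2l lerN2; apply: hi1.
  apply: (@le_trans _ _ (n%:R * G i1)).
    by rewrite mulr_natl -[X in _ *+ X]card_ord -sumr_const; apply: ler_sum => j _.
  rewrite ler_pM2l // /F /g (bigD1 i) //= addrAC subrr add0r (bigD1 i1) ?(eq_sym i1) //=.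
  by rewrite lerDl sumr_ge0 // => j _; exact: ltW.
rewrite negb_exists => /forallP hc.
have {}hc i : i != i1 -> `|kap i| <= eps * D.
  by move=> ii; have := hc i; rewrite ii /= -ltNge => /ltW.
have [kn'|kn'] := ltnP k n.
  have hD := critical_intermediate (_ : (0 < k < n)%N) kD D1' e0 en2 hc eA.
  by rewrite ler_pM ?(ltW w0) ?(ltW D0) ?hD ?orbT // k0.
have {kn'}kn' : k = n by apply/eqP; rewrite eqn_leq kn.
have [z [e ze H]] := H5 D1' kn' i1.
have kc : k = #|{: 'I_n}| by rewrite card_ord.
have gc' : gcone [set: 'I_n] #|{: 'I_n}| (fun i => D - kap i) by rewrite -kc.
have etap i : 0 < D - kap i by exact: (gcone_full_gt0 i gc').
have etaA : \prod_i (D - kap i) <= A by rewrite -esf_full -kc.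
apply/orP; right; apply/orP; right; apply/orP; right.
apply: (@critical_full _ _ k%:R w q b B D C0 M Y A eps F G kap u y D1 e z i1) => //.
- by rewrite w0.
- by rewrite qp.
- by move=> i; rewrite /G kc dlog_esf_full.
- exact: main.
Qed.

End Combination.

(** * Symmetric matrices *)

Section RowReduction.
Context {R : comNzRingType} {n : nat} (i1 : 'I_n) (c : 'I_n -> R).

(** Congruence by this unipotent matrix preserves the determinant and, among the diagonal entries,
    changes only the one at [i1]; it serves to sharpen one factor in Hadamard's bound. *)
Definition row_reduction : 'M[R]_n :=
  1%:M - \matrix_(i, j) if (i == i1) && (j != i1) then c j else 0.
Local Notation C := (\matrix_(i, j) if (i == i1) && (j != i1) then c j else 0).

Lemma det_row_reduction : \det row_reduction = 1.
Proof.
rewrite (expand_det_col _ i1) (bigD1 i1) //= big1 => [|i ii].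
  rewrite !mxE !eqxx subr0 mul1r addr0 /cofactor -signr_odd addnn odd_double mul1r.
  have -> : row' i1 (col' i1 row_reduction) = 1%:M; last exact: det1.
  by apply/matrixP => a b; rewrite !mxE (inj_eq lift_inj) [lift i1 a == i1]eq_sym (negbTE (neq_lift _ _)) subr0.
by rewrite !mxE (negbTE ii) subr0 mul0r.
Qed.

Lemma row_reduction_diag (N : 'M[R]_n) i : i != i1 -> (row_reduction *m N *m row_reduction^T) i i = N i i.
Proof.
move=> ii; have rE (B : 'M[R]_n) j : (row_reduction *m B) i j = B i j.
  rewrite mulmxBl mul1mx [LHS]mxE [X in _ + X]mxE [X in - X]mxE big1 ?subr0 // => a _.
  by rewrite mxE (negbTE ii) mul0r.
rewrite -mulmxA rE -[N]trmxK -trmx_mul mxE rE !mxE //.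
Qed.

Lemma row_reduction_pivot (N : 'M[R]_n) : N^T = N ->
  (row_reduction *m N *m row_reduction^T) i1 i1 = N i1 i1 - 2 * (\sum_(q | q != i1) c q * N i1 q)
    + \sum_(q | q != i1) \sum_(s | s != i1) c q * c s * N q s.
Proof.
move=> sN; have CN (B : 'M[R]_n) j : (C *m B) i1 j = \sum_(q | q != i1) c q * B q j.
  rewrite mxE [RHS]big_mkcond; apply: eq_bigr => q _; rewrite mxE eqxx /=.
  by case: ifP => // _; rewrite mul0r.
have NN q : N q i1 = N i1 q by rewrite -[in LHS]sN mxE.
have -> : row_reduction *m N *m row_reduction^T = N - C *m N - (C *m N)^T + C *m (C *m N)^T.
  rewrite /row_reduction linearB /= trmx1 mulmxBl mul1mx mulmxBr mulmx1 mulmxBl trmx_mul sN opprB.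
  by rewrite !mulmxA addrA addrAC.
have e1 : (C *m N) i1 i1 = \sum_(q | q != i1) c q * N i1 q by rewrite CN; under eq_bigr do rewrite NN.
have e2 : (C *m (C *m N)^T) i1 i1 = \sum_(q | q != i1) \sum_(s | s != i1) c q * c s * N q s.
  rewrite CN; apply: eq_bigr => q _; rewrite mxE CN mulr_sumr; apply: eq_bigr => s _.
  by rewrite -[in LHS]sN mxE mulrA.
move: e1 e2; set C1 := C *m N; set C2 := C *m C1^T => e1 e2.
move: e1 e2; move: C1 C2 => C1 C2 e1 e2; by rewrite !mxE e1 e2; ring.
Qed.

End RowReduction.

From mathcomp Require Import all_classical all_reals all_analysis.
Import numFieldNormedType.Exports.
Local Open Scope classical_set_scope.
Local Open Scope ring_scope.

(** * Rearrangement inequality for doubly stochastic matrices *)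

Section Rearrangement.
Context {R : realFieldType}.

Lemma sorting_perm n (f : 'I_n -> R) :
  exists s : {perm 'I_n}, forall i j : 'I_n, (i <= j)%N -> f (s i) <= f (s j).
Proof.
pose le i j := f i <= f j; pose r := sort le (enum 'I_n).
have sz : size r = n by rewrite size_sort size_enum_ord.
have ur : uniq r by rewrite sort_uniq enum_uniq.
have inj : injective (fun i : 'I_n => nth i r i).
  move=> i j /eqP; rewrite (set_nth_default i) ?sz //.
  by rewrite nth_uniq ?sz // => /eqP h; apply/val_inj.
exists (perm inj) => i j ij; rewrite !permE (set_nth_default i j) ?sz //.
have tle : total le by move=> a b; apply: le_total.
have rle : reflexive le by move=> a; apply: lexx.
have trle : transitive le by move=> a b c; apply: le_trans.
by apply: (sorted_leq_nth trle rle i (sort_sorted tle _)) => //; rewrite inE sz.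
Qed.

(** Summation by parts: a nonnegative partial sum only gains when its weight rises from [g n.+1] to
    [g n]. *)
Lemma abel_ge0 (g y : nat -> R) n :
  (forall i j, (i <= j <= n)%N -> g j <= g i) ->
  (forall p, (p <= n)%N -> 0 <= \sum_(i < p) y i) ->
  g n * (\sum_(i < n.+1) y i) <= \sum_(i < n.+1) g i * y i.
Proof.
elim: n => [|n IH] gd Y; first by rewrite !big_ord1.
rewrite !(big_ord_recr n.+1) /= mulrDr lerD2r.
apply: le_trans (IH _ _); last 2 first.
- by move=> i j /andP[ij jn]; apply: gd; rewrite ij leqW.
- by move=> p pn; apply/Y/leqW.
by rewrite ler_wpM2r ?gd ?leqnSn //=; apply: Y.
Qed.

(** Doubly stochastic averaging can only raise the sum of the first [p] entries of an increasing
    sequence: the column weights lie between 0 and 1 and total [p], so after subtracting the entry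
    at [p] from every [l j] each term of the difference is nonnegative. The full sum is unchanged,
    and Abel summation against the decreasing [g] concludes. *)
Lemma sorted_rearrangement n (g l : 'I_n -> R) (D : 'I_n -> 'I_n -> R) :
  (forall i j : 'I_n, (i <= j)%N -> g j <= g i) -> (forall i j : 'I_n, (i <= j)%N -> l i <= l j) ->
  (forall i j, 0 <= D i j) ->
  (forall i, \sum_j D i j = 1) -> (forall j, \sum_i D i j = 1) ->
  \sum_i g i * l i <= \sum_i g i * \sum_j D i j * l j.
Proof.
case: n g l D => [|n] g l D gd li D0 Dr Dc; first by rewrite !big_ord0.
rewrite -subr_ge0 -sumrB; under eq_bigr do rewrite -mulrBr.
pose y i := \sum_j D i j * l j - l i.
have part p : \sum_(i < n.+1 | (i < p)%N) y i =
    \sum_j (\sum_(i < n.+1 | (i < p)%N) D i j - (j < p)%N%:R) * l j.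
  rewrite sumrB exchange_big /= [X in _ - X]big_mkcond -sumrB; apply: eq_bigr => j _.
  rewrite mulrBl -mulr_suml; congr (_ - _); case: ifP => _; by rewrite ?mul1r ?mul0r.
have tot p : \sum_j (\sum_(i < n.+1 | (i < p)%N) D i j - (j < p)%N%:R) = 0.
  rewrite sumrB exchange_big /= (eq_bigr (fun=> 1)) // [X in X - _]big_mkcond /=.
  by rewrite -sumrB big1 // => i _; case: ifP => _; rewrite subrr.
have Yge p : (p <= n)%N -> 0 <= \sum_(i < n.+1 | (i < p)%N) y i.
  move=> pn; rewrite part.
  have -> : \sum_j (\sum_(i < n.+1 | (i < p)%N) D i j - (j < p)%N%:R) * l j =
     \sum_j (\sum_(i < n.+1 | (i < p)%N) D i j - (j < p)%N%:R) * (l j - l (inord p)).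
    under [RHS]eq_bigr do rewrite mulrBr.
    by rewrite sumrB -mulr_suml tot mul0r subr0.
  apply: sumr_ge0 => j _; have [jp|pj] := ltnP j p.
    rewrite -mulrNN mulr_ge0 // oppr_ge0 subr_le0.
      by rewrite -(Dc j) [leRHS](bigID (fun i : 'I_n.+1 => (i < p)%N)) /= lerDl sumr_ge0.
    by apply: li; rewrite inordK ?ltnS // ltnW.
  rewrite subr0 mulr_ge0 ?sumr_ge0 // subr_ge0 li // inordK ?ltnS //.
have e (z : 'I_n.+1 -> R) p : (p <= n.+1)%N -> \sum_(i < p) z (inord i) = \sum_(i < n.+1 | (i < p)%N) z i.
  move=> pn; rewrite (big_ord_widen _ (fun i => z (inord i)) pn).
  by apply: eq_bigr => i _; rewrite inord_val.
have := @abel_ge0 (g \o inord) (y \o inord) n; rewrite /=.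
have -> : \sum_(i < n.+1) y (inord i) = 0.
  rewrite e // part big1 // => j _; rewrite ltn_ord.
  by under eq_bigl do rewrite ltn_ord; rewrite Dc subrr mul0r.
rewrite mulr0 => h; rewrite (eq_bigr (fun i : 'I_n.+1 => g (inord i) * y (inord i))); last first.
  by move=> i _; rewrite inord_val.
apply: h => [i j /andP[ij jn]|p pn]; last by rewrite e ?leqW // Yge.
by apply: gd; rewrite !inordK // ltnS // (leq_trans ij).
Qed.

(** The permutation is the one pairing [g] and [l] in opposite orders; sorting both reduces to the
    ordered case, with no decomposition of [D] into permutation matrices. *)
Lemma rearrangement n (g l : 'I_n -> R) (D : 'I_n -> 'I_n -> R) :
  (forall i j, 0 <= D i j) ->
  (forall i, \sum_j D i j = 1) -> (forall j, \sum_i D i j = 1) ->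
  exists s : {perm 'I_n}, \sum_i g i * l (s i) <= \sum_i g i * \sum_j D i j * l j.
Proof.
move=> D0 Dr Dc.
have [a ha] := sorting_perm (fun i => - g i); have [b hb] := sorting_perm l.
exists (a^-1 * b)%g.
rewrite (reindex_inj (@perm_inj _ a)) /= [leRHS](reindex_inj (@perm_inj _ a)) /=.
have := @sorted_rearrangement n (g \o a) (l \o b) (fun i j => D (a i) (b j)).
rewrite /= => h; under eq_bigr do rewrite permM permK.
rewrite [leRHS](eq_bigr (fun i => g (a i) * (\sum_j D (a i) (b j) * l (b j)))); last first.
  by move=> i _; congr (_ * _); rewrite [LHS](reindex_inj (@perm_inj _ b)).
apply: h => // [i j ij|i|j]; first by rewrite -lerN2 ha.
  by rewrite -(Dr (a i)) [RHS](reindex_inj (@perm_inj _ b)).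
by rewrite -(Dc (b j)) [RHS](reindex_inj (@perm_inj _ a)).
Qed.

End Rearrangement.

(** * Orthogonal diagonalization of real symmetric matrices *)

Section Spectral.
Context {R : realType}.

(** The reflection along [w = e_0 - v] exchanges the two unit vectors; its coefficient [2 / |w|^2]
    is [(1 - v 0 0)^-1]. When [v] is already [e_0], the identity serves. *)
Lemma householder n (v : 'rV[R]_n.+1) : (v *m v^T) 0 0 = 1 ->
  exists2 Q : 'M[R]_n.+1, Q *m Q^T = 1%:M & row 0 Q = v.
Proof.
move=> hv; pose w : 'rV[R]_n.+1 := delta_mx 0 0 - v.
have vv : v *m v^T = 1%:M by apply/matrixP => i j; rewrite !ord1 hv mxE.
have dv : delta_mx 0 0 *m v^T = (v 0 0)%:M :> 'M[R]_1.
  by apply/matrixP => i j; rewrite !ord1 -rowE !mxE.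
have vd : v *m (delta_mx 0 0)^T = (v 0 0)%:M :> 'M[R]_1.
  by rewrite -[LHS]trmxK trmx_mul trmxK dv tr_scalar_mx.
have dd : delta_mx 0 0 *m (delta_mx 0 0 : 'rV[R]_n.+1)^T = 1%:M :> 'M[R]_1.
  by apply/matrixP => i j; rewrite !ord1 -rowE !mxE !eqxx.
have ww : w *m w^T = (2 - 2 * v 0 0)%:M.
  rewrite /w linearB /= mulmxBl !mulmxBr dd dv vd vv -!raddfB /=; congr (_%:M); ring.
have dw : delta_mx 0 0 *m w^T = (1 - v 0 0)%:M :> 'M[R]_1.
  by rewrite /w linearB /= mulmxBr dd dv -raddfB.
have [v1|v1] := eqVneq (v 0 0) 1.
  exists 1%:M; first by rewrite trmx1 mulmx1.
  have w0 : w = 0.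
    have : \sum_j w 0 j ^+ 2 = 0.
      have := congr1 (fun M : 'M[R]_1 => M 0 0) ww; rewrite v1 mulr1 subrr !mxE /= mul0rn => h.
      by rewrite -[RHS]h; apply: eq_bigr => j _; rewrite !mxE expr2.
    move=> /psumr_eq0P h; apply/rowP => j; rewrite [RHS]mxE; apply/eqP; rewrite -sqrf_eq0.
    by apply/eqP/h => // i _; exact: sqr_ge0.
  by rewrite row1 -[RHS]addr0 -w0 /w addrC subrK.
have c0 : 1 - v 0 0 != 0 by rewrite subr_eq0 eq_sym.
have ew : w = delta_mx 0 0 - v by [].
clearbody w.
pose Q : 'M[R]_n.+1 := 1%:M - (1 - v 0 0)^-1 *: (w^T *m w).
have QT : Q^T = Q by rewrite /Q linearB /= trmx1 linearZ /= trmx_mul trmxK.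
exists Q.
  rewrite QT /Q mulmxBl mul1mx mulmxBr mulmx1 -scalemxAl -scalemxAr !mulmxA -(mulmxA w^T).
  rewrite ww mul_mx_scalar -scalemxAl !scalerA -[X in _ - X]scalerBl -addrA -opprD -scalerDl.
  by rewrite [X in X *: _](_ : _ = 0) ?scale0r ?subr0 //; field.
rewrite rowE /Q mulmxBr mulmx1 -scalemxAr mulmxA dw mul_scalar_mx scalerA mulVf // scale1r.
by rewrite ew opprB addrC subrK.
Qed.

(** [real_sym_split] provides the eigenvalues only. A unit eigenvector is completed to an orthogonal
    matrix by [householder]; symmetry clears the first column together with the first row, and
    induction treats the remaining block. *)
Lemma real_sym_spectral n (A : 'M[R]_n) : A^T = A ->
  exists P : 'M[R]_n, exists2 d : 'rV[R]_n, P *m P^T = 1%:M & A = P^T *m diag_mx d *m P.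
Proof.
elim: n A => [|n IH] A sA.
  by exists 1%:M, 0; [rewrite trmx1 mulmx1 | apply/matrixP => -[]].
have [l hl] := real_sym_split sA.
have : eigenvalue A (l 0 0).
  rewrite eigenvalue_root_char hl big_ord_recl /root hornerM.
  by rewrite hornerXsubC subrr mul0r.
move=> /eigenvalueP[v0 hv0 v0n].
have nv : 0 < (v0 *m v0^T) 0 0.
  rewrite mxE lt_neqAle sumr_ge0 ?andbT; last by move=> i _; rewrite mxE -expr2 sqr_ge0.
  apply: contra v0n => /eqP /esym /psumr_eq0P h; apply/eqP/rowP => i.
  have := h _ i; rewrite !mxE => /(_ _ isT) hi; apply/eqP.
  by rewrite -sqrf_eq0 expr2 hi // => j _; rewrite mxE -expr2 sqr_ge0.
pose v := (Num.sqrt ((v0 *m v0^T) 0 0))^-1 *: v0.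
have vv : (v *m v^T) 0 0 = 1.
  rewrite /v linearZ /= -scalemxAl -scalemxAr scalerA mxE -invfM -expr2.
  by rewrite sqr_sqrtr ?mulVf ?gt_eqF ?ltW.
have vA : v *m A = l 0 0 *: v by rewrite /v -scalemxAl hv0 scalerA mulrC -scalerA.
have [Q QQ Q0] := householder vv.
have QQ' : Q^T *m Q = 1%:M by apply: mulmx1C.
pose B : 'M[R]_(1 + n) := Q *m A *m Q^T.
have sB : B^T = B by rewrite /B !trmx_mul trmxK sA mulmxA.
have B0 : row 0 B = l 0 0 *: delta_mx 0 0.
  rewrite /B !row_mul Q0 vA -scalemxAl; congr (_ *: _).
  by rewrite -Q0 -row_mul QQ row1.
have Bur : ursubmx B = 0.
  apply/matrixP => i j; rewrite !mxE ord1.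
  have := congr1 (fun M : 'rV[R]_n.+1 => M 0 (rshift 1 j)) B0.
  rewrite !mxE /= => h; rewrite (_ : lshift n 0 = 0); last exact/val_inj.
  by rewrite h mulr0.
have Bul : ulsubmx B = (l 0 0)%:M.
  apply/matrixP => i j; rewrite !mxE !ord1.
  have := congr1 (fun M : 'rV[R]_n.+1 => M 0 0) B0.
  rewrite !mxE /= mulr1 => h; rewrite (_ : lshift n 0 = 0); last exact/val_inj.
  by rewrite h mulr1n.
have Bdl : dlsubmx B = 0 by rewrite -sB -trmx_ursub Bur trmx0.
have [P' [d' PP' hd']] : exists P : 'M[R]_n, exists2 d : 'rV[R]_n, P *m P^T = 1%:M & drsubmx B = P^T *m diag_mx d *m P.
  by apply: IH; rewrite trmx_drsub sB.
have eB : B = (block_mx 1 0 0 P')^T *m diag_mx (row_mx (l 0 0)%:M d') *m block_mx 1 0 0 P'.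
  rewrite -[LHS]submxK Bul Bur Bdl hd' tr_block_mx !trmx0 trmx1 diag_mx_row.
  rewrite !mulmx_block !mul1mx !mulmx1 !mul0mx !mulmx0 !addr0 !add0r !mul0mx.
  congr block_mx; apply/matrixP => i j; rewrite !ord1 !mxE //.
have CC : (block_mx 1 0 0 P' : 'M[R]_(1 + n)) *m (block_mx 1 0 0 P')^T = 1%:M.
  rewrite tr_block_mx !trmx0 trmx1 mulmx_block.
  by rewrite !mul1mx !mul0mx !mulmx0 !addr0 !add0r PP' -scalar_mx_block.
move: CC eB; rewrite /B.
move: (block_mx _ _ _ _) (row_mx _ _) => /= C d; rewrite -[(1 + n)%N]/n.+1 in C d *.
move=> CC eB; exists (C *m Q); exists d.
  by rewrite trmx_mul mulmxA -(mulmxA C) QQ mulmx1.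
have -> : (C *m Q)^T *m diag_mx d *m (C *m Q) = Q^T *m (C^T *m diag_mx d *m C) *m Q.
  by rewrite trmx_mul !mulmxA.
by rewrite -eB !mulmxA QQ' mul1mx -mulmxA QQ' mulmx1.
Qed.

End Spectral.

Lemma ln_prod {R : realType} (I : Type) (s : seq I) (a : I -> R) : (forall i, 0 < a i) ->
  ln (\prod_(i <- s) a i) = \sum_(i <- s) ln (a i).
Proof.
move=> a0; elim: s => [|i s IH]; first by rewrite !big_nil ln1.
by rewrite !big_cons lnM ?posrE ?IH // prodr_gt0.
Qed.

(** * Tangent and Hadamard bounds for [ln sigma_k] of a symmetric matrix *)

Section MatrixConcavity.
Context {R : realType} {n : nat}.
Implicit Types (A P Q E : 'M[R]_n) (d l : 'rV[R]_n).

Lemma sigma_esf k l : sigma k l = esf [set: 'I_n]%SET k (l 0).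
Proof. by apply: eq_bigl => J; rewrite finset.subsetT. Qed.

Lemma orthogonal_invmx P : P *m P^T = 1%:M -> P \in unitmx /\ invmx P = P^T.
Proof.
move=> h; have [u1 u2] := mulmx1_unit h; split => //.
by rewrite -[LHS]mulmx1 -h mulmxA mulVmx // mul1mx.
Qed.

(** [eigenvals] fixes no order. The roots of the characteristic polynomial are unique up to a
    permutation, which [esf] ignores. *)
Lemma sigma_eigenvals k A P d : P *m P^T = 1%:M -> A = P^T *m diag_mx d *m P ->
  sigma k (eigenvals A) = esf [set: 'I_n]%SET k (d 0).
Proof.
move=> PP eA; have sA : A^T = A by rewrite eA !trmx_mul trmxK tr_diag_mx mulmxA.
have [uP iP] := orthogonal_invmx PP.
have h : \prod_(i < n) ('X - (eigenvals A 0 i)%:P) = \prod_(i < n) ('X - (d 0 i)%:P).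
  rewrite -eigenvalsP // {1}eA -iP char_poly_conj // char_poly_trig ?diag_mx_is_trig //.
  by apply: eq_bigr => i _; rewrite !mxE eqxx.
rewrite sigma_esf.
have : perm_eq [tuple eigenvals A 0 i | i < n] [tuple d 0 i | i < n].
  apply: prod_XsubC_eq; rewrite !big_tuple.
  by under eq_bigr do rewrite tnth_mktuple; under [RHS]eq_bigr do rewrite tnth_mktuple.
move=> /tuple_permP[s hs]; rewrite -[RHS](esf_perm k s); apply: eq_esf => i _ /=.
have := congr1 (fun t : seq R => nth 0 t i) hs.
by rewrite -!tnth_nth !tnth_mktuple => ->.
Qed.

Lemma Gamma_gcone k A P d : P *m P^T = 1%:M -> A = P^T *m diag_mx d *m P ->
  Gamma k (eigenvals A) <-> gcone [set: 'I_n]%SET k (d 0).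
Proof.
move=> PP eA; split => h j; last first.
  by move=> /andP[_ jk]; rewrite (sigma_eigenvals _ PP eA) h.
case: j => [|j] jk; first by rewrite esf0.
by rewrite -(sigma_eigenvals _ PP eA) h.
Qed.

(** If [A] has eigenvalues [l], the diagonal of [P *m A *m P^T] averages them with the doubly
    stochastic weights [U i j ^+ 2]. [rearrangement] supplies an ordering of [l] whose pairing with
    the gradient [g] is no larger, and [ln_esf_tangent] applies to that ordering. *)
Lemma ln_sigma_tangent k A P d : (0 < k)%N -> P *m P^T = 1%:M -> A^T = A ->
  gcone [set: 'I_n]%SET k (d 0) -> Gamma k (eigenvals A) ->
  ln (sigma k (eigenvals A)) <= ln (esf [set: 'I_n]%SET k (d 0)) +
    \sum_i dlog_esf [set: 'I_n]%SET k (d 0) i * ((P *m A *m P^T) i i - d 0 i).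
Proof.
move=> k0 PP sA hd hA; have [Q [l QQ eA]] := real_sym_spectral sA.
have hl := (Gamma_gcone k QQ eA).1 hA; rewrite (sigma_eigenvals _ QQ eA).
pose U := P *m Q^T.
have UU : U *m U^T = 1%:M.
  by rewrite /U trmx_mul trmxK mulmxA -(mulmxA P) (mulmx1C QQ) mulmx1.
have UU' := mulmx1C UU.
set g := dlog_esf _ _ _.
have Dr i : \sum_j U i j ^+ 2 = 1.
  transitivity ((U *m U^T) i i); last by rewrite UU mxE eqxx.
  by rewrite mxE; apply: eq_bigr => j _; rewrite [U^T j i]mxE expr2.
have Dc j : \sum_i U i j ^+ 2 = 1.
  transitivity ((U^T *m U) j j); last by rewrite UU' mxE eqxx.
  by rewrite mxE; apply: eq_bigr => i _; rewrite [U^T j i]mxE expr2.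
have [s hs] := @rearrangement _ n g (l 0) _ (fun i j => sqr_ge0 (U i j)) Dr Dc.
rewrite -(esf_perm k s).
have hls : gcone [set: 'I_n]%SET k (l 0 \o s) by move=> j jk; rewrite esf_perm hl.
apply: le_trans (ln_esf_tangent k0 hd hls) _.
rewrite lerD2l big_mkcond /=; under eq_bigr do rewrite finset.in_setT mulrBr.
under [leRHS]eq_bigr do rewrite mulrBr.
rewrite !sumrB lerD2r; apply: le_trans hs _; apply: ler_sum => i _.
apply: eq_leW; congr (_ * _).
have -> : P *m A *m P^T = U *m diag_mx l *m U^T.
  by rewrite eA /U trmx_mul trmxK !mulmxA.
rewrite mxE; apply: eq_bigr => j _; rewrite mul_mx_diag mxE [U^T j i]mxE; ring.
Qed.

Lemma Gamma_full_posdef A (y : 'rV[R]_n) : A^T = A -> Gamma n (eigenvals A) -> y != 0 ->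
  0 < (y *m A *m y^T) 0 0.
Proof.
move=> sA hA y0; have [P [l PP eA]] := real_sym_spectral sA.
have lp i : 0 < l 0 i.
  by apply: gcone_full_gt0; rewrite card_ord; apply/(Gamma_gcone _ PP eA).1.
have -> : y *m A *m y^T = ((y *m P^T)^T)^T *m diag_mx l *m (y *m P^T)^T.
  by rewrite eA trmxK trmx_mul trmxK !mulmxA.
set z := y *m P^T.
have z0 : z != 0.
  apply: contra y0 => /eqP h; apply/eqP.
  by rewrite -[y]mulmx1 -(mulmx1C PP) mulmxA -/z h mul0mx.
have ge i : true -> 0 <= l 0 i * (z^T i 0 * z^T i 0) by move=> _; apply: mulr_ge0; [exact: ltW | rewrite -expr2 sqr_ge0].
have -> : (z^T^T *m diag_mx l *m z^T) 0 0 = \sum_a l 0 a * (z^T a 0 * z^T a 0).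
  rewrite mxE; apply: eq_bigr => a _; rewrite mul_mx_diag !mxE; ring.
rewrite lt_neqAle sumr_ge0 ?andbT; last by move=> i _; apply: ge.
apply: contra z0 => /eqP/esym/psumr_eq0P h; apply/eqP/rowP => i.
have /eqP := h ge i isT; rewrite mulf_eq0 gt_eqF //= !mxE -expr2 sqrf_eq0 => /eqP //.
Qed.

(** [sigma n] is the determinant, which congruence by [E] preserves. Hadamard's inequality for [C]
    is the tangent inequality at the diagonal of [C] in the standard frame, where the linear term
    vanishes. *)
Lemma ln_sigma_hadamard A E : (0 < n)%N -> A^T = A -> Gamma n (eigenvals A) -> (\det E) ^+ 2 = 1 ->
  ln (sigma n (eigenvals A)) <= \sum_i ln ((E *m A *m E^T) i i).
Proof.
move=> n0 sA hA dE; pose C := E *m A *m E^T.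
have sC : C^T = C by rewrite /C !trmx_mul trmxK sA mulmxA.
have uE : E \in unitmx.
  by rewrite unitmxE unitfE; apply/eqP => h; move: dE; rewrite h expr0n /= => /eqP; rewrite eq_sym oner_eq0.
have quadC (y : 'rV[R]_n) : y != 0 -> 0 < (y *m C *m y^T) 0 0.
  move=> y0; have -> : y *m C *m y^T = (y *m E) *m A *m (y *m E)^T.
    by rewrite trmx_mul /C !mulmxA.
  apply: Gamma_full_posdef => //; apply: contra y0 => /eqP h; apply/eqP.
  by rewrite -[y](mulmxK uE) h mul0mx.
have rowC (Q : 'M[R]_n) i : Q \in unitmx -> 0 < (Q *m C *m Q^T) i i.
  move=> uQ; have := quadC (row i Q); rewrite -row_mul mxE => H; rewrite mxE.
  rewrite [X in 0 < X](_ : _ = \sum_j row i (Q *m C) 0 j * (row i Q)^T j 0); last first.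
    by apply: eq_bigr => j _; rewrite [row i _ 0 j]mxE [(row i Q)^T j 0]mxE [row i Q 0 j]mxE [Q^T j i]mxE.
  apply: H; apply/eqP => h; have : row i Q *m invmx Q = 0 by rewrite h mul0mx.
  rewrite -row_mul mulmxV // => /rowP/(_ i); rewrite !mxE eqxx => /eqP; by rewrite oner_eq0.
have [Q [c QQ eC]] := real_sym_spectral sC.
have [uQ _] := orthogonal_invmx QQ.
have cp i : 0 < c 0 i.
  have := rowC Q i uQ; rewrite eC.
  rewrite (_ : Q *m _ *m _ = diag_mx c) ?mxE ?eqxx //.
  by rewrite !mulmxA QQ mul1mx -mulmxA QQ mulmx1.
have gC : Gamma n (eigenvals C).
  by apply/(Gamma_gcone _ QQ eC).2 => j jn; apply: esf_gt0; rewrite ?cardsT ?card_ord.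
pose d : 'rV[R]_n := \row_i C i i.
have dp i : 0 < d 0 i by rewrite mxE; have := rowC 1%:M i (unitmx1 _ _); rewrite mul1mx trmx1 mulmx1.
have gd : gcone [set: 'I_n]%SET n (d 0).
  by move=> j jn; apply: esf_gt0; rewrite ?cardsT ?card_ord.
have detE (B : 'M[R]_n) : B^T = B -> sigma n (eigenvals B) = \det B.
  move=> sB; have [P [l PP eB]] := real_sym_spectral sB.
  rewrite (sigma_eigenvals _ PP eB) -[X in esf _ X]card_ord esf_full.
  rewrite [in RHS]eB !det_mulmx det_diag mulrAC -det_mulmx (mulmx1C PP) det1 mul1r //.
have := ln_sigma_tangent n0 (_ : 1%:M *m 1%:M^T = 1%:M) sC gd gC.
rewrite trmx1 mulmx1 => /(_ erefl).
have d0 i : C i i - d 0 i = 0 by rewrite [d 0 i]mxE subrr.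
under eq_bigr do rewrite mul1mx mulmx1 d0 mulr0.
rewrite big1_eq addr0.
rewrite !detE // /C !det_mulmx det_tr mulrAC -expr2 dE mul1r -/C.
rewrite -[X in esf _ X]card_ord esf_full => h; apply: le_trans h _.
by rewrite ln_prod //; apply/eq_leW/eq_bigr => i _; rewrite mxE.
Qed.

End MatrixConcavity.

(** * Second-order expansions along lines *)

Section DirectionalDerivative.
Context {R : realType} {V : normedModType R}.
Implicit Types (h : V -> R) (x v : V).

Lemma is_derive_epsP h x v d : is_derive x v h d <->
  forall e : R, 0 < e -> exists2 r : R, 0 < r &
    forall t : R, `|t| < r -> `|h (t *: v + x) - h x - t * d| <= e * `|t|.
Proof.
pose q t : R := t^-1 *: (h (t *: v + x) - h x).
have qE (t : R) e : t != 0 ->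
    (`|d - q t| <= e) = (`|h (t *: v + x) - h x - t * d| <= e * `|t|).
  move=> t0; rewrite distrC -ler_pdivrMr ?normr_gt0 //; congr (_ <= e).
  rewrite -normfV -normrM; congr (`|_|); rewrite /q /GRing.scale /=; field.
  exact: t0.
split=> [[dv dE] e e0|H].
  have qd : q t @[t --> 0^'] --> d by rewrite -dE.
  have /cvgrPdist_le/(_ e e0) := qd.
  rewrite near_withinE /= => /nbhs_ballP[r /= r0 hr]; exists r => // t tr.
  have [->|t0] := eqVneq t 0.
    by rewrite scale0r add0r subrr mul0r subrr normr0 mulr0.
  by rewrite -qE //; apply: hr => //; rewrite /ball /= sub0r normrN.
have qd : q t @[t --> 0^'] --> d.
  apply/cvgrPdist_le => e e0; have [r r0 hr] := H e e0.
  rewrite near_withinE /=; apply/nbhs_ballP; exists r => //= t.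
  by rewrite /ball /= sub0r normrN => tr t0; rewrite qE //; apply: hr.
by apply: DeriveDef; [apply/cvg_ex; exists d | apply/cvg_lim].
Qed.

Lemma derivable_is_derive h x v : derivable h x v -> is_derive x v h ('D_v h x).
Proof. exact: derivableP. Qed.

End DirectionalDerivative.

Lemma is_derive_line {R : realType} {V : normedModType R} (h : V -> R) x v (t d : R) : is_derive (t *: v + x) v h d ->
  is_derive t (1 : R) (fun s : R => h (s *: v + x)) d.
Proof.
rewrite is_derive_epsP => H; apply/is_derive_epsP => e /H[r r0 hr].
exists r => // s /hr; by rewrite addrA -scalerDl [s *: 1]mulr1.
Qed.

Section MeanValue.
Context {R : realType}.

Lemma mean_value (f df : R -> R) (c : R) :
  (forall t : R, `|t| <= `|c| -> is_derive t (1 : R) f (df t)) ->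
  exists2 s : R, `|s| <= `|c| & f c - f 0 = df s * c.
Proof.
move=> H.
have cont a b : (forall t, t \in `[a, b] -> `|t| <= `|c|) -> {within `[a, b], continuous f}.
  move=> h; apply: derivable_within_continuous => t tab.
  by have [] := H t (h t tab).
have [c0|c0] := leP 0 c.
  have le t : t \in `[0, c] -> `|t| <= `|c|.
    by rewrite in_itv /= => /andP[t0 tc]; rewrite !ger0_norm.
  have hd t : t \in `]0, c[ -> is_derive t (1 : R) f (df t).
    by move=> tc; apply/H/le; apply: subset_itv_oo_cc.
  have [s sc e] := MVT_segment c0 hd (cont _ _ le).
  by exists s; [exact: le | rewrite e subr0].
have le t : t \in `[c, 0] -> `|t| <= `|c|.
  by rewrite in_itv /= => /andP[t0 tc]; rewrite !ler0_norm ?lerN2 // ltW.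
have hd t : t \in `]c, 0[ -> is_derive t (1 : R) f (df t).
  by move=> tc; apply/H/le; apply: subset_itv_oo_cc.
have [s sc e] := MVT_segment (ltW c0) hd (cont _ _ le).
by exists s; [exact: le | rewrite -[LHS]opprB e sub0r mulrN opprK].
Qed.

End MeanValue.

(** * Calculus of second-order expansions at 0 *)

Section Jets.
Context {R : realType}.
Implicit Types (f g : R -> R) (a b c t : R).

(** A Peano expansion with slope [b] and second derivative [c]. It asks for no derivative near 0,
    which keeps products, compositions and one-sided comparisons elementary. *)
Definition jet2 g a b c := forall e : R, 0 < e -> exists2 r : R, 0 < r &
  forall t : R, `|t| < r -> `|g t - (a + b * t + c / 2 * t ^+ 2)| <= e * t ^+ 2.

Lemma jet2_at0 g a b c : jet2 g a b c -> g 0 = a.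
Proof.
move=> /(_ 1 ltr01)[r r0 /(_ 0)]; rewrite normr0 expr0n !mulr0 !addr0 => /(_ r0).
by rewrite normr_le0 subr_eq0 => /eqP.
Qed.

Lemma eq_jet2 f g a b c : f =1 g -> jet2 f a b c -> jet2 g a b c.
Proof. by move=> /funext ->. Qed.

Lemma jet2_eq g a b c a' b' c' : jet2 g a b c -> a = a' -> b = b' -> c = c' -> jet2 g a' b' c'.
Proof. by move=> h <- <- <-. Qed.

Lemma jet2_poly a b c : jet2 (fun t => a + b * t + c / 2 * t ^+ 2) a b c.
Proof.
by move=> e e0; exists 1 => // t _; rewrite subrr normr0 mulr_ge0 ?sqr_ge0 ?ltW.
Qed.

Lemma jet2_cst a : jet2 (fun=> a) a 0 0.
Proof.
by apply: eq_jet2 (jet2_poly a 0 0) => t; rewrite !mul0r !addr0.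
Qed.

Lemma jet2_affine a b : jet2 (fun t => t * b + a) a b 0.
Proof.
by apply: eq_jet2 (jet2_poly a b 0) => t; rewrite !mul0r !addr0; ring.
Qed.

Lemma jet2D f g a b c a' b' c' : jet2 f a b c -> jet2 g a' b' c' ->
  jet2 (fun t => f t + g t) (a + a') (b + b') (c + c').
Proof.
move=> hf hg e e0; have e2 : 0 < e / 2 by rewrite divr_gt0.
have [r r0 hr] := hf _ e2; have [s s0 hs] := hg _ e2.
exists (Num.min r s); first by rewrite lt_min r0 s0.
move=> t; rewrite lt_min => /andP[/hr h1 /hs h2].
rewrite [X in `|X|](_ : _ = f t - (a + b * t + c / 2 * t ^+ 2) + (g t - (a' + b' * t + c' / 2 * t ^+ 2))); last by field.
by apply: le_trans (ler_normD _ _) _; lra.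
Qed.

Lemma jet2Z k f a b c : jet2 f a b c -> jet2 (fun t => k * f t) (k * a) (k * b) (k * c).
Proof.
move=> hf e e0; have k0 : 0 < `|k| + 1 by rewrite ltr_wpDl.
have [r r0 hr] := hf _ (divr_gt0 e0 k0); exists r => // t /hr h.
rewrite [X in `|X|](_ : _ = k * (f t - (a + b * t + c / 2 * t ^+ 2))); last by field.
rewrite normrM (@le_trans _ _ ((`|k| + 1) * (e / (`|k| + 1) * t ^+ 2))) //.
  by apply: ler_pM; rewrite // lerDl.
by rewrite mulrA [X in X * _]mulrC divfK // gt_eqF.
Qed.

Lemma jet2N f a b c : jet2 f a b c -> jet2 (fun t => - f t) (- a) (- b) (- c).
Proof.
by move=> /(jet2Z (-1)); rewrite !mulN1r; apply: eq_jet2 => t; rewrite mulN1r.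
Qed.

Lemma jet2B f g a b c a' b' c' : jet2 f a b c -> jet2 g a' b' c' ->
  jet2 (fun t => f t - g t) (a - a') (b - b') (c - c').
Proof. by move=> hf /jet2N; apply: jet2D. Qed.

Lemma jet2_sum (I : Type) (s : seq I) (f : I -> R -> R) (a b c : I -> R) :
  (forall i, jet2 (f i) (a i) (b i) (c i)) ->
  jet2 (fun t => \sum_(i <- s) f i t) (\sum_(i <- s) a i) (\sum_(i <- s) b i) (\sum_(i <- s) c i).
Proof.
move=> h; elim: s => [|i s IH].
  by rewrite !big_nil; apply: eq_jet2 (jet2_cst 0) => t; rewrite big_nil.
rewrite !big_cons; apply: eq_jet2 (jet2D (h i) IH) => t.
by rewrite big_cons.
Qed.

Lemma jet2_bound f a b c : jet2 f a b c -> exists2 r : R, 0 < r &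
  forall t : R, `|t| < r -> `|f t - a| <= (`|b| + `|c| + 1) * `|t| /\ `|f t| <= `|a| + `|b| + `|c| + 1.
Proof.
move=> /(_ 1 ltr01)[r r0 hr]; exists (Num.min r 1); first by rewrite lt_min r0 ltr01.
move=> t; rewrite lt_min => /andP[/hr h t1].
have t2 : t ^+ 2 <= `|t| by rewrite -real_normK ?num_real // expr2 ler_piMr // ltW.
have h1 : `|f t - a| <= (`|b| + `|c| + 1) * `|t|.
  rewrite [X in `|X|](_ : _ = f t - (a + b * t + c / 2 * t ^+ 2) + b * t + c / 2 * t ^+ 2); last by field.
  rewrite (le_trans (ler_normD _ _)) // (le_trans (lerD (ler_normD _ _) (lexx _))) //.
  have hc := ler_wpM2l (normr_ge0 c) t2; have hc' := mulr_ge0 (normr_ge0 c) (sqr_ge0 t).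
  rewrite (_ : `|c / 2 * t ^+ 2| = `|c| * t ^+ 2 / 2) ?normrM; last first.
    by rewrite ?normrM normfV (ger0_norm (ler0n R 2)) -expr2 real_normK ?num_real //; ring.
  lra.
split=> //; rewrite -[f t](subrKC a) (le_trans (ler_normD _ _)) // -!addrA lerD2l.
apply: le_trans h1 _; rewrite addrA ler_piMr ?ltW //.
Qed.

Lemma jet2_rem f g a b c : jet2 f a b c -> jet2 (fun t => g t - f t) 0 0 0 -> jet2 g a b c.
Proof.
move=> hf hg; have := jet2D hf hg; rewrite !addr0; apply: eq_jet2 => t; ring.
Qed.

Lemma jet2_small f : (forall e : R, 0 < e -> exists2 r : R, 0 < r &
  forall t : R, `|t| < r -> `|f t| <= e * t ^+ 2) -> jet2 f 0 0 0.
Proof.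
move=> h e /h[r r0 hr]; exists r => // t /hr; by rewrite !mul0r !addr0 subr0.
Qed.

Lemma jet2_small_mul f g a b c : jet2 f 0 0 0 -> jet2 g a b c -> jet2 (fun t => f t * g t) 0 0 0.
Proof.
move=> hf hg; apply: jet2_small => e e0; have [r r0 hr] := jet2_bound hg.
set K := `|a| + `|b| + `|c| + 1 in hr.
have K0 : 0 < K by rewrite /K; have := normr_ge0 a; have := normr_ge0 b; have := normr_ge0 c; lra.
have [s s0 hs] := hf _ (divr_gt0 e0 K0).
exists (Num.min r s); first by rewrite lt_min r0.
move=> t; rewrite lt_min => /andP[/hr[_ h1] /hs]; rewrite !mul0r !addr0 subr0 => h2.
rewrite normrM (le_trans (ler_pM _ _ h2 h1)) // mulrAC divfK ?gt_eqF //.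
Qed.

Lemma jet2_cube k : jet2 (fun t => k * t ^+ 3) 0 0 0.
Proof.
apply: jet2_small => e e0; have k0 : 0 < `|k| + 1 by rewrite ltr_wpDl.
exists (e / (`|k| + 1)); first exact: divr_gt0.
move=> t; rewrite ltr_pdivlMr // => h; rewrite exprS mulrA normrM [`|t ^+ 2|]ger0_norm ?sqr_ge0 //.
by rewrite ler_wpM2r ?sqr_ge0 // normrM; have := normr_ge0 t; lra.
Qed.

Lemma jet2M f g a b c a' b' c' : jet2 f a b c -> jet2 g a' b' c' ->
  jet2 (fun t => f t * g t) (a * a') (a * b' + b * a') (a * c' + 2 * b * b' + c * a').
Proof.
move=> hf hg.
pose p t := a + b * t + c / 2 * t ^+ 2; pose q t := a' + b' * t + c' / 2 * t ^+ 2.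
have hp : jet2 (fun t => f t - p t) 0 0 0.
  by have := jet2B hf (jet2_poly a b c); rewrite !subrr.
have hq : jet2 (fun t => g t - q t) 0 0 0.
  by have := jet2B hg (jet2_poly a' b' c'); rewrite !subrr.
have h1 := jet2_small_mul hp hg; have h2 := jet2_small_mul hq (jet2_poly a b c).
(* [h3] and [h4] are the terms of degree three and four in the product of the two quadratic
   polynomials. *)
have h3 := jet2_small_mul (jet2_cube ((b * c' + c * b') / 2)) (jet2_cst 1).
have h4 := jet2_small_mul (jet2_cube (c * c' / 4)) (jet2_affine 0 1).
have := jet2D (jet2D (jet2D h1 h2) (jet2D h3 h4))
  (jet2_poly (a * a') (a * b' + b * a') (a * c' + 2 * b * b' + c * a')).
rewrite !addr0 !add0r; apply: eq_jet2 => t; rewrite /p /q; by field.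
Qed.

Lemma jet2_comp (G : R -> R) f a b c A B C : jet2 (fun s => G (a + s)) A B C -> jet2 f a b c ->
  jet2 (fun t => G (f t)) A (B * b) (B * c + C * b ^+ 2).
Proof.
move=> hG hf.
have hd : jet2 (fun t => f t - a) 0 b c.
  by have := jet2B hf (jet2_cst a); rewrite subrr !subr0.
have hP := jet2D (jet2D (jet2_cst A) (jet2Z B hd)) (jet2Z (C / 2) (jet2M hd hd)).
have {}hP : jet2 (fun t => A + B * (f t - a) + C / 2 * ((f t - a) * (f t - a))) A (B * b) (B * c + C * b ^+ 2).
  have e1 : A + B * 0 + C / 2 * (0 * 0) = A by ring.
  have e2 : 0 + B * b + C / 2 * (0 * b + b * 0) = B * b by ring.
  have e3 : 0 + B * c + C / 2 * (0 * c + 2 * b * b + c * 0) = B * c + C * b ^+ 2 by field.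
  by move: hP; rewrite e1 e2 e3.
apply: jet2_rem hP _; apply: jet2_small => e e0.
have [r r0 hr] := jet2_bound hf; set K := `|b| + `|c| + 1 in hr.
have K0 : 0 < K by rewrite /K; have := normr_ge0 b; have := normr_ge0 c; lra.
have [s s0 hs] := hG _ (divr_gt0 e0 (exprn_gt0 2 K0)).
exists (Num.min r (s / K)); first by rewrite lt_min r0 divr_gt0.
move=> t; rewrite lt_min ltr_pdivlMr // => /andP[/hr[h1 _] h2].
have := hs (f t - a) (le_lt_trans h1 _); rewrite mulrC => /(_ h2).
rewrite subrKC -expr2 => h3; apply: le_trans h3 _.
rewrite -(real_normK (num_real (f t - a))) -(real_normK (num_real t)).
rewrite mulrAC ler_pdivrMr ?exprn_gt0 // -mulrA (ler_wpM2l (ltW e0)) // -exprMn mulrC.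
by apply: lerXn2r; rewrite ?nnegrE // mulr_ge0 // ltW.
Qed.

(** The mean value theorem for the remainder [k] reduces the claim to the first-order expansion of
    [g'] at 0. *)
Lemma jet2_of_derive g g' c (r : R) : 0 < r ->
  (forall t : R, `|t| < r -> is_derive t (1 : R) g (g' t)) ->
  is_derive (0 : R) (1 : R) g' c -> jet2 g (g 0) (g' 0) c.
Proof.
move=> r0 hg hg' e e0.
have /is_derive_epsP hE := hg'.
have [s s0 hs] := hE e e0.
exists (Num.min r s); first by rewrite lt_min r0.
move=> t; rewrite lt_min => /andP[tr ts].
pose k u := g u - (g 0 + g' 0 * u + c / 2 * u ^+ 2).
have hk u : `|u| <= `|t| -> is_derive u (1 : R) k (g' u - g' 0 - u * c).
  move=> ut; have := hg u (le_lt_trans ut tr) => hgu; rewrite /k.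
  apply: is_derive_eq; rewrite /GRing.scale /=; by field.
have [u ut] := mean_value hk.
rewrite {2}/k mulr0 expr0n mulr0 !addr0 subrr subr0 -/(k t) => ->.
have := hs u (le_lt_trans ut ts); rewrite [u *: 1]mulr1 addr0 => h.
rewrite normrM -(real_normK (num_real t)) expr2 mulrA ler_wpM2r //.
by apply: le_trans h _; rewrite ler_wpM2l // ltW.
Qed.

Lemma jet2_ln g a b c : 0 < a -> jet2 g a b c ->
  jet2 (fun t => ln (g t)) (ln a) (b / a) (c / a - (b / a) ^+ 2).
Proof.
move=> a0 hg.
have h : jet2 (fun s => ln (a + s)) (ln a) a^-1 (- (a ^+ 2)^-1).
  have -> : a^-1 = (a + 0)^-1 by rewrite addr0.
  rewrite -[in X in jet2 _ X](addr0 a).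
  apply: (@jet2_of_derive _ (fun s => (a + s)^-1) _ a) => // [t|].
    rewrite ltr_norml => /andP[t1 _].
    have p : 0 < a + t by lra.
    have /is_derive_epsP hl := is_derive1_ln p.
    apply/is_derive_epsP => e /hl[r r0 hr]; exists r => // u /hr.
    by rewrite addrCA.
  have n0 : (a + 0) != 0 by rewrite addr0 gt_eqF.
  have /(@is_deriveV _ (fun s : R => a + s) 0 1 1 n0) h : is_derive (0 : R) (1 : R) (fun s : R => a + s) 1.
    apply/is_derive_epsP => e e0; exists 1 => // t _.
    rewrite [t *: 1]mulr1 (_ : _ - _ = 0) ?normr0 ?mulr_ge0 //; last by ring.
    exact: ltW.
  move/is_derive_epsP: h => h; apply/is_derive_epsP => e /h[r r0 hr].
  by exists r => // t /hr; rewrite [(- _ ^- 2) *: 1]mulr1 !addr0.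
have := jet2_comp h hg; rewrite mulrC.
by rewrite [X in jet2 _ _ _ X](_ : _ = c / a - (b / a) ^+ 2) //; field; rewrite gt_eqF.
Qed.

Lemma jet2_max g a b c (r : R) : 0 < r -> jet2 g a b c -> (forall t, `|t| < r -> g t <= g 0) ->
  b = 0 /\ c <= 0.
Proof.
move=> r0 hg hm; have g0 := jet2_at0 hg.
have ineq (e : R) : 0 < e -> exists2 s : R, 0 < s & forall t : R, `|t| < s -> b * t + c / 2 * t ^+ 2 <= e * t ^+ 2.
  move=> e0; have [s s0 hs] := hg e e0; exists (Num.min r s); first by rewrite lt_min r0.
  move=> t; rewrite lt_min => /andP[/hm h1 /hs].
  rewrite ler_norml => /andP[h2 _]; move: h1; rewrite g0; lra.
have b0 : b = 0.
  apply/eqP/negPn/negP => bn.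
  have [s s0 hs] := ineq 1 ltr01.
  have bp : 0 < `|b| by rewrite normr_gt0.
  have k0 : 0 < `|c / 2| + 2 by rewrite ltr_wpDl.
  pose d := Num.min (s / 2) (`|b| / (`|c / 2| + 2)).
  have d0 : 0 < d by rewrite lt_min !divr_gt0.
  have ds : d < s by rewrite gt_min; apply/orP; left; lra.
  have d1 : d * (`|c / 2| + 2) <= `|b| by rewrite -ler_pdivlMr // ge_min lexx orbT.
  have sq : d ^+ 2 * (`|c / 2| + 2) <= d * `|b| by rewrite expr2 -mulrA ler_pM2l.
  have c1 := lerNnormlW (lexx `|c / 2|).
  have d2 : 0 < d ^+ 2 by rewrite exprn_gt0.
  have := hs d; have := hs (- d); rewrite normrN gtr0_norm // sqrrN => /(_ ds) h1 /(_ ds) h2.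
  have [bb|bb] := leP 0 b.
    by rewrite (ger0_norm bb) in sq bp; nra.
  by rewrite (ltr0_norm bb) in sq bp; nra.
split=> //; rewrite leNgt; apply/negP => c0.
have [s s0 hs] := ineq (c / 4) ltac:(by rewrite divr_gt0).
have := hs (s / 2); rewrite b0 mul0r add0r ger0_norm; last by lra.
move=> /(_ ltac:(lra)); rewrite ler_pM2r ?exprn_gt0 ?divr_gt0 //; lra.
Qed.

(** The difference has a local maximum at 0. Applied to [ln f] and its majorants, this yields the
    differentiated equations without differentiating eigenvalues. *)
Lemma jet2_le f g a b c b' c' (r : R) : 0 < r -> jet2 f a b c -> jet2 g a b' c' ->
  (forall t, `|t| < r -> f t <= g t) -> b = b' /\ c <= c'.
Proof.
move=> r0 hf hg h; have := jet2B hf hg => /(jet2_max r0)[t /h|/eqP].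
  by rewrite (jet2_at0 hf) (jet2_at0 hg) subrr subr_le0.
by rewrite subr_eq0 subr_le0 => /eqP.
Qed.

End Jets.

(** * Taylor expansions and mixed partials from coordinate derivatives *)

Section ContinuouslyDifferentiable.
Context {R : realType} {V : normedModType R} {I : finType}.
Implicit Types (e : I -> V) (W : set V) (g h : V -> R) (s : seq I) (m : nat).

Lemma partial_cat e s1 s2 g : partial e (s1 ++ s2) g = partial e s1 (partial e s2 g).
Proof. by rewrite /partial foldr_cat. Qed.

Lemma Cm_partial e m m' W g s : (m' + size s <= m)%N -> Cm e m W g ->
  Cm e m' W (partial e s g).
Proof.
move=> hs H s' hs' x Wx; rewrite -partial_cat.
have [|h1 h2] := H (s' ++ s) _ x Wx.
  by rewrite size_cat; apply: leq_trans hs; rewrite leq_add2r.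
split=> // hm; apply: h2; rewrite size_cat; apply: leq_trans hs.
by rewrite -addSn leq_add2r.
Qed.

Lemma Cm_le e m m' W g : (m' <= m)%N -> Cm e m W g -> Cm e m' W g.
Proof. by move=> h; apply: (@Cm_partial e m m' W g [::]); rewrite addn0. Qed.

Lemma Cm_is_derive e m W g s x i : (size s < m)%N -> Cm e m W g -> W x ->
  is_derive x (e i) (partial e s g) (partial e (i :: s) g x).
Proof.
by move=> hs H Wx; have [_ /(_ hs i)] := H s (ltnW hs) x Wx; apply: derivable_is_derive.
Qed.

Lemma C1_is_derive e m W h x i : Cm e m.+1 W h -> W x -> is_derive x (e i) h ('D_(e i) h x).
Proof. by move=> H Wx; have [_ /(_ isT i)] := H [::] isT x Wx; apply: derivable_is_derive. Qed.

Lemma near_norm_ball W x : nbhs x W -> exists2 r : R, 0 < r & forall y, `|y - x| < r -> W y.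
Proof.
move=> /nbhs_ballP[r /= r0 hr]; exists r => // y yr; apply: hr.
by rewrite -ball_normE /ball_ /= distrC.
Qed.

Lemma near_partial e m W g s x (eps : R) : open W -> Cm e m W g -> (size s <= m)%N -> W x ->
  0 < eps -> \forall y \near x, W y /\ `|partial e s g y - partial e s g x| <= eps.
Proof.
move=> oW H hs Wx e0; have [c _] := H s hs x Wx; near=> y; split.
  by near: y; apply: open_nbhs_nbhs.
by rewrite distrC; near: y; move: c => /cvgrPdist_le; apply.
Unshelve. all: by end_near. Qed.

Lemma norm_lincomb_le e (c : I -> R) s :
  `|\sum_(i <- s) c i *: e i| <= (\sum_(i <- s) `|c i|) * (\sum_i `|e i| + 1).
Proof.
rewrite mulr_suml (le_trans (ler_norm_sum _ _ _)) // ler_sum // => i _.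
rewrite normrZ ler_wpM2l // (bigD1 i) //= -addrA lerDl addr_ge0 // sumr_ge0 //.
Qed.

(** Only derivatives along the vectors [e i] are given, so the increment is walked one vector at a
    time, with the mean value theorem on each leg; a list [s] in place of [I] allows the
    induction. *)
Lemma C1_expansion e W h x (eps : R) : open W -> Cm e 1 W h -> W x -> 0 < eps ->
  exists2 r : R, 0 < r & forall s (c : I -> R), \sum_(i <- s) `|c i| < r ->
    W (x + \sum_(i <- s) c i *: e i) /\
    `|h (x + \sum_(i <- s) c i *: e i) - h x - \sum_(i <- s) c i * 'D_(e i) h x|
      <= eps * \sum_(i <- s) `|c i|.
Proof.
move=> oW H Wx e0.
have : \forall y \near x, W y /\ forall i, `|'D_(e i) h y - 'D_(e i) h x| <= eps.
  near=> y; split; first by near: y; apply: open_nbhs_nbhs.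
  near: y; apply: filter_forall => i.
  by apply: filterS (near_partial (s := [:: i]) oW H _ Wx e0) => // y [].
move=> /near_norm_ball[r r0 hr]; pose K := \sum_i `|e i| + 1.
have K0 : 0 < K by rewrite ltr_wpDl // sumr_ge0.
exists (r / K); first exact: divr_gt0.
move=> s c; rewrite ltr_pdivlMr // => sc; split.
  have [] // := hr (x + \sum_(i <- s) c i *: e i).
  by rewrite addrAC subrr add0r; apply: le_lt_trans (norm_lincomb_le _ _ _) sc.
elim: s sc => [|i s IH].
  by rewrite !big_nil addr0 subrr subr0 normr0 mulr0.
rewrite !big_cons mulrDl; set S := \sum_(j <- s) c j *: e j in IH *; set N := \sum_(j <- s) `|c j|.
move=> sc.
have cK : 0 <= `|c i| * K by rewrite mulr_ge0 // ltW.
have hS : `|S| <= N * K by apply: norm_lincomb_le.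
have seg t : `|t| <= `|c i| -> W (t *: e i + (x + S)) /\
    `|'D_(e i) h (t *: e i + (x + S)) - 'D_(e i) h x| <= eps.
  move=> tc; have [|Wt /(_ i) ?] // := hr (t *: e i + (x + S)).
  rewrite (_ : _ - x = t *: e i + S); last by rewrite addrCA addrAC subrr add0r.
  apply: le_lt_trans (ler_normD _ _) _; apply: le_lt_trans sc; apply: lerD hS.
  rewrite normrZ ler_pM // /K (bigD1 i) //= -addrA lerDl addr_ge0 // sumr_ge0 //.
pose f (t : R) := h (t *: e i + (x + S)).
have [|t /seg[_ ht]] := @mean_value _ f (fun t => 'D_(e i) h (t *: e i + (x + S))) (c i).
  by move=> t /seg[Wt _]; exact: (is_derive_line (C1_is_derive i H Wt)).
rewrite /f scale0r add0r => fc.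
have -> : x + (c i *: e i + S) = c i *: e i + (x + S) by rewrite addrCA.
rewrite [X in `|X|](_ : _ = ('D_(e i) h (t *: e i + (x + S)) - 'D_(e i) h x) * c i +
  (h (x + S) - h x - \sum_(j <- s) c j * 'D_(e j) h x)); last by rewrite mulrBl -fc; ring.
apply: le_trans (ler_normD _ _) _; rewrite mulrDr lerD //; last by apply: IH; apply: le_lt_trans sc; rewrite lerDr.
by rewrite normrM ler_wpM2r.
Unshelve. all: by end_near. Qed.

Lemma C1_derive e W h x (a : I -> R) : open W -> Cm e 1 W h -> W x ->
  is_derive x (\sum_i a i *: e i) h (\sum_i a i * 'D_(e i) h x).
Proof.
move=> oW H Wx; apply/is_derive_epsP => eps e0.
pose A := \sum_i `|a i| + 1.
have A0 : 0 < A by rewrite ltr_wpDl // sumr_ge0.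
have [r r0 hr] := C1_expansion oW H Wx (divr_gt0 e0 A0).
exists (r / A); first exact: divr_gt0.
move=> t; rewrite ltr_pdivlMr // => tA.
have sA : \sum_i `|t * a i| <= `|t| * A.
  by under eq_bigr do rewrite normrM; rewrite -mulr_sumr ler_wpM2l // lerDl.
have [_] := hr (index_enum I) (fun i => t * a i) (le_lt_trans sA tA).
rewrite [x + _](_ : _ = t *: (\sum_i a i *: e i) + x); last first.
  by rewrite addrC scaler_sumr; under [in RHS]eq_bigr do rewrite scalerA.
rewrite [X in _ - X](_ : _ = t * \sum_i a i * 'D_(e i) h x); last first.
  by rewrite mulr_sumr; under [in RHS]eq_bigr do rewrite mulrA.
move=> h1; apply: le_trans h1 _; rewrite mulrAC ler_pdivrMr // -mulrA (ler_wpM2l (ltW e0)) //.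
Qed.

Lemma bigmin_le_idx (a : R) (r : I -> R) : \big[Num.min/a]_i r i <= a.
Proof.
by elim/big_rec: _ => // i y _ h; rewrite ge_min h orbT.
Qed.

Lemma bigmin_le_nth (a : R) (r : I -> R) i : \big[Num.min/a]_i r i <= r i.
Proof. by rewrite (bigD1 i) //= ge_min lexx. Qed.

(** Along the segment the remainder [f] has as derivative a combination of the errors in the
    first-order expansions of the ['D_(e i) h], which [C1_expansion] controls. *)
Lemma C2_taylor e W h x (eps : R) : open W -> Cm e 2 W h -> W x -> 0 < eps ->
  exists2 r : R, 0 < r & forall c : I -> R, \sum_i `|c i| < r ->
    `|h (x + \sum_i c i *: e i) - h x - \sum_i c i * partial e [:: i] h x
      - 2^-1 * \sum_i c i * \sum_j c j * partial e [:: j; i] h x|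
      <= eps * (\sum_i `|c i|) ^+ 2.
Proof.
move=> oW H Wx e0.
have H1 i : Cm e 1 W ('D_(e i) h) by apply: (@Cm_partial e 2 1 W h [:: i]).
have /fin_all_exists[r hr] : forall i, exists r : R, 0 < r /\ forall s (c : I -> R), \sum_(i <- s) `|c i| < r ->
    W (x + \sum_(i <- s) c i *: e i) /\
    `|'D_(e i) h (x + \sum_(i <- s) c i *: e i) - 'D_(e i) h x - \sum_(j <- s) c j * 'D_(e j) ('D_(e i) h) x|
      <= eps * \sum_(i <- s) `|c i|.
  by move=> i; have [r r0 hr] := C1_expansion oW (H1 i) Wx e0; exists r.
have [r' r'0 hr'] := C1_expansion oW (Cm_le (isT : (1 <= 2)%N) H) Wx e0.
pose rho := \big[Num.min/r']_i r i.
have rho0 : 0 < rho.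
  by rewrite /rho; elim/big_ind : _ => // [a b a0 b0|i _]; [rewrite lt_min a0|have [] := hr i].
exists rho => // c; set N := \sum_i `|c i| => cr.
have N0 : 0 <= N by apply: sumr_ge0.
pose v := \sum_i c i *: e i.
have vt (t : R) : t *: v = \sum_i (t * c i) *: e i.
  by rewrite scaler_sumr; under eq_bigr do rewrite scalerA.
have nt (t : R) : `|t| <= `|1 : R| -> \sum_i `|t * c i| <= N.
  rewrite normr1 => t1; apply: ler_sum => i _; by rewrite normrM ler_piMl.
pose Q := \sum_i c i * \sum_j c j * partial e [:: j; i] h x.
pose A := \sum_i c i * partial e [:: i] h x.
pose f (t : R) := h (t *: v + x) - t * A - t ^+ 2 / 2 * Q.
have hf t : `|t| <= `|1 : R| -> is_derive t (1 : R) f (\sum_i c i * 'D_(e i) h (t *: v + x) - A - t * Q).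
  move=> t1; have Wt : W (t *: v + x).
    rewrite addrC vt; have [] // := hr' (index_enum I) (fun i => t * c i).
    apply: le_lt_trans (nt t t1) _; apply: lt_le_trans cr _.
    exact: bigmin_le_idx.
  have h1 := is_derive_line (C1_derive c oW (Cm_le (isT : (1 <= 2)%N) H) Wt).
  rewrite /f; apply: is_derive_eq; rewrite /GRing.scale /=; by field.
have [t t1 fE] := mean_value hf.
have -> : h (x + \sum_i c i *: e i) - h x - A - 2^-1 * Q = f 1 - f 0.
  rewrite /f scale1r scale0r add0r -/v [x + v]addrC; by field.
rewrite fE mulr1 /A /Q mulr_sumr -!sumrB.
apply: le_trans (ler_norm_sum _ _ _) _.
rewrite expr2 mulrA mulrC [X in _ <= X]mulr_suml; apply: ler_sum => i _.
rewrite [X in `|X|](_ : _ = c i * ('D_(e i) h (x + \sum_j (t * c j) *: e j) - 'D_(e i) h x -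
   \sum_j (t * c j) * 'D_(e j) ('D_(e i) h) x)); last first.
  rewrite [x + _]addrC -vt.
  have -> : \sum_j t * c j * 'D_(e j) ('D_(e i) h) x = t * \sum_j c j * partial e [:: j; i] h x.
    by rewrite mulr_sumr; apply: eq_bigr => j _; rewrite mulrA.
  rewrite /=; ring.
rewrite normrM ler_wpM2l //; have [_ hri] := hr i.
have [|_ h1] := hri (index_enum I) (fun j => t * c j).
  apply: le_lt_trans (nt t t1) _; apply: lt_le_trans cr _.
  exact: bigmin_le_nth.
by apply: le_trans h1 _; rewrite (ler_wpM2l (ltW e0)) // nt.
Qed.

(** The increments [k i t] are of order [t], so the error in [C2_taylor] is negligible against
    [t ^+ 2], and the quadratic polynomial is expanded by the jet calculus. *)
Lemma jet2_path e W h x (k : I -> R -> R) (k1 k2 : I -> R) : open W -> Cm e 2 W h -> W x ->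
  (forall i, jet2 (k i) 0 (k1 i) (k2 i)) ->
  jet2 (fun t => h (x + \sum_i k i t *: e i)) (h x)
    (\sum_i k1 i * partial e [:: i] h x)
    (\sum_i k2 i * partial e [:: i] h x +
     \sum_i k1 i * \sum_j k1 j * partial e [:: j; i] h x).
Proof.
move=> oW H Wx hk.
pose p t := h x + \sum_i partial e [:: i] h x * k i t +
  2^-1 * \sum_i \sum_j partial e [:: j; i] h x * (k i t * k j t).
have hp : jet2 p (h x) (\sum_i k1 i * partial e [:: i] h x)
    (\sum_i k2 i * partial e [:: i] h x +
     \sum_i k1 i * \sum_j k1 j * partial e [:: j; i] h x).
  have h1 := jet2_sum (index_enum I) (fun i => jet2Z (partial e [:: i] h x) (hk i)).
  have h2 := jet2_sum (index_enum I) (fun i => jet2_sum (index_enum I)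
     (fun j => jet2Z (partial e [:: j; i] h x) (jet2M (hk i) (hk j)))).
  apply: (jet2_eq (jet2D (jet2D (jet2_cst (h x)) h1) (jet2Z 2^-1 h2))).
  - rewrite !big1 ?mulr0 ?addr0 // => i _; last by rewrite mulr0.
    by rewrite big1 // => j _; rewrite !mulr0.
  - rewrite add0r [X in _ + _ * X]big1 ?mulr0 ?addr0; last first.
      by move=> i _; rewrite big1 // => j _; rewrite mul0r mulr0 addr0 mulr0.
    by apply: eq_bigr => i _; rewrite mulrC.
  rewrite add0r; congr (_ + _); first by apply: eq_bigr => i _; rewrite mulrC.
  rewrite mulr_sumr; apply: eq_bigr => i _; rewrite mulr_sumr mulr_sumr; apply: eq_bigr => j _.
  rewrite mul0r mulr0 addr0 add0r; by field.
apply: jet2_rem hp _; apply: jet2_small => eps e0.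
have /fin_all_exists[r hr] : forall i, exists r : R, 0 < r /\ forall t : R, `|t| < r ->
    `|k i t| <= (`|k1 i| + `|k2 i| + 1) * `|t|.
  move=> i; have [r r0 hr] := jet2_bound (hk i); exists r; split=> // t /hr[].
  by rewrite subr0.
pose K := \sum_i (`|k1 i| + `|k2 i| + 1) + 1.
have K0 : 0 < K by rewrite ltr_wpDl // sumr_ge0 // => i _; rewrite !addr_ge0.
have [d d0 hd] := C2_taylor oW H Wx (divr_gt0 e0 (exprn_gt0 2 K0)).
pose rho := \big[Num.min/d / K]_i r i.
have rho0 : 0 < rho.
  rewrite /rho; elim/big_ind : _ => [|a b a0 b0|i _]; [exact: divr_gt0|by rewrite lt_min a0|by have [] := hr i].
have rd : rho <= d / K := bigmin_le_idx _ _.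
have ri i : rho <= r i := bigmin_le_nth _ _ i.
exists rho => // t tr.
have sk : \sum_i `|k i t| <= K * `|t|.
  apply: (@le_trans _ _ (\sum_i (`|k1 i| + `|k2 i| + 1) * `|t|)).
    by apply: ler_sum => i _; have [_] := hr i; apply; apply: lt_le_trans tr (ri i).
  by rewrite -mulr_suml ler_wpM2r // lerDl.
have sd : \sum_i `|k i t| < d.
  apply: le_lt_trans sk _; rewrite mulrC -ltr_pdivlMr //; exact: lt_le_trans tr rd.
have := hd _ sd; rewrite [X in `|X| <= _ -> _](_ : _ = h (x + \sum_i k i t *: e i) - p t); last first.
  rewrite /p !opprD !addrA; congr (_ - _ - _).
    by apply: eq_bigr => i _; rewrite mulrC.
  congr (_ * _); apply: eq_bigr => i _; rewrite mulr_sumr; apply: eq_bigr => j _; ring.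
move=> h1; apply: le_trans h1 _.
rewrite mulrAC ler_pdivrMr ?exprn_gt0 // -mulrA (ler_wpM2l (ltW e0)) // [leRHS]mulrC.
rewrite -(real_normK (num_real t)) -exprMn.
by apply: lerXn2r; rewrite ?nnegrE ?mulr_ge0 ?sumr_ge0 // ltW.
Qed.

(** The mean value theorem is applied first along [e i], then along [e j]; using both orders on the
    same second difference gives the symmetry of mixed partials. *)
Lemma mixed_difference e W h x i j (d : R) : open W -> Cm e 2 W h ->
  (forall s t : R, `|s| <= `|d| -> `|t| <= `|d| -> W (s *: e i + t *: e j + x)) ->
  exists s t : R, [/\ `|s| <= `|d|, `|t| <= `|d| &
    h (d *: e i + d *: e j + x) - h (d *: e i + x) - (h (d *: e j + x) - h x) =
    d ^+ 2 * partial e [:: j; i] h (s *: e i + t *: e j + x)].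
Proof.
move=> oW H hW; have d0 : `|0 : R| <= `|d| by rewrite normr0.
have [|s sd] := @mean_value _ (fun s : R => h (s *: e i + (d *: e j + x)) - h (s *: e i + x))
   (fun s : R => 'D_(e i) h (s *: e i + (d *: e j + x)) - 'D_(e i) h (s *: e i + x)) d.
  move=> s sd.
  have W1 : W (s *: e i + (d *: e j + x)) by rewrite addrA; apply: hW.
  have W2 : W (s *: e i + x) by have := hW s 0 sd d0; rewrite scale0r addr0.
  have h1 := is_derive_line (C1_is_derive i H W1).
  have h2 := is_derive_line (C1_is_derive i H W2).
  exact: is_deriveB.
rewrite !scale0r !add0r => E1.
have [|t td] := @mean_value _ (fun t : R => 'D_(e i) h (t *: e j + (s *: e i + x)))
   (fun t : R => partial e [:: j; i] h (t *: e j + (s *: e i + x))) d.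
  move=> t td; have Wt : W (t *: e j + (s *: e i + x)) by rewrite addrCA addrA; apply: hW.
  exact: (is_derive_line (@Cm_is_derive e 2 W h [:: i] _ j isT H Wt)).
rewrite scale0r add0r => E2.
exists s, t; split=> //.
rewrite -(addrA (d *: e i)) E1.
rewrite (_ : s *: e i + (d *: e j + x) = d *: e j + (s *: e i + x)) ?E2; last by rewrite addrCA.
by rewrite addrCA addrA; ring.
Qed.

Lemma mixed_partial_sym e W h x i j : open W -> Cm e 2 W h -> W x ->
  partial e [:: i; j] h x = partial e [:: j; i] h x.
Proof.
move=> oW H Wx; apply/eqP; rewrite -subr_eq0 -normr_le0 leNgt; apply/negP => n0.
set a := partial e [:: i; j] h x in n0 *; set b := partial e [:: j; i] h x in n0 *.
have e0 : 0 < `|a - b| / 3 by rewrite divr_gt0.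
have /near_norm_ball[r1 r10 h1] := near_partial oW H (isT : (size [:: i; j] <= 2)%N) Wx e0.
have /near_norm_ball[r2 r20 h2] := near_partial oW H (isT : (size [:: j; i] <= 2)%N) Wx e0.
pose K := `|e i| + `|e j| + 1; have K0 : 0 < K by rewrite /K ltr_wpDl // addr_ge0.
pose d := Num.min r1 r2 / K / 2.
have d0 : 0 < d by rewrite !divr_gt0 // lt_min r10.
have near2 (s t : R) : `|s| <= `|d| -> `|t| <= `|d| -> `|s *: e i + t *: e j| < Num.min r1 r2.
  move=> sd td; apply: (@le_lt_trans _ _ (d * K)).
    rewrite (le_trans (ler_normD _ _)) // !normrZ.
    rewrite (gtr0_norm d0) in sd td.
    have := ler_wpM2r (normr_ge0 (e i)) sd; have := ler_wpM2r (normr_ge0 (e j)) td.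
    by rewrite /K; have := d0; lra.
  rewrite /d mulrAC divfK ?gt_eqF //.
  by have : 0 < Num.min r1 r2 by [rewrite lt_min r10]; lra.
have key (s t : R) : `|s| <= `|d| -> `|t| <= `|d| ->
   [/\ W (s *: e i + t *: e j + x), `|partial e [:: i; j] h (s *: e i + t *: e j + x) - a| <= `|a - b| / 3
     & `|partial e [:: j; i] h (s *: e i + t *: e j + x) - b| <= `|a - b| / 3].
  move=> sd td; have := near2 s t sd td; rewrite lt_min => /andP[n1 n2].
  have dist : s *: e i + t *: e j + x - x = s *: e i + t *: e j by rewrite addrK.
  rewrite -dist in n1 n2.
  have [Wy d1] := h1 _ n1; have [_ d2] := h2 _ n2; exact: And3 Wy d1 d2.
have [|s [t [sd td E1]]] := @mixed_difference e W h x i j d oW H.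
  by move=> s t sd td; have [] := key s t sd td.
have [|t' [s' [td' sd' E2]]] := @mixed_difference e W h x j i d oW H.
  by move=> s' t' sd' td'; rewrite [_ *: e j + _]addrC; have [] := key t' s' td' sd'.
have [_ _ k1] := key s t sd td; have [_ k2 _] := key s' t' sd' td'.
rewrite (addrC (t' *: e j)) (addrC (d *: e j) (d *: e i)) in E2.
move: E1 E2 k1 k2; clear key h1 h2; clearbody a b d.
move: (partial e [:: j; i] h _) (partial e [:: i; j] h _) => p1 p2.
move: (h _) (h _) (h _) (h _) => A B C D E1 E2 k1 k2.
have E : p1 = p2.
  have d2 : d ^+ 2 != 0 by rewrite expf_neq0 // gt_eqF.
  by apply: (mulfI d2); rewrite -E1 -E2; ring.
rewrite E in k1.
have : `|a - b| <= `|a - b| / 3 + `|a - b| / 3.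
  rewrite -[X in `|X| <= _](subrKA p2).
  by rewrite (le_trans (ler_normD _ _)) // lerD // distrC.
lra.
Qed.

End ContinuouslyDifferentiable.

(** * Partial derivatives along another family of vectors *)

Section ChangeOfBasis.
Context {R : realType} {V : normedModType R} {I : finType}.
Implicit Types (e : I -> V) (W : set V) (g h : V -> R) (s : seq I) (m : nat).

Lemma near_in_open W x (P : V -> Prop) : open W -> W x -> (forall y, W y -> P y) ->
  \forall y \near x, P y.
Proof. by move=> oW Wx h; apply: filterS (open_nbhs_nbhs (conj oW Wx)). Qed.

Lemma eq_partial_in e W g1 g2 : open W -> (forall x, W x -> g1 x = g2 x) ->
  forall s x, W x -> partial e s g1 x = partial e s g2 x.
Proof.
move=> oW h; elim=> [|i s IH] x Wx /=; first exact: h.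
by apply: near_eq_derive; apply: near_in_open oW Wx IH.
Qed.

Lemma eq_Cm_in e m W g1 g2 : open W -> (forall x, W x -> g1 x = g2 x) ->
  Cm e m W g1 -> Cm e m W g2.
Proof.
move=> oW h H s hs x Wx; have [c d] := H s hs x Wx.
have eq12 := eq_partial_in e oW h.
split.
  rewrite /prop_for /continuous_at -(eq12 s x Wx).
  apply: cvg_trans c; apply: near_eq_cvg.
  by apply: near_in_open oW Wx _ => y Wy; apply: eq12.
move=> sm i; apply: near_eq_derivable (d sm i).
by apply: near_in_open oW Wx _ => y Wy; apply: eq12.
Qed.

Lemma is_derive_lincomb (J : finType) (a : J -> R) (h : J -> V -> R) x v (d : J -> R) :
  (forall j, is_derive x v (h j) (d j)) ->
  is_derive x v (fun y => \sum_j a j * h j y) (\sum_j a j * d j).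
Proof.
move=> H; elim: (index_enum J) => [|j r IH].
  rewrite big_nil (_ : (fun y => _) = cst 0); first exact: is_derive_cst.
  by apply/funext => y; rewrite big_nil.
rewrite big_cons (_ : (fun y => _) = (a j \*: h j) + (fun y => \sum_(j <- r) a j * h j y)).
  exact: is_deriveD.
by apply/funext => y; rewrite big_cons.
Qed.

Lemma continuous_lincomb (J : finType) (a : J -> R) (h : J -> V -> R) x :
  (forall j, {for x, continuous (h j)}) ->
  {for x, continuous (fun y => \sum_j a j * h j y)}.
Proof.
move=> H; rewrite /prop_for /continuous_at; apply: cvg_big => [|j _].
  exact: add_continuous.
by apply: cvgM; [exact: cvg_cst | exact: H].
Qed.

Lemma partial_lincomb (J : finType) (a : J -> R) (h : J -> V -> R) e m W : open W ->
  (forall j, Cm e m W (h j)) -> forall s x, (size s <= m)%N -> W x ->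
  partial e s (fun y => \sum_j a j * h j y) x = \sum_j a j * partial e s (h j) x.
Proof.
move=> oW H; elim=> [|i s IH] x // hs Wx.
have d j := @Cm_is_derive _ _ _ e m W (h j) s x i hs (H j) Wx.
have [_ <-] := is_derive_lincomb a d.
apply: near_eq_derive; apply: near_in_open oW Wx _ => y; exact: (IH y (ltnW hs)).
Qed.

Lemma Cm_lincomb (J : finType) (a : J -> R) (h : J -> V -> R) e m W : open W ->
  (forall j, Cm e m W (h j)) -> Cm e m W (fun y => \sum_j a j * h j y).
Proof.
move=> oW H s hs x Wx; have E := partial_lincomb a oW H.
split.
  have : {for x, continuous (fun y => \sum_j a j * partial e s (h j) y)}.
    by apply: continuous_lincomb => j; have [] := H j s hs x Wx.
  rewrite /prop_for /continuous_at -E // => c; apply: cvg_trans c; apply: near_eq_cvg.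
  by apply: near_in_open oW Wx _ => y Wy; rewrite E.
move=> sm i; have d j := @Cm_is_derive _ _ _ e m W (h j) s x i sm (H j) Wx.
have [dd _] := is_derive_lincomb a d; apply: near_eq_derivable dd.
by apply: near_in_open oW Wx _ => y Wy; rewrite E.
Qed.

Context (J : finType) (e : I -> V) (e' : J -> V) (a : J -> I -> R) (W : set V).
Hypothesis (oW : open W) (he : forall j, e' j = \sum_i a j i *: e i).

Lemma derive_change_basis h x j : Cm e 1 W h -> W x ->
  is_derive x (e' j) h (\sum_i a j i * 'D_(e i) h x).
Proof. by move=> H Wx; rewrite he; apply: C1_derive oW H Wx. Qed.

(** On the open set [W] each derivative along a new vector is a combination of old ones, and it
    costs one order of regularity. *)
Lemma partial_change_basis m g (s : seq J) : Cm e m W g -> (size s <= m)%N ->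
  Cm e (m - size s) W (partial e' s g).
Proof.
move=> H; elim: s => [|j s IH] hs; first by rewrite subn0.
have {}IH := IH (ltnW hs).
have E : (m - size s = (m - size (j :: s)).+1)%N by rewrite -subSn // subSS.
rewrite E in IH; set r := (m - _)%N in IH *.
apply: (@eq_Cm_in e r W (fun y => \sum_i a j i * 'D_(e i) (partial e' s g) y)) => // [y Wy|].
  by have [_ <-] := derive_change_basis j (Cm_le (isT : (1 <= r.+1)%N) IH) Wy.
apply: Cm_lincomb => // i; apply: (@Cm_partial _ _ _ e r.+1 r W _ [:: i]) IH.
by rewrite addn1.
Qed.

Lemma partial_cons_change_basis m g (s : seq J) j x : Cm e m W g -> (size s < m)%N -> W x ->
  partial e' (j :: s) g x = \sum_i a j i * 'D_(e i) (partial e' s g) x.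
Proof.
move=> H hs Wx; have H1 := partial_change_basis H (ltnW hs).
have [|_ <- //] := derive_change_basis j (Cm_le _ H1) Wx.
by rewrite subn_gt0.
Qed.

Lemma Cm_change_basis m g : Cm e m W g -> Cm e' m W g.
Proof.
move=> H s hs x Wx; have H1 := partial_change_basis H hs; split.
  by have [] := H1 [::] isT x Wx.
move=> sm j; have [|//] := derive_change_basis j (Cm_le _ H1) Wx.
by rewrite subn_gt0.
Qed.

Lemma partial2_change_basis m g j l x : Cm e m W g -> (2 <= m)%N -> W x ->
  partial e' [:: j; l] g x = \sum_i a j i * \sum_i' a l i' * partial e [:: i; i'] g x.
Proof.
move=> H m2 Wx; rewrite (partial_cons_change_basis j H (s := [:: l]) m2 Wx).
apply: eq_bigr => i _; congr (_ * _).
have H1 i' : Cm e (m - 1) W ('D_(e i') g).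
  by apply: (@Cm_partial _ _ _ e m _ W g [:: i']) H; rewrite subnK // ltnW.
have := partial_lincomb (a l) oW H1 (s := [:: i]) (x := x).
rewrite -ltnS -subSn ?(ltnW m2) // subn1 /= => /(_ m2 Wx) <-.
apply: near_eq_derive; apply: near_in_open oW Wx _ => y Wy.
exact: (partial_cons_change_basis (s := [::]) l H (ltnW m2) Wy).
Qed.

End ChangeOfBasis.

(** * Derivatives in an orthonormal frame *)

Section Lines.
Context {R : realType} {V : normedModType R} {I : finType}.
Context (e : I -> V) (W : set V) (m : nat) (g : V -> R).
Hypothesis (oW : open W) (Hg : Cm e m W g).

Lemma partial_swap s1 s2 i j x : (size s1 + size s2 + 2 <= m)%N -> W x ->
  partial e (s1 ++ [:: i, j & s2]) g x = partial e (s1 ++ [:: j, i & s2]) g x.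
Proof.
move=> hs Wx; rewrite !partial_cat; apply: eq_partial_in oW _ _ _ Wx => y Wy.
apply: (mixed_partial_sym i j oW _ Wy); apply: (@Cm_partial _ _ _ e m 2 W g s2) Hg.
by apply: leq_trans hs; rewrite addnC leq_add2r leq_addl.
Qed.

Lemma near_line x v (P : V -> Prop) : (\forall y \near x, P y) ->
  exists2 r : R, 0 < r & forall t : R, `|t| < r -> P (t *: v + x).
Proof.
move=> /near_norm_ball[r r0 hr]; have v0 : 0 < `|v| + 1 by rewrite ltr_wpDl.
exists (r / (`|v| + 1)); first exact: divr_gt0.
move=> t; rewrite ltr_pdivlMr // => ht; apply: hr; rewrite addrK normrZ.
by apply: le_lt_trans ht; rewrite ler_wpM2l // lerDl.
Qed.

Lemma jet2_line s l x : (size s + 2 <= m)%N -> W x ->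
  jet2 (fun t : R => partial e s g (t *: e l + x)) (partial e s g x)
    (partial e (l :: s) g x) (partial e [:: l, l & s] g x).
Proof.
move=> hs Wx; have [r r0 hr] := near_line (e l) (near_in_open oW Wx (fun y => id)).
have s1 : (size s < m)%N by apply: leq_trans hs; rewrite addn2.
have h1 (t : R) : `|t| < r -> is_derive t (1 : R) (fun t : R => partial e s g (t *: e l + x))
    (partial e (l :: s) g (t *: e l + x)).
  by move=> /hr Wt; exact: (is_derive_line (Cm_is_derive l s1 Hg Wt)).
have h2 : is_derive (0 : R) (1 : R) (fun t : R => partial e (l :: s) g (t *: e l + x))
    (partial e [:: l, l & s] g x).
  have W0 : W (0 *: e l + x) by rewrite scale0r add0r.
  have s2 : (size (l :: s) < m)%N by rewrite /= -addn2.
  have := is_derive_line (Cm_is_derive l s2 Hg W0).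
  by rewrite scale0r add0r.
have := jet2_of_derive r0 h1 h2.
by rewrite !scale0r !add0r.
Qed.

End Lines.

Section Rotation.
Context {R : realType} {n : nat}.
Context (P : 'M[R]_n) (Omega : set 'rV[R]_n) (m : nat) (phi : 'rV[R]_n -> R).
Hypothesis (PP : P *m P^T = 1%:M) (oO : open Omega) (Hphi : Cm evec m Omega phi).
Local Notation e' := (fun a : 'I_n => row a P).

Lemma row_evec (Q : 'M[R]_n) a : row a Q = \sum_i Q a i *: evec i.
Proof. by rewrite [LHS]row_sum_delta; apply: eq_bigr => i _; rewrite mxE. Qed.

Lemma evec_row i : evec i = \sum_a P^T i a *: row a P.
Proof.
transitivity (row i (P^T *m P)); first by rewrite (mulmx1C PP) row1.
apply/rowP => j; rewrite summxE !mxE; apply: eq_bigr => a _; rewrite !mxE //.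
Qed.

Lemma Cm_rotate : Cm e' m Omega phi.
Proof. exact: (Cm_change_basis oO (fun a => row_evec P a) Hphi). Qed.

Lemma partial1_rotate a x : (0 < m)%N -> Omega x ->
  partial e' [:: a] phi x = \sum_i P a i * partial evec [:: i] phi x.
Proof.
move=> m0 Ox.
exact: (partial_cons_change_basis oO (fun a => row_evec P a) (s := [::]) a Hphi m0 Ox).
Qed.

Lemma partial1_unrotate i x : (0 < m)%N -> Omega x ->
  partial evec [:: i] phi x = \sum_a P a i * partial e' [:: a] phi x.
Proof.
move=> m0 Ox.
have := partial_cons_change_basis oO (fun i => evec_row i) (s := [::]) i Cm_rotate m0 Ox.
by move=> ->; apply: eq_bigr => a _; rewrite mxE.
Qed.

Lemma partial2_rotate a b x : (1 < m)%N -> Omega x ->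
  partial e' [:: a; b] phi x = (P *m hess phi x *m P^T) a b.
Proof.
move=> m1 Ox.
rewrite (partial2_change_basis oO (fun a => row_evec P a) a b Hphi m1 Ox) mxE.
under eq_bigr do rewrite mulr_sumr.
rewrite exchange_big; apply: eq_bigr => j _.
rewrite mxE mulr_suml; apply: eq_bigr => i _; rewrite !mxE; ring.
Qed.

Lemma laplacian_rotate x : (1 < m)%N -> Omega x ->
  laplacian phi x = \sum_a partial e' [:: a; a] phi x.
Proof.
move=> m1 Ox; under [RHS]eq_bigr do rewrite partial2_rotate //.
have -> : \sum_a (P *m hess phi x *m P^T) a a = \tr (P *m hess phi x *m P^T) by [].
rewrite mxtrace_mulC mulmxA (mulmx1C PP) mul1mx.
by apply: eq_bigr => i _; rewrite mxE.
Qed.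

(** [P] stays fixed while [x] ranges over [Omega]: the conjugated matrix is linear in the second
    derivatives of [phi] everywhere, and diagonality is asked only at the base point. *)
Lemma eta_rotate x : (1 < m)%N -> Omega x ->
  P *m eta_mx phi x *m P^T =
  \matrix_(a, b) ((\sum_c partial e' [:: c; c] phi x) *+ (a == b) - partial e' [:: a; b] phi x).
Proof.
move=> m1 Ox; apply/matrixP => a b; rewrite [RHS]mxE partial2_rotate // -laplacian_rotate //.
rewrite /eta_mx mulmxBr mulmxBl mul_mx_scalar -scalemxAl PP.
by rewrite [LHS]mxE; congr (_ + _); rewrite ?scalemx1 mxE.
Qed.

Lemma sum_sqr_rotate x : (0 < m)%N -> Omega x ->
  \sum_i partial evec [:: i] phi x ^+ 2 = \sum_a partial e' [:: a] phi x ^+ 2.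
Proof.
move=> m0 Ox; pose p := grad phi x.
have e1 : \sum_i partial evec [:: i] phi x ^+ 2 = (p *m p^T) 0 0.
  by rewrite mxE; apply: eq_bigr => i _; rewrite !mxE expr2.
rewrite e1 -[p]mulmx1 -(mulmx1C PP) -mulmxA -!mulmxA.
have -> : p *m (P^T *m (P *m (p *m (P^T *m P))^T)) = (p *m P^T) *m (p *m P^T)^T.
  by rewrite (mulmx1C PP) mulmx1 trmx_mul trmxK !mulmxA.
rewrite mxE; apply: eq_bigr => a _; rewrite partial1_rotate //.
rewrite [(_)^T _ _]mxE -expr2; congr (_ ^+ 2); rewrite mxE.
by apply: eq_bigr => i _; rewrite !mxE mulrC.
Qed.

End Rotation.

#[local] Arguments partial : simpl never.

(** * Expansion of the right-hand side along a line *)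

Section JetComposition.
Context {R : realType} {n : nat}.
Context (P : 'M[R]_n) (Omega : set 'rV[R]_n) (phi : 'rV[R]_n -> R).
Context (f : 'rV[R]_n * R * 'rV[R]_n -> R) (kap : 'I_n -> R) (x : 'rV[R]_n).
Hypothesis (PP : P *m P^T = 1%:M) (oO : open Omega) (Hphi : Cm evec 4 Omega phi).
Hypothesis (Hf : Cm jvec 2 (jet Omega) f) (Ox : Omega x).
Local Notation e' := (fun a : 'I_n => row a P).
Hypothesis diag_hess : forall a b, partial e' [:: a; b] phi x = kap a *+ (a == b).

Definition jpt (y : 'rV[R]_n) : 'rV[R]_n * R * 'rV[R]_n := (y, phi y, grad phi y).

Lemma open_jet : open (jet Omega).
Proof.
have -> : jet Omega = (fun q : 'rV[R]_n * R * 'rV[R]_n => q.1.1) @^-1` Omega.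
  by apply/seteqP; split=> q /=; [case=> -[] | rewrite /jet].
apply: open_comp oO => q _; apply: (@continuous_comp _ _ _ fst fst); exact: cvg_fst.
Qed.

Lemma sum_jvec (k : 'I_n + unit + 'I_n -> R) : \sum_j k j *: jvec j =
  (\sum_i k (inl (inl i)) *: evec i, k (inl (inr tt)), \sum_i k (inr i) *: evec i).
Proof.
rewrite !big_sumType /=.
rewrite (big_pred1 tt); last by case.
have e1 (s : seq 'I_n) (c : 'I_n -> R) :
    \sum_(i <- s) c i *: (evec i : 'rV[R]_n, 0 : R, 0 : 'rV[R]_n) = (\sum_(i <- s) c i *: evec i, 0, 0).
  elim: s => [|i s IH]; first by rewrite !big_nil.
  by rewrite !big_cons IH; congr (_, _, _); rewrite /= ?scaler0 ?addr0.
have e2 (s : seq 'I_n) (c : 'I_n -> R) :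
    \sum_(i <- s) c i *: (0 : 'rV[R]_n, 0 : R, evec i : 'rV[R]_n) = (0, 0, \sum_(i <- s) c i *: evec i).
  elim: s => [|i s IH]; first by rewrite !big_nil.
  by rewrite !big_cons IH; congr (_, _, _); rewrite /= ?scaler0 ?addr0.
rewrite e1 e2; congr (_, _, _); rewrite /= ?scaler0 ?addr0 ?add0r //.
by rewrite [_ *: 1]mulr1.
Qed.

Lemma jet2_grad l i : jet2 (fun t : R => partial evec [:: i] phi (t *: row l P + x))
  (partial evec [:: i] phi x) (P l i * kap l) (\sum_b P b i * partial e' [:: l; l; b] phi x).
Proof.
have Ho : Cm e' 3 Omega (partial evec [:: i] phi).
  exact: (Cm_change_basis oO (fun a => row_evec P a) (@Cm_partial _ _ _ evec 4 3 Omega phi [:: i] isT Hphi)).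
have H := jet2_line oO Ho (s := [::]) l isT Ox.
have H' := Cm_rotate P oO Hphi.
have Hb b : Cm e' 3 Omega (partial e' [:: b] phi) := @Cm_partial _ _ _ e' 4 3 Omega phi [:: b] isT H'.
have E y : Omega y -> partial evec [:: i] phi y = \sum_b P b i * partial e' [:: b] phi y.
  exact: (partial1_unrotate PP oO Hphi).
have E1 (s : seq 'I_n) : (size s <= 3)%N -> partial e' s (partial evec [:: i] phi) x =
    \sum_b P b i * partial e' (s ++ [:: b]) phi x.
  move=> hs; rewrite (eq_partial_in e' oO E s Ox).
  rewrite (partial_lincomb (fun b => P b i) oO Hb hs Ox).
  by under eq_bigr do rewrite -partial_cat.
apply: (jet2_eq H); [by [] | | exact: (E1 [:: l; l])].
transitivity (\sum_b P b i * partial e' [:: l; b] phi x); first exact: (E1 [:: l]).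
rewrite (bigD1 l) //= (diag_hess l l) eqxx mulr1n big1 ?addr0 // => b bl.
by rewrite (diag_hess l b) eq_sym (negbTE bl) mulr0n mulr0.
Qed.

(** [Q] gathers the second derivatives of [f], paired twice with the velocity of the jet, which a
    diagonal Hessian expresses through [kap l]. The third derivatives of [phi] are kept exact: they
    enter linearly, weighted by the derivatives of [f] in the gradient variable. *)
Lemma jet2_jpt l (Ab : R) : (forall s, (size s <= 2)%N -> `|partial jvec s f (jpt x)| <= Ab) ->
  exists2 Q : R, `|Q| <= Ab * (\sum_i `|P l i| + `|partial e' [:: l] phi x| + \sum_i `|P l i * kap l|) ^+ 2 &
  jet2 (fun t : R => f (jpt (t *: row l P + x))) (f (jpt x))
    ((\sum_i P l i * partial jvec [:: inl (inl i)] f (jpt x) +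
      partial e' [:: l] phi x * partial jvec [:: inl (inr tt)] f (jpt x)) +
     kap l * \sum_i P l i * partial jvec [:: inr i] f (jpt x))
    (kap l * partial jvec [:: inl (inr tt)] f (jpt x) +
     (\sum_b (\sum_i P b i * partial jvec [:: inr i] f (jpt x)) * partial e' [:: l; l; b] phi x) + Q).
Proof.
move=> hA.
pose k (j : 'I_n + unit + 'I_n) (t : R) : R := match j with
  | inl (inl i) => t * P l i
  | inl (inr _) => phi (t *: row l P + x) - phi x
  | inr i => partial evec [:: i] phi (t *: row l P + x) - partial evec [:: i] phi x end.
pose k1 (j : 'I_n + unit + 'I_n) : R := match j with
  | inl (inl i) => P l i
  | inl (inr _) => partial e' [:: l] phi x
  | inr i => P l i * kap l end.
pose k2 (j : 'I_n + unit + 'I_n) : R := match j with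
  | inl (inl i) => 0
  | inl (inr _) => kap l
  | inr i => \sum_b P b i * partial e' [:: l; l; b] phi x end.
have hk j : jet2 (k j) 0 (k1 j) (k2 j).
  case: j => [[i|[]]|i] /=.
  - by apply: eq_jet2 (jet2_affine 0 (P l i)) => t; rewrite addr0.
  - have H := jet2_line oO (Cm_rotate P oO Hphi) (s := [::]) l isT Ox.
    apply: (jet2_eq (jet2B H (jet2_cst (phi x)))); first exact: subrr.
      by rewrite subr0.
    by rewrite subr0 (diag_hess l l) eqxx mulr1n.
  - by apply: (jet2_eq (jet2B (jet2_grad l i) (jet2_cst (partial evec [:: i] phi x)))); rewrite /= ?subrr ?subr0.
have Jx : jet Omega (jpt x) by [].
have := jet2_path open_jet Hf Jx hk.
set Q := (X in _ + X) => HQ.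
exists Q.
  rewrite /Q; apply: le_trans (ler_norm_sum _ _ _) _.
  have kN : \sum_j `|k1 j| = \sum_i `|P l i| + `|partial e' [:: l] phi x| + \sum_i `|P l i * kap l|.
    by rewrite !big_sumType /= (big_pred1 tt) //; case.
  rewrite -kN expr2 mulrA [leRHS]mulr_sumr; apply: ler_sum => i _.
  rewrite normrM mulrC; apply: ler_wpM2r => //.
  apply: le_trans (ler_norm_sum _ _ _) _; rewrite mulr_sumr; apply: ler_sum => j _.
  by rewrite normrM mulrC; apply: ler_wpM2r => //; apply: hA.
have cur (t : R) : jpt x + \sum_i k i t *: jvec i = jpt (t *: row l P + x).
  rewrite sum_jvec /jpt; congr (_, _, _) => /=.
  - rewrite addrC; congr (_ + _); rewrite row_evec scaler_sumr.
    by apply: eq_bigr => i _; rewrite scalerA.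
  - by rewrite subrKC.
  - apply/rowP => i; rewrite !mxE summxE (bigD1 i) //= !mxE !eqxx big1 ?addr0.
      by rewrite mulr1 addrC subrK.
    by move=> j ji; rewrite !mxE eq_sym (negbTE ji) andbF mulr0.
apply: (jet2_eq (eq_jet2 (fun t => congr1 f (cur t)) HQ)) => //.
  rewrite !big_sumType /= (big_pred1 tt); last by case.
  by rewrite mulr_sumr; congr (_ + _); apply: eq_bigr => i _; rewrite mulrCA mulrA.
congr (_ + _); rewrite !big_sumType /= (big_pred1 tt); last by case.
rewrite [X in X + _ + _]big1 ?add0r; last by move=> i _; rewrite mul0r.
congr (_ + _).
under eq_bigr do rewrite mulr_suml.
rewrite exchange_big /=; apply: eq_bigr => b _; rewrite mulr_suml; apply: eq_bigr => i _; ring.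
Qed.

End JetComposition.

(** * The maximum point of the test function *)

(* Jets at a point, along the axes of an orthonormal frame diagonalizing the
   Hessian: [p s] stands for the partial derivative of multi-index [s] at the
   point, and [pl l s] for its restriction to the line in direction [l]. *)
Section JetsInEigenframe.
Context {R : realType} {n : nat}.
Context (kap : 'I_n -> R) (p : seq 'I_n -> R) (pl : 'I_n -> seq 'I_n -> R -> R).
Hypothesis jet2_pl : forall l s, (size s <= 2)%N -> jet2 (pl l s) (p s) (p (l :: s)) (p [:: l, l & s]).
Hypothesis diag_hess : forall a b, p [:: a; b] = kap a *+ (a == b).
Hypothesis third_sym : forall l a b, p [:: l; a; b] = p [:: a; b; l].
Hypothesis fourth_sym : forall l a, p [:: l; l; a; a] = p [:: a; a; l; l].

Lemma jet2_trace l : jet2 (fun t => \sum_c pl l [:: c; c] t) (\sum_a kap a)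
    (\sum_c p [:: l; c; c]) (\sum_c p [:: l; l; c; c]).
Proof.
have h := jet2_sum (index_enum 'I_n) (fun c => jet2_pl l (s := [:: c; c]) isT).
apply: (jet2_eq h) => //; apply: eq_bigr => c _; by rewrite diag_hess eqxx mulr1n.
Qed.

Lemma jet2_sqr_grad a : jet2 (fun t => \sum_c pl a [:: c] t ^+ 2)
    (\sum_c p [:: c] ^+ 2) (2 * p [:: a] * kap a)
    (2 * kap a ^+ 2 + 2 * \sum_l p [:: l] * p [:: a; a; l]).
Proof.
have h := jet2_sum (index_enum 'I_n)
  (fun c => jet2M (jet2_pl a (s := [:: c]) isT) (jet2_pl a (s := [:: c]) isT)).
apply: (jet2_eq (eq_jet2 _ h)) => [t|||].
- by apply: eq_bigr => c _; rewrite expr2.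
- by apply: eq_bigr => c _; rewrite expr2.
- rewrite (bigD1 a) //= big1 => [|c ca].
    by rewrite diag_hess eqxx mulr1n addr0; ring.
  by rewrite diag_hess eq_sym (negbTE ca) mulr0n mulr0 mul0r addr0.
transitivity (\sum_c 2 * p [:: a; c] ^+ 2 + 2 * \sum_l p [:: l] * p [:: a; a; l]).
  by rewrite mulr_sumr -big_split /=; apply: eq_bigr => c _; ring.
congr (_ + _); rewrite (bigD1 a) //= big1 => [|c ca].
  by rewrite diag_hess eqxx mulr1n addr0.
by rewrite diag_hess eq_sym (negbTE ca) mulr0n expr0n mulr0.
Qed.

Lemma test_function_max (be B K delta r y : R) (rho : R -> R) (rho0 : R) a :
  let w := - p [::] - delta in let D := \sum_a kap a in
  let q := (K - \sum_c p [:: c] ^+ 2)^-1 in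
  let W t := be * ln (- pl a [::] t - delta) + ln (\sum_c pl a [:: c; c] t)
    - 1 / 3 * ln (K - \sum_c pl a [:: c] t ^+ 2) + B / 2 * rho t in
  0 < w -> 0 < D -> 0 < K - \sum_c p [:: c] ^+ 2 -> 0 < r ->
  jet2 rho rho0 (2 * y) 2 ->
  (forall t : R, `|t| < r -> W t <= W 0) ->
  (\sum_c p [:: a; c; c]) / D =
    be * p [:: a] / w - 2 / 3 * q * (p [:: a] * kap a) - B * y /\
  be * (- kap a / w - (p [:: a] / w) ^+ 2) +
    ((\sum_c p [:: a; a; c; c]) / D - ((\sum_c p [:: a; c; c]) / D) ^+ 2) +
    1 / 3 * (q * (2 * kap a ^+ 2 + 2 * \sum_l p [:: l] * p [:: a; a; l]) +
      (q * (2 * p [:: a] * kap a)) ^+ 2) + B <= 0.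
Proof.
move=> w D q W w0 D0 q0 r0 j4 hmax.
have j1 : jet2 (fun t : R => - pl a [::] t - delta) w (- p [:: a]) (- kap a).
  apply: (jet2_eq (jet2B (jet2N (jet2_pl a (s := [::]) isT)) (jet2_cst delta))) => //; rewrite subr0 //.
  by rewrite diag_hess eqxx mulr1n.
have j3 := jet2B (jet2_cst K) (jet2_sqr_grad a); rewrite !sub0r in j3.
have J := jet2D (jet2B (jet2D (jet2Z be (jet2_ln w0 j1)) (jet2_ln D0 (jet2_trace a))) (jet2Z (1 / 3) (jet2_ln q0 j3)))
   (jet2Z (B / 2) j4).
have [b0 c0] := jet2_max r0 J hmax.
move: b0 c0; rewrite -/q -/D; set s := \sum_c p [:: a; c; c]; set s' := \sum_c p [:: a; a; c; c].
set s'' := \sum_l _; move=> b0 c0; split.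
  have -> : s / D = (be * (- p [:: a] / w) + s / D - 1 / 3 * (- (2 * p [:: a] * kap a) * q) + B / 2 * (2 * y))
     - (be * (- p [:: a] / w) - 1 / 3 * (- (2 * p [:: a] * kap a) * q) + B / 2 * (2 * y)) by ring.
  by rewrite b0; field; rewrite gt_eqF.
apply: le_trans c0; apply: eq_leW.
by field; rewrite !gt_eqF.
Qed.

Section Equation.
Context (F A1 A2 : R) (fl : R -> R) (l : 'I_n) (G : 'I_n -> R).
Hypothesis (F0 : 0 < F) (jf : jet2 fl F A1 A2).
Local Notation N i j t := ((\sum_c pl l [:: c; c] t) *+ (i == j) - pl l [:: i; j] t).

(** Both sides agree at [t = 0], so [jet2_le] compares the two orders at once. The trace part of
    [eta] redistributes the weights, which makes [\sum_i G i - G a] the coefficients of the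
    linearized operator. *)
Lemma supergradient_jets (r : R) : 0 < r ->
  (forall t : R, `|t| < r -> ln (fl t) <= ln F + \sum_i G i * (N i i t - (\sum_c kap c - kap i))) ->
  \sum_a (\sum_i G i - G a) * p [:: a; a; l] = A1 / F /\
  A2 / F - (A1 / F) ^+ 2 <= \sum_a (\sum_i G i - G a) * p [:: a; a; l; l].
Proof.
move=> r0 h.
have jR := jet2D (jet2_cst (ln F)) (jet2_sum (index_enum 'I_n) (fun i =>
  jet2Z (G i) (jet2B (jet2B (jet2_trace l) (jet2_pl l (s := [:: i; i]) isT)) (jet2_cst (\sum_c kap c - kap i))))).
have e0 : ln F + \sum_i G i * (\sum_a kap a - p [:: i; i] - (\sum_c kap c - kap i)) = ln F.
  rewrite big1 ?addr0 // => i _; by rewrite diag_hess eqxx mulr1n subrr mulr0.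
have [|b c] := jet2_le r0 (jet2_ln F0 jf) (jet2_eq jR e0 erefl erefl).
  move=> t /h; rewrite (eq_bigr (fun i => G i * (\sum_c pl l [:: c; c] t - pl l [:: i; i] t - (\sum_c kap c - kap i)))) //.
  by move=> i _; rewrite eqxx mulr1n.
have E (T : 'I_n -> R) : \sum_i G i * (\sum_c T c - T i - 0) = \sum_a (\sum_i G i - G a) * T a.
  under eq_bigr do rewrite subr0 mulrBr.
  rewrite sumrB -mulr_suml; under [RHS]eq_bigr do rewrite mulrBl.
  by rewrite sumrB -mulr_sumr.
rewrite !add0r !E in b c.
split; first by rewrite b; apply: eq_bigr => a _; rewrite -third_sym.
by apply: le_trans c _; apply/eq_leW/eq_bigr => a _; rewrite fourth_sym.
Qed.

(* The right-hand side of the hypothesis is Hadamard's bound for the matrix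
   [E *m N *m E^T], where [E] subtracts from row [i1] the multiples
   [N i1 q / N0 q q] of the other rows ([N0] being [N] at [t = 0]): the second
   derivative of [N i1 i1] is thereby decreased by the off-diagonal terms. *)
Lemma hadamard_jets (r : R) i1 : 0 < r -> (forall i, 0 < \sum_c kap c - kap i) ->
  (forall i, G i = (\sum_c kap c - kap i)^-1) ->
  (forall t : R, `|t| < r -> ln (fl t) <= \sum_(i | i != i1) ln (N i i t) +
    ln (N i1 i1 t - 2 * (\sum_(q | q != i1) G q * N i1 q t * N i1 q t) +
      \sum_(q | q != i1) \sum_(s | s != i1) (G q * N i1 q t) * (G s * N i1 s t) * N q s t)) ->
  ln F = \sum_i ln (\sum_c kap c - kap i) ->
  A2 / F - (A1 / F) ^+ 2 + G i1 ^+ 2 * (\sum_c p [:: l; c; c] - p [:: l; i1; i1]) ^+ 2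
    + 2 * G i1 * (\sum_(q | q != i1) G q * p [:: l; i1; q] ^+ 2) <=
  \sum_a (\sum_i G i - G a) * p [:: a; a; l; l].
Proof.
move=> r0 eta0 GE h eqF; set D := \sum_c kap c in eta0 GE eqF *.
pose d1 i := \sum_c p [:: l; c; c] - p [:: l; i; i].
pose d2 i := \sum_c p [:: l; l; c; c] - p [:: l; l; i; i].
have jN i : jet2 (fun t => N i i t) (D - kap i) (d1 i) (d2 i).
  apply: (jet2_eq (eq_jet2 _ (jet2B (jet2_trace l) (jet2_pl l (s := [:: i; i]) isT)))) => // [t|].
    by rewrite eqxx mulr1n.
  by rewrite diag_hess eqxx mulr1n.
have jO q s : q != s -> jet2 (fun t => N q s t) 0 (- p [:: l; q; s]) (- p [:: l; l; q; s]).
  move=> qs; apply: (jet2_eq (eq_jet2 _ (jet2N (jet2_pl l (s := [:: q; s]) isT)))) => // [t|].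
    by rewrite (negbTE qs) mulr0n sub0r.
  by rewrite diag_hess (negbTE qs) mulr0n oppr0.
have jsum (T : 'I_n -> R -> R) (a b c : 'I_n -> R) :
    (forall q, q != i1 -> jet2 (T q) (a q) (b q) (c q)) ->
    jet2 (fun t => \sum_(q | q != i1) T q t) (\sum_(q | q != i1) a q) (\sum_(q | q != i1) b q) (\sum_(q | q != i1) c q).
  move=> hT; have := @jet2_sum R 'I_n (index_enum 'I_n) (fun q t => if q != i1 then T q t else 0)
    (fun q => if q != i1 then a q else 0) (fun q => if q != i1 then b q else 0) (fun q => if q != i1 then c q else 0).
  rewrite -!big_mkcond /= => H; apply: (eq_jet2 _ (H _)) => [t|q]; first by rewrite -big_mkcond.
  by case: ifP => [/hT //|_]; apply: jet2_cst.
pose b q := - p [:: l; i1; q].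
have jc q : q != i1 -> jet2 (fun t => G q * N i1 q t) (G q * 0) (G q * b q) (G q * - p [:: l; l; i1; q]).
  by move=> qi; apply: jet2Z; apply: jO; rewrite eq_sym.
have j1 := jsum _ _ _ _ (fun q qi => jet2M (jc q qi) (jO i1 q ltac:(by rewrite eq_sym))).
have j2 q : q != i1 -> jet2 (fun t => \sum_(s | s != i1) (G q * N i1 q t) * (G s * N i1 s t) * N q s t) 0 0
    (2 * (G q * b q) ^+ 2 * (D - kap q)).
  move=> qi.
  have js s : s != i1 -> jet2 (fun t => (G q * N i1 q t) * (G s * N i1 s t) * N q s t) 0 0
     (if s == q then 2 * (G q * b q) ^+ 2 * (D - kap q) else 0).
    move=> si; have jqs := jet2M (jc q qi) (jc s si).
    case: (boolP (s == q)) => [/eqP sq|sq].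
      by rewrite {s si}sq in jqs *; apply: (jet2_eq (jet2M jqs (jN q))); ring.
    by apply: (jet2_eq (jet2M jqs (jO q s ltac:(by rewrite eq_sym)))); ring.
  apply: (jet2_eq (jsum _ _ _ _ js)); try by rewrite big1.
  rewrite (bigD1 q) //= eqxx big1 ?addr0 // => s /andP[_ /negbTE ->] //.
have j2' := jsum _ _ _ _ j2.
have jv := jet2D (jet2B (jN i1) (jet2Z 2 j1)) j2'.
pose b2 := \sum_(q | q != i1) G q * b q ^+ 2.
have {}jv : jet2 (fun t => N i1 i1 t - 2 * (\sum_(q | q != i1) G q * N i1 q t * N i1 q t) +
      \sum_(q | q != i1) \sum_(s | s != i1) (G q * N i1 q t) * (G s * N i1 s t) * N q s t)
    (D - kap i1) (d1 i1) (d2 i1 - 2 * b2).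
  apply: (jet2_eq jv).
  - by rewrite !big1 ?mulr0 ?subr0 ?addr0 // => q _; rewrite ?mulr0.
  - rewrite [X in _ - 2 * X + _]big1 ?mulr0 ?subr0; last by move=> q _; ring.
    by rewrite big1 ?addr0.
  (* Each [q] contributes [- 4 * G q * b q ^+ 2] from the cross term and, as [G q] inverts the
     diagonal entry, [2 * G q * b q ^+ 2] from the double sum, whose terms with [s != q] are of
     third order. *)
  rewrite -addrA; congr (_ + _); rewrite /b2 !mulr_sumr -!sumrN -big_split /=; apply: eq_bigr => q _.
  rewrite GE /b; by field; rewrite gt_eqF.
have jR := jet2D (jsum _ _ _ _ (fun i (_ : i != i1) => jet2_ln (eta0 i) (jN i))) (jet2_ln (eta0 i1) jv).
have eqF' : ln F = \sum_(i | i != i1) ln (D - kap i) + ln (D - kap i1) by rewrite eqF (bigD1 i1) //= addrC.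
have [_ c2] := jet2_le r0 (jet2_ln F0 jf) (jet2_eq jR (esym eqF') erefl erefl) h.
have c3 : \sum_(i | i != i1) (d2 i / (D - kap i) - (d1 i / (D - kap i)) ^+ 2) <= \sum_(i | i != i1) G i * d2 i.
  by apply: ler_sum => i _; rewrite GE mulrC gerBl sqr_ge0.
have E : \sum_i G i * d2 i = \sum_a (\sum_i G i - G a) * p [:: a; a; l; l].
  under eq_bigr do rewrite mulrBr.
  rewrite sumrB -mulr_suml; under [RHS]eq_bigr do rewrite mulrBl.
  rewrite sumrB -mulr_sumr; congr (_ * _ - _); apply: eq_bigr => c _; first exact: fourth_sym.
  by rewrite fourth_sym.
rewrite -E [\sum_i G i * d2 i](bigD1 i1) //=.
have -> : \sum_(q | q != i1) G q * p [:: l; i1; q] ^+ 2 = b2.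
  by apply: eq_bigr => q _; rewrite /b sqrrN.
rewrite -/(d1 i1).
have -> : G i1 ^+ 2 * d1 i1 ^+ 2 = (d1 i1 / (D - kap i1)) ^+ 2 by rewrite GE; ring.
have : (d2 i1 - 2 * b2) / (D - kap i1) = G i1 * d2 i1 - 2 * G i1 * b2 by rewrite GE; ring.
move: c2 c3; set u := _ / (D - kap i1); set u' := (d1 i1 / _) ^+ 2; set v := \sum_(i | _) _; set v' := \sum_(i | _) _.
lra.
Qed.

End Equation.
End JetsInEigenframe.

Lemma sqrD_le_mul {R : realDomainType} (a b x : R) :
  (a + b * x) ^+ 2 <= (a ^+ 2 + b ^+ 2) * (1 + x ^+ 2).
Proof.
rewrite -subr_ge0 [leRHS](_ : _ = (a * x - b) ^+ 2) ?sqr_ge0 //; ring.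
Qed.

Lemma sum_mul_exchange {R : comPzRingType} {n} (c : 'I_n -> R) (p : 'I_n -> 'I_n -> R) :
  \sum_a c a * (\sum_l p a l) = \sum_l \sum_a c a * p a l.
Proof. by rewrite exchange_big; apply: eq_bigr => a _; rewrite mulr_sumr. Qed.

Section Symmetry.
Context {R : realType} {n : nat} (Omega : set 'rV[R]_n) (phi : 'rV[R]_n -> R) (x : 'rV[R]_n).
Hypothesis (oO : open Omega) (Hphi : Cm evec 4 Omega phi) (Ox : Omega x).

Lemma hess_sym : (hess phi x)^T = hess phi x.
Proof.
apply/matrixP => i j; rewrite !mxE.
exact: (mixed_partial_sym j i oO (Cm_le (isT : (2 <= 4)%N) Hphi) Ox).
Qed.

Lemma eta_mx_sym : (eta_mx phi x)^T = eta_mx phi x.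
Proof. by rewrite /eta_mx linearB /= tr_scalar_mx hess_sym. Qed.

End Symmetry.

(** * The equation along the axes of an eigenframe *)

Section Frame.
Context {R : realType} {n : nat}.
Context (P : 'M[R]_n) (Omega : set 'rV[R]_n) (phi : 'rV[R]_n -> R).
Context (kap : 'I_n -> R) (x0 : 'rV[R]_n).
Hypothesis (PP : P *m P^T = 1%:M) (oO : open Omega) (Hphi : Cm evec 4 Omega phi).
Hypothesis (Ox : Omega x0).
Local Notation e' := (fun a : 'I_n => row a P).

Definition fpart (s : seq 'I_n) : R := partial e' s phi x0.
Definition fline (l : 'I_n) (s : seq 'I_n) (t : R) : R := partial e' s phi (t *: row l P + x0).

Lemma jet2_fline l s : (size s <= 2)%N ->
  jet2 (fline l s) (fpart s) (fpart (l :: s)) (fpart [:: l, l & s]).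
Proof.
move=> hs; apply: (jet2_line oO (Cm_rotate P oO Hphi) l _ Ox).
by rewrite addn2 !ltnS.
Qed.

Lemma fpart_third l a b : fpart [:: l; a; b] = fpart [:: a; b; l].
Proof.
have H := Cm_rotate P oO Hphi.
exact: (etrans (partial_swap oO H (s1 := [::]) (s2 := [:: b]) l a isT Ox)
  (partial_swap oO H (s1 := [:: a]) (s2 := [::]) l b isT Ox)).
Qed.

Lemma fpart_fourth l a : fpart [:: l; l; a; a] = fpart [:: a; a; l; l].
Proof.
have H := Cm_rotate P oO Hphi.
have e1 := partial_swap oO H (s1 := [:: l]) (s2 := [:: a]) l a isT Ox.
have e2 := partial_swap oO H (s1 := [::]) (s2 := [:: l; a]) l a isT Ox.
have e3 := partial_swap oO H (s1 := [:: a; l]) (s2 := [::]) l a isT Ox.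
have e4 := partial_swap oO H (s1 := [:: a]) (s2 := [:: l]) l a isT Ox.
exact: (etrans e1 (etrans e2 (etrans e3 e4))).
Qed.

Lemma near_fline l (Q : 'rV[R]_n -> Prop) : (\forall y \near x0, Q y) ->
  exists2 r : R, 0 < r & forall t : R, `|t| < r -> Omega (t *: row l P + x0) /\ Q (t *: row l P + x0).
Proof.
move=> h; apply: (near_line (row l P) (P := fun y => Omega y /\ Q y)).
by near=> y; split; near: y => //; apply: open_nbhs_nbhs.
Unshelve. all: by end_near. Qed.

Hypothesis diag_hess : forall a b, fpart [:: a; b] = kap a *+ (a == b).

Lemma laplacian_fpart : laplacian phi x0 = \sum_a kap a.
Proof.
rewrite (laplacian_rotate PP oO Hphi isT Ox); apply: eq_bigr => a _.
by have := diag_hess a a; rewrite eqxx mulr1n.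
Qed.

Lemma eta_fpart : eta_mx phi x0 = P^T *m diag_mx (\row_i (\sum_a kap a - kap i)) *m P.
Proof.
have -> : diag_mx (\row_i (\sum_a kap a - kap i)) = P *m eta_mx phi x0 *m P^T.
  rewrite (eta_rotate PP oO Hphi isT Ox) -(laplacian_rotate PP oO Hphi isT Ox) laplacian_fpart.
  apply/matrixP => a b; rewrite !mxE; have := diag_hess a b; rewrite /fpart => ->.
  by rewrite mulrnBl; case: eqP => // ->.
by rewrite !mulmxA (mulmx1C PP) mul1mx -mulmxA (mulmx1C PP) mulmx1.
Qed.

Section Equation.
Context (k : nat) (f : 'rV[R]_n * R * 'rV[R]_n -> R).
Hypothesis (Hf : Cm jvec 2 (jet Omega) f) (eta_cvx : eta_convex k Omega phi).
Hypothesis equation : forall x, Omega x -> sigma k (eigenvals (eta_mx phi x)) = f (jpt phi x).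
Local Notation D := (\sum_a kap a).
Local Notation eta := (fun i => D - kap i).

Lemma gcone_eta : gcone [set: 'I_n]%SET k eta.
Proof.
have h := (Gamma_gcone k PP eta_fpart).1 (eta_cvx Ox).
by move=> j /h; rewrite (eq_esf _ _ (y := eta)) // => i; rewrite mxE.
Qed.

Lemma esf_eta : esf [set: 'I_n]%SET k eta = f (jpt phi x0).
Proof.
by rewrite -equation // (sigma_eigenvals k PP eta_fpart); apply: eq_esf => i; rewrite mxE.
Qed.

Local Notation G := (dlog_esf [set: 'I_n]%SET k eta).
Local Notation N l i j t := ((\sum_c fline l [:: c; c] t) *+ (i == j) - fline l [:: i; j] t).

Lemma eta_fline l t : Omega (t *: row l P + x0) ->
  P *m eta_mx phi (t *: row l P + x0) *m P^T = \matrix_(i, j) N l i j t.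
Proof. by move=> Oy; exact: (eta_rotate PP oO Hphi isT Oy). Qed.

(** [ln_sigma_tangent] is used at every point of the line with the frame of [x0]; at [t = 0] the
    diagonal is [eta], so the majorant touches [ln f] there. *)
Lemma ln_tangent_line l : (0 < k)%N -> exists2 r : R, 0 < r & forall t : R, `|t| < r ->
  ln (f (jpt phi (t *: row l P + x0))) <= ln (f (jpt phi x0)) + \sum_i G i * (N l i i t - eta i).
Proof.
move=> k0; have [r r0 hr] := near_fline l (open_nbhs_nbhs (conj oO Ox)).
exists r => // t /hr[Oy _]; rewrite -equation // -esf_eta.
have gd : gcone [set: 'I_n]%SET k ((\row_i eta i) 0).
  by move=> j /gcone_eta; rewrite (eq_esf _ _ (y := (\row_i eta i) 0)) // => i _; rewrite mxE.
have h := ln_sigma_tangent k0 PP (eta_mx_sym oO Hphi Oy) gd (eta_cvx Oy).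
have e1 : esf [set: 'I_n]%SET k ((\row_i eta i) 0) = esf [set: 'I_n]%SET k eta.
  by apply: eq_esf => i _; rewrite mxE.
apply: le_trans h _; rewrite e1 lerD2l; apply/eq_leW/eq_bigr => i _.
rewrite (eta_fline Oy) [in X in _ * (X - _)]mxE [in X in _ * (_ - X)]mxE; congr (_ * _).
congr (_ / _); last exact: e1.
by apply: eq_esf => j _; rewrite mxE.
Qed.

(** The multipliers of the row reduction vary with [t], but its determinant is always 1, so its
    product with [P] is admissible in [ln_sigma_hadamard]. *)
Lemma hadamard_line l i1 (c : 'I_n -> R) : k = n -> exists2 r : R, 0 < r & forall t : R, `|t| < r ->
  ln (f (jpt phi (t *: row l P + x0))) <= \sum_(i | i != i1) ln (N l i i t) +
    ln (N l i1 i1 t - 2 * (\sum_(q | q != i1) c q * N l i1 q t * N l i1 q t) +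
      \sum_(q | q != i1) \sum_(s | s != i1) (c q * N l i1 q t) * (c s * N l i1 s t) * N l q s t).
Proof.
move=> kn; have [r r0 hr] := near_fline l (open_nbhs_nbhs (conj oO Ox)).
exists r => // t /hr[Oy _]; rewrite -equation //; set y := t *: row l P + x0.
have n0 : (0 < n)%N := leq_ltn_trans (leq0n i1) (ltn_ord i1).
pose B := \matrix_(i, j) N l i j t.
have eB : P *m eta_mx phi y *m P^T = B := eta_fline Oy.
have sB : B^T = B by rewrite -eB !trmx_mul trmxK (eta_mx_sym oO Hphi Oy) mulmxA.
have gn : Gamma n (eigenvals (eta_mx phi y)) by rewrite -[X in Gamma X]kn; apply: eta_cvx.
pose E := row_reduction i1 (fun q => c q * N l i1 q t).
have dE : (\det (E *m P)) ^+ 2 = 1.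
  rewrite det_mulmx det_row_reduction mul1r expr2 -{2}det_tr -det_mulmx PP; exact: det1.
have := ln_sigma_hadamard n0 (eta_mx_sym oO Hphi Oy) gn dE.
rewrite -[X in sigma X]kn => h; apply: le_trans h _.
have eE : E *m P *m eta_mx phi y *m (E *m P)^T = E *m B *m E^T.
  by rewrite trmx_mul -eB !mulmxA.
rewrite eE (bigD1 i1) //= addrC (row_reduction_pivot _ _ sB); apply: eq_leW.
congr (_ + ln (_ - 2 * _ + _)).
- by apply: eq_bigr => i ii; rewrite (row_reduction_diag _ _ ii) mxE.
- by rewrite mxE.
- by apply: eq_bigr => q _; rewrite mxE.
- by apply: eq_bigr => q _; apply: eq_bigr => s _; rewrite mxE.
Qed.

Section SecondOrder.
Context (M m A : R).
Hypothesis (m0 : 0 < m) (fm : m <= f (jpt phi x0)).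
Hypothesis fA : forall s, (size s <= 2)%N -> `|partial jvec s f (jpt phi x0)| <= A.
Hypothesis uM : forall a, `|fpart [:: a]| <= M.
Local Notation F := (f (jpt phi x0)).

(* At [x0], [ln f (x, phi x, grad phi x)] has derivative
   [drift0 l + drift l * kap l] in the direction of the row [l] of [P]. *)
Definition drift0 l := (\sum_i P l i * partial jvec [:: inl (inl i)] f (jpt phi x0) +
   fpart [:: l] * partial jvec [:: inl (inr tt)] f (jpt phi x0)) / F.
Definition drift l := (\sum_i P l i * partial jvec [:: inr i] f (jpt phi x0)) / F.

Lemma abs_orthogonal_le1 l i : `|P l i| <= 1.
Proof.
have : (P *m P^T) l l = 1 by rewrite PP mxE eqxx.
rewrite mxE (bigD1 i) //= mxE -expr2 => h.
have h1 : P l i ^+ 2 <= 1.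
  by rewrite -h lerDl sumr_ge0 // => j _; rewrite mxE -expr2 sqr_ge0.
by rewrite -(@expr_le1 _ 2) // real_normK ?num_real.
Qed.

Lemma norm_sum_le (b : 'I_n -> R) c : (forall i, `|b i| <= c) -> `|\sum_i b i| <= n%:R * c.
Proof.
move=> h; apply: le_trans (ler_norm_sum _ _ _) _.
by rewrite mulr_natl -[X in _ *+ X]card_ord -sumr_const ler_sum.
Qed.

(** [c1] bounds [drift0] and [drift]. In [C0], the summand [c1] keeps that bound available, [A / m]
    pays for the derivative of [ln f] in the variable [z], the next term for the remainder [Q], and
    the last for the square of the first derivative of [ln f]; the leading factors [n] come from
    summing over directions. *)
Let c1 := (n%:R + M) * A / m.
Let C0 := c1 + A / m + n%:R * (A / m) * ((n%:R + M) ^+ 2 + n%:R ^+ 4) + n%:R * c1 ^+ 2 * (1 + n%:R ^+ 2).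

Lemma rhs_gt0 : 0 < F. Proof. exact: lt_le_trans m0 fm. Qed.

Lemma rhs_bound_ge0 : 0 <= A. Proof. exact: le_trans (fA (isT : (size [::] <= 2)%N)). Qed.

Lemma div_rhs_le (a b : R) : `|a| <= b -> `|a / F| <= b / m.
Proof.
move=> h; rewrite normrM [`|F^-1|]gtr0_norm ?invr_gt0 ?rhs_gt0 //.
by apply: ler_pM => //; rewrite ?invr_ge0 ?(ltW rhs_gt0) // lef_pV2 ?posrE ?rhs_gt0.
Qed.

Lemma drift_le l : `|drift l| <= n%:R * A / m.
Proof.
apply: div_rhs_le; apply: norm_sum_le => i; rewrite normrM -[leRHS]mul1r.
by apply: ler_pM => //; [exact: abs_orthogonal_le1 | exact: fA].
Qed.

Lemma drift0_le l : `|drift0 l| <= c1.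
Proof.
apply: div_rhs_le; apply: le_trans (ler_normD _ _) _; rewrite mulrDl; apply: lerD.
  apply: norm_sum_le => i; rewrite normrM -[leRHS]mul1r.
  by apply: ler_pM => //; [exact: abs_orthogonal_le1 | exact: fA].
by rewrite normrM; apply: ler_pM => //; exact: fA.
Qed.

Lemma jet2_rhs l : exists2 Q : R,
  `|Q| <= A * (\sum_i `|P l i| + `|fpart [:: l]| + \sum_i `|P l i * kap l|) ^+ 2 &
  jet2 (fun t => f (jpt phi (t *: row l P + x0))) F ((drift0 l + drift l * kap l) * F)
    (kap l * partial jvec [:: inl (inr tt)] f (jpt phi x0) +
    (\sum_b (\sum_i P b i * partial jvec [:: inr i] f (jpt phi x0)) * fpart [:: l; l; b]) + Q).
Proof.
have F0 := rhs_gt0; have [Q hQ jQ] := jet2_jpt PP oO Hphi Hf Ox diag_hess l fA.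
exists Q => //; apply: (jet2_eq jQ) => //.
by rewrite /drift0 /drift mulrDl [X in _ = X + _]divfK ?lt0r_neq0 // [X in _ = _ + X]mulrAC divfK ?lt0r_neq0 // [X in _ = _ + X]mulrC.
Qed.

(** Summing the twice differentiated equation over all directions produces the Laplacian. Symmetry
    of the third derivatives turns the sum of [drift b * fpart [:: l; l; b]] into [drift] paired
    with the gradient of the Laplacian; [tex] stands for the gain of whichever concavity bound is
    used. *)
Lemma sum_equation_second_order (Fa tex : 'I_n -> R) : 1 <= D -> (forall a, `|kap a| <= n%:R * D) ->
  (forall l A2, jet2 (fun t => f (jpt phi (t *: row l P + x0))) F ((drift0 l + drift l * kap l) * F) A2 ->
    A2 / F - (drift0 l + drift l * kap l) ^+ 2 + tex l <= \sum_a Fa a * fpart [:: a; a; l; l]) ->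
  \sum_l drift l * (\sum_c fpart [:: l; c; c]) - C0 * (1 + D ^+ 2) + \sum_l tex l <=
  \sum_a Fa a * (\sum_l fpart [:: a; a; l; l]).
Proof.
move=> D1 kD h; have F0 := rhs_gt0; have A0 := rhs_bound_ge0.
have D2 : 1 <= D ^+ 2 by rewrite exprn_ege1.
have Am : 0 <= A / m by rewrite divr_ge0 // ltW.
have key l : kap l * (partial jvec [:: inl (inr tt)] f (jpt phi x0) / F) + \sum_b drift b * fpart [:: l; l; b]
   - ((A / m) * ((n%:R + M) ^+ 2 + n%:R ^+ 4) + c1 ^+ 2 * (1 + n%:R ^+ 2)) * (1 + D ^+ 2) + tex l
   <= \sum_a Fa a * fpart [:: a; a; l; l].
  have [Q hQ jF] := jet2_rhs l.
  have M0 : 0 <= M by apply: le_trans (uM l).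
  apply: le_trans (h l _ jF); rewrite lerD2r.
  have eS : (\sum_b (\sum_i P b i * partial jvec [:: inr i] f (jpt phi x0)) * fpart [:: l; l; b]) / F =
     \sum_b drift b * fpart [:: l; l; b].
    by rewrite mulr_suml; apply: eq_bigr => b _; rewrite /drift mulrAC.
  rewrite [(_ + Q) / F]mulrDl [X in X + Q / F]mulrDl eS -[kap l * _ / F]mulrA.
  have q1 : `|Q| <= A * (((n%:R + M) ^+ 2 + n%:R ^+ 4) * (1 + D ^+ 2)).
    apply: le_trans hQ _; apply: ler_wpM2l => //.
    set s := _ + _; have s0 : 0 <= s by rewrite /s !addr_ge0 // sumr_ge0.
    have sle : s <= (n%:R + M) + n%:R ^+ 2 * D.
      rewrite /s; apply: lerD.
        apply: lerD; last exact: uM.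
        rewrite -[n%:R]mulr1 mulr_natl -[X in _ *+ X]card_ord -sumr_const; apply: ler_sum => i _.
        exact: abs_orthogonal_le1.
      rewrite expr2 -mulrA mulr_natl -[X in _ *+ X]card_ord -sumr_const; apply: ler_sum => i _.
      rewrite normrM -[leRHS]mul1r; apply: ler_pM => //; exact: abs_orthogonal_le1.
    apply: (@le_trans _ _ (((n%:R + M) + n%:R ^+ 2 * D) ^+ 2)).
      by apply: lerXn2r; rewrite ?nnegrE // (le_trans s0).
    by have := sqrD_le_mul (n%:R + M) (n%:R ^+ 2) D; rewrite -[(n%:R ^+ 2) ^+ 2]exprM.
  have q2 := div_rhs_le q1; have := lerNnormlW q2.
  have q3 : (drift0 l + drift l * kap l) ^+ 2 <= c1 ^+ 2 * (1 + n%:R ^+ 2) * (1 + D ^+ 2).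
    have b1 := drift0_le l; have b2 := drift_le l.
    have c10 : 0 <= c1 by apply: le_trans b1.
    have b2' : `|drift l| <= c1.
      apply: le_trans b2 _; rewrite /c1 ler_pM2r ?invr_gt0 // ler_wpM2r // lerDl //.
    have b3 : `|drift0 l + drift l * kap l| <= c1 * (1 + n%:R * D).
      apply: le_trans (ler_normD _ _) _; rewrite mulrDr mulr1; apply: lerD => //.
      by rewrite normrM; apply: ler_pM.
    apply: (@le_trans _ _ ((c1 * (1 + n%:R * D)) ^+ 2)).
      rewrite -real_normK ?num_real //; apply: lerXn2r; rewrite ?nnegrE //.
      by rewrite mulr_ge0 // addr_ge0 // mulr_ge0 //; lra.
    rewrite exprMn -[leRHS]mulrA; apply: ler_wpM2l; first exact: sqr_ge0.
    by have := sqrD_le_mul 1 n%:R D; rewrite expr1n.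
  move: q3; set q := (_ + _) ^+ 2; set a := A / m; set b := (n%:R + M) ^+ 2 + _; set c := c1 ^+ 2 * _.
  set z := kap l * _; set s := \sum_b drift b * _.
  rewrite [A * _ / m](_ : _ = a * b * (1 + D ^+ 2)); last by rewrite /a; ring.
  move=> q3 q4; lra.
have n0 : (0 < n)%N by case: (n) (kap) D1 => // kp; rewrite big_ord0 ler10.
have c10 : 0 <= c1 * (1 + D ^+ 2).
  by rewrite mulr_ge0 ?addr_ge0 ?sqr_ge0 // (le_trans _ (drift0_le (Ordinal n0))).
have t3 := fpart_third.
move: key t3; generalize fpart => p key t3.
rewrite (sum_mul_exchange Fa (fun a l => p [:: a; a; l; l])).
apply: le_trans (ler_sum _ (fun l _ => key l)).
rewrite !big_split /= lerD2r sumr_const card_ord -mulr_suml.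
have -> : \sum_l \sum_b drift b * p [:: l; l; b] = \sum_l drift l * (\sum_c p [:: l; c; c]).
  rewrite -(sum_mul_exchange drift (fun b l => p [:: l; l; b])).
  by apply: eq_bigr => b _; congr (_ * _); apply: eq_bigr => l _; rewrite (t3 b l l).
have := div_rhs_le (fA (isT : (size [:: inl (inr tt) : 'I_n + unit + 'I_n] <= 2)%N)).
move=> /lerNnormlW; set z := partial _ _ _ _ / F => hz.
have hDz : - (A / m * (1 + D ^+ 2)) <= D * z.
  have D0 : 0 <= D by lra.
  have := ler_wpM2l D0 hz; have : D <= 1 + D ^+ 2 by nra.
  by move=> /(ler_wpM2l Am); lra.
rewrite -[_ *+ n]mulr_natl /C0; move: hDz c10.
set s := \sum_l drift l * _; set a := A / m; set b := (n%:R + M) ^+ 2 + _; set c := c1 ^+ 2; set N2 := 1 + n%:R ^+ 2.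
set dd := 1 + D ^+ 2.
lra.
Qed.

End SecondOrder.
End Equation.
End Frame.

(* [h v = - 1 / 3 * ln (K - v)] satisfies [h'' = 3 * h' ^ 2]: the second
   derivative of the gradient term absorbs its own contribution to
   [(ln (laplacian phi))' ^ 2] at a critical point. *)
Definition test_function {R : realType} {n : nat} (be B K delta : R) (phi : 'rV[R]_n -> R) x : R :=
  be * ln (- phi x - delta) + ln (laplacian phi x)
    - 1 / 3 * ln (K - \sum_i partial evec [:: i] phi x ^+ 2) + B / 2 * \sum_i x 0 i ^+ 2.

(** * Conditions at the maximum and differentiated equations in the eigenframe *)

Section Frame.
Context {R : realType} {n : nat}.
Context (P : 'M[R]_n) (Omega : set 'rV[R]_n) (phi : 'rV[R]_n -> R).
Context (kap : 'I_n -> R) (x0 : 'rV[R]_n).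
Hypothesis (PP : P *m P^T = 1%:M) (oO : open Omega) (Hphi : Cm evec 4 Omega phi).
Hypothesis (Ox : Omega x0).
Local Notation p := (fpart P phi x0).
Hypothesis diag_hess : forall a b, p [:: a; b] = kap a *+ (a == b).
Local Notation D := (\sum_a kap a).

Lemma jet2_sqr_norm a : jet2 (fun t : R => \sum_i (t *: row a P + x0) 0 i ^+ 2)
  (\sum_i x0 0 i ^+ 2) (2 * \sum_i x0 0 i * P a i) 2.
Proof.
have h i : jet2 (fun t : R => (t *: row a P + x0) 0 i ^+ 2) (x0 0 i ^+ 2) (2 * (x0 0 i * P a i)) (2 * P a i ^+ 2).
  have H := jet2_affine (x0 0 i) (P a i).
  by apply: (jet2_eq (eq_jet2 _ (jet2M H H))) => [t|||]; rewrite ?mxE; ring.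
apply: (jet2_eq (jet2_sum (index_enum 'I_n) h)) => //; first by rewrite mulr_sumr.
rewrite -mulr_sumr; have : (P *m P^T) a a = 1 by rewrite PP mxE eqxx.
rewrite mxE => e; transitivity (2 * (\sum_j P a j * P^T j a)); last by rewrite e mulr1.
by congr (_ * _); apply: eq_bigr => i _; rewrite mxE expr2.
Qed.

Lemma test_function_frame (be B K delta : R) a :
  let w := - phi x0 - delta in let q := (K - \sum_c p [:: c] ^+ 2)^-1 in
  let y := \sum_i x0 0 i * P a i in
  0 < w -> 0 < D -> 0 < K - \sum_c p [:: c] ^+ 2 ->
  (forall x, Omega x -> 0 < - phi x - delta ->
    test_function be B K delta phi x <= test_function be B K delta phi x0) ->
  (\sum_c p [:: a; c; c]) / D =
    be * p [:: a] / w - 2 / 3 * q * (p [:: a] * kap a) - B * y /\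
  be * (- kap a / w - (p [:: a] / w) ^+ 2) +
    ((\sum_c p [:: a; a; c; c]) / D - ((\sum_c p [:: a; c; c]) / D) ^+ 2) +
    1 / 3 * (q * (2 * kap a ^+ 2 + 2 * \sum_l p [:: l] * p [:: a; a; l]) +
      (q * (2 * p [:: a] * kap a)) ^+ 2) + B <= 0.
Proof.
move=> w q y w0 D0 q0 hmax.
(* [hmax] compares only points where [- phi x - delta] is positive, which continuity ensures near
   [x0]. *)
have nw : \forall x \near x0, 0 < - phi x - delta.
  have := near_partial oO Hphi (isT : (size [::] <= 4)%N) Ox (_ : 0 < w / 2).
  rewrite divr_gt0 // => /(_ isT); apply: filterS => x [_].
  rewrite ler_distl => /andP[_]; rewrite /partial /= => h; rewrite /w in w0 h; lra.
have [r r0 hr] := near_fline P oO Ox a nw.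
have eW (t : R) x : x = t *: row a P + x0 -> Omega x -> test_function be B K delta phi x =
   be * ln (- fline P phi x0 a [::] t - delta) + ln (\sum_c fline P phi x0 a [:: c; c] t)
    - 1 / 3 * ln (K - \sum_c fline P phi x0 a [:: c] t ^+ 2) + B / 2 * \sum_i (t *: row a P + x0) 0 i ^+ 2.
  move=> -> Oy; rewrite /test_function (laplacian_rotate PP oO Hphi isT Oy).
  by rewrite (sum_sqr_rotate PP oO Hphi isT Oy).
have H := @test_function_max R n kap p (fline P phi x0) (jet2_fline P oO Hphi Ox) diag_hess
  be B K delta r y _ _ a w0 D0 q0 r0 (jet2_sqr_norm a).
apply: H => t tr; have [Oy wy] := hr t tr.
have e0 : x0 = (0 : R) *: row a P + x0 by rewrite scale0r add0r.
by have := hmax _ Oy wy; rewrite (eW t _ erefl Oy) (eW 0 _ e0 Ox).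
Qed.

Section Equation.
Context (k : nat) (f : 'rV[R]_n * R * 'rV[R]_n -> R).
Hypothesis (Hf : Cm jvec 2 (jet Omega) f) (eta_cvx : eta_convex k Omega phi).
Hypothesis equation : forall x, Omega x -> sigma k (eigenvals (eta_mx phi x)) = f (jpt phi x).
Hypothesis k0 : (0 < k)%N.
Local Notation eta := (fun i => D - kap i).
Local Notation G := (dlog_esf [set: 'I_n]%SET k eta).
Local Notation F := (f (jpt phi x0)).
Context (M m A : R).
Hypothesis (m0 : 0 < m) (fm : m <= F).
Hypothesis fA : forall s, (size s <= 2)%N -> `|partial jvec s f (jpt phi x0)| <= A.
Hypothesis uM : forall a, `|p [:: a]| <= M.

Lemma equation_first_order l :
  \sum_a (\sum_i G i - G a) * p [:: a; a; l] = drift0 P phi x0 f l + drift P phi x0 f l * kap l.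
Proof.
have F0 := rhs_gt0 m0 fm.
have [r r0 hr] := ln_tangent_line PP oO Hphi Ox diag_hess eta_cvx equation l k0.
have [Q _ jF] := jet2_rhs PP oO Hphi Ox diag_hess Hf m0 fm fA l.
have [e _] := @supergradient_jets R n kap p (fline P phi x0) (jet2_fline P oO Hphi Ox) diag_hess
  (fpart_third P oO Hphi Ox) (fpart_fourth P oO Hphi Ox) F _ _ _ l G F0 jF r r0 hr.
by apply: (etrans e); rewrite mulfK // lt0r_neq0.
Qed.

Local Notation C0 := ((n%:R + M) * A / m + A / m + n%:R * (A / m) * ((n%:R + M) ^+ 2 + n%:R ^+ 4)
  + n%:R * ((n%:R + M) * A / m) ^+ 2 * (1 + n%:R ^+ 2)).

Lemma equation_second_order : 1 <= D -> (forall a, `|kap a| <= n%:R * D) ->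
  \sum_l drift P phi x0 f l * (\sum_c p [:: l; c; c]) - C0 * (1 + D ^+ 2) <=
  \sum_a (\sum_i G i - G a) * (\sum_l p [:: a; a; l; l]).
Proof.
move=> D1 kD; have F0 := rhs_gt0 m0 fm.
have := sum_equation_second_order PP oO Hphi Ox diag_hess Hf m0 fm fA uM
  (Fa := fun a => \sum_i G i - G a) (tex := fun=> 0) D1 kD.
rewrite [\sum_(_ < _) 0]big1 // addr0; apply=> l A2 jF.
have [r r0 hr] := ln_tangent_line PP oO Hphi Ox diag_hess eta_cvx equation l k0.
have [_] := @supergradient_jets R n kap p (fline P phi x0) (jet2_fline P oO Hphi Ox) diag_hess
  (fpart_third P oO Hphi Ox) (fpart_fourth P oO Hphi Ox) F _ _ _ l G F0 jF r r0 hr.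
by rewrite addr0 mulfK // lt0r_neq0.
Qed.

Lemma equation_second_order_full i1 : k = n -> 1 <= D -> (forall a, `|kap a| <= n%:R * D) ->
  \sum_l drift P phi x0 f l * (\sum_c p [:: l; c; c]) - C0 * (1 + D ^+ 2) +
    \sum_(l | l != i1) (G i1 ^+ 2 * (\sum_c p [:: l; c; c] - p [:: l; i1; i1]) ^+ 2 +
      2 * G i1 * G l * p [:: l; i1; i1] ^+ 2) <=
  \sum_a (\sum_i G i - G a) * (\sum_l p [:: a; a; l; l]).
Proof.
move=> kn D1 kD; have F0 := rhs_gt0 m0 fm.
have kc : k = #|'I_n| by rewrite card_ord.
have gc : gcone [set: 'I_n]%SET #|'I_n| eta by rewrite -kc; exact: (gcone_eta PP oO Hphi Ox diag_hess eta_cvx).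
have eta0 i : 0 < D - kap i by exact: (gcone_full_gt0 i gc).
have GE i : G i = (D - kap i)^-1 by rewrite kc dlog_esf_full.
have Gp i : 0 < G i by rewrite GE invr_gt0.
pose tex l := G i1 ^+ 2 * (\sum_c p [:: l; c; c] - p [:: l; i1; i1]) ^+ 2
    + 2 * G i1 * (\sum_(q | q != i1) G q * p [:: l; i1; q] ^+ 2).
have eF : ln F = \sum_i ln (D - kap i).
  rewrite -(esf_eta PP oO Hphi Ox diag_hess equation) kc esf_full ln_prod //.
have := sum_equation_second_order PP oO Hphi Ox diag_hess Hf m0 fm fA uM
  (Fa := fun a => \sum_i G i - G a) (tex := tex) D1 kD.
have t3 := fpart_third P oO Hphi Ox; have t4 := fpart_fourth P oO Hphi Ox.
have hj := hadamard_jets (jet2_fline P oO Hphi Ox) diag_hess t4.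
have hh l := hadamard_line PP oO Hphi Ox eta_cvx equation l i1 G kn.
move=> H; apply: le_trans (H _) => [|l A2 jF]; last first.
  have [r r0 hr] := hh l.
  have := hj F _ A2 _ l G F0 jF r i1 r0 eta0 GE hr eF.
  by rewrite mulfK ?lt0r_neq0 // /tex addrA.
rewrite lerD2l; move: t3; rewrite /tex; generalize (fpart P phi x0) => pp t3.
(* By symmetry of third derivatives, the squares weighted by [2 * G i1 * G l] all come from the
   off-diagonal gain of the single direction [i1], in [tex i1]; the other directions supply the
   squares weighted by [G i1 ^+ 2]. *)
rewrite [leRHS](bigD1 i1) //= big_split /= [leRHS]addrC; apply: lerD.
  apply: ler_sum => l _; rewrite lerDl mulr_ge0 ?sumr_ge0 //; first by rewrite mulr_ge0 // ltW.
  by move=> q _; rewrite mulr_ge0 ?sqr_ge0 // ltW.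
apply: ler_wpDl; first by rewrite mulr_ge0 ?sqr_ge0.
rewrite mulr_sumr; apply/eq_leW/eq_bigr => q _.
by rewrite t3 mulrA.
Qed.

End Equation.
End Frame.

(** * The bound at the maximum point *)

Section AtMaximum.
Context {R : realType}.

(** The jets at [x0] are fed into [regimes_bound]; as its constants precede them, [C], [B] and [be]
    serve every [Omega], [f], [phi] and [delta] with the same bounds. *)
Lemma pogorelov_at_max (n k : nat) (M m A rad : R) :
  (2 <= k <= n)%N -> 0 < M -> 0 < m -> m <= A -> 0 <= rad ->
  exists (C B : R) (be : nat), [/\ 0 < B, (0 < be)%N &
  forall (Omega : set 'rV[R]_n) (f : 'rV[R]_n * R * 'rV[R]_n -> R) (phi : 'rV[R]_n -> R) x0 delta,
    open Omega -> Cm jvec 2 (jet Omega) f -> Cm evec 4 Omega phi -> eta_convex k Omega phi ->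
    (forall x, Omega x -> sigma k (eigenvals (eta_mx phi x)) = f (jpt phi x)) ->
    (forall x, Omega x -> m <= f (jpt phi x)) ->
    (forall s x, (size s <= 2)%N -> Omega x -> `|partial jvec s f (jpt phi x)| <= A) ->
    (forall x, Omega x -> `|phi x| <= M) ->
    (forall x, Omega x -> \sum_i partial evec [:: i] phi x ^+ 2 <= M ^+ 2) ->
    (forall x i, Omega x -> `|x 0 i| <= rad) ->
    Omega x0 -> 0 <= delta -> 0 < - phi x0 - delta ->
    (forall x, Omega x -> 0 < - phi x - delta ->
      test_function be%:R B (M ^+ 2 + 1) delta phi x <= test_function be%:R B (M ^+ 2 + 1) delta phi x0) ->
    (- phi x0 - delta) * laplacian phi x0 <= C].
Proof.
move=> /[dup] hk /andP[k2 kn] M0 m0 mA r0; have A0 := lt_le_trans m0 mA.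
have n2 : (2 <= n)%N := leq_trans k2 kn.
pose c1 := (n%:R + M) * A / m.
pose C0 := c1 + A / m + n%:R * (A / m) * ((n%:R + M) ^+ 2 + n%:R ^+ 4) + n%:R * c1 ^+ 2 * (1 + n%:R ^+ 2).
have Am : 0 <= A / m by rewrite divr_ge0 // ltW.
have c10 : 0 <= c1 by rewrite /c1 -mulrA mulr_ge0 // addr_ge0 // ltW.
have c1C : c1 <= C0.
  rewrite /C0 -!addrA lerDl !addr_ge0 // !mulr_ge0 ?sqr_ge0 ?addr_ge0 ?sqr_ge0 ?exprn_ge0 ?invr_ge0 ?(ltW m0) ?(ltW M0) ?(ltW A0) //.
have C00 : 0 <= C0 := le_trans c10 c1C.
have Y0 : 0 <= n%:R * rad by rewrite mulr_ge0.
have [C [B [be [B0 be0 H]]]] := regimes_bound hk M0 A0 C00 Y0.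
exists C, B, be; split=> // Omega f phi x0 delta oO Hf Hphi ecv eqn fm fA phiM gM xr Ox d0 w0 hmax.
have [P [d PP hE]] := real_sym_spectral (hess_sym oO Hphi Ox).
pose kap i := d 0 i.
have diag a b : fpart P phi x0 [:: a; b] = kap a *+ (a == b).
  rewrite /fpart (partial2_rotate P oO Hphi a b isT Ox) hE !mulmxA PP mul1mx -mulmxA PP mulmx1.
  by rewrite mxE.
have k0 : (0 < k)%N := ltnW k2.
have gc := gcone_eta PP oO Hphi Ox diag ecv.
have esfE := esf_eta PP oO Hphi Ox diag eqn.
have lapE := laplacian_fpart PP oO Hphi Ox diag.
rewrite lapE; set D := \sum_a kap a in gc esfE lapE *.
have n0 : (0 : R) < n%:R by rewrite ltr0n; apply: leq_trans n2.
have sumeta : \sum_(i in [set: 'I_n]%SET) (D - kap i) = n%:R * D - D.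
  rewrite sum_setT sumrB sumr_const card_ord -/D -[_ *+ _]mulr_natl //.
have eta1 : 0 < n%:R * D - D.
  by rewrite -sumeta -esf1; apply: gc.
have D0 : 0 < D.
  have : (2 : R) <= n%:R by rewrite ler_nat.
  by move=> h; rewrite -(pmulr_rgt0 _ (_ : 0 < n%:R - 1)) ?mulrBl ?mul1r //; lra.
(* Here [2 <= k] enters: positivity of [esf] in degree 2 bounds each [D - kap a] by the trace
   [(n - 1) * D]. *)
have kD a : `|kap a| <= n%:R * D.
  have := norm_le_esf1 (finset.in_setT a) (gcone_le k2 gc).
  rewrite sumeta /= !ler_norml => /andP[h1 h2]; apply/andP; split; lra.
have fA0 s : (size s <= 2)%N -> `|partial jvec s f (jpt phi x0)| <= A by move=> hs; apply: fA.
have fm0 := fm x0 Ox.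
have gp : \sum_c fpart P phi x0 [:: c] ^+ 2 <= M ^+ 2.
  by rewrite /fpart -(sum_sqr_rotate PP oO Hphi isT Ox); apply: gM.
have uM a : `|fpart P phi x0 [:: a]| <= M.
  rewrite -(@ler_pXn2r _ 2) ?nnegrE ?(ltW M0) // real_normK ?num_real //.
  by apply: le_trans gp; rewrite (bigD1 a) //= lerDl sumr_ge0 // => c _; rewrite sqr_ge0.
have K0 : 0 < M ^+ 2 + 1 - \sum_c fpart P phi x0 [:: c] ^+ 2 by lra.
have hT := test_function_frame PP oO Hphi Ox diag _ w0 D0 K0 hmax.
apply: (H (- phi x0 - delta) (M ^+ 2 + 1 - \sum_c fpart P phi x0 [:: c] ^+ 2)^-1 D kap
  (fun a => fpart P phi x0 [:: a]) (fun a => \sum_i x0 0 i * P a i)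
  (fun l => \sum_c fpart P phi x0 [:: l; c; c]) (fun a => \sum_l fpart P phi x0 [:: a; a; l; l])
  (drift0 P phi x0 f) (drift P phi x0 f) (fun l a => fpart P phi x0 [:: a; a; l])).
- rewrite w0; have := phiM x0 Ox; rewrite ler_norml => /andP[h _]; lra.
- have s0 : 0 <= \sum_c fpart P phi x0 [:: c] ^+ 2 by apply: sumr_ge0 => c _; rewrite sqr_ge0.
  have q1 : 1 <= M ^+ 2 + 1 - \sum_c fpart P phi x0 [:: c] ^+ 2 by lra.
  have K1 : 0 < M ^+ 2 + 1 by rewrite ltr_wpDl ?sqr_ge0.
  apply/andP; split; last by rewrite invf_le1.
  by rewrite lef_pV2 ?posrE //; lra.
- by [].
- exact: gc.
- by rewrite esfE; apply: (le_trans (ler_norm _)); exact: (fA0 [::]).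
- exact: uM.
- move=> a; apply: norm_sum_le => i; rewrite normrM -[leRHS]mulr1.
  by apply: ler_pM => //; [exact: xr | exact: abs_orthogonal_le1].
- by move=> l; apply: le_trans (drift_le PP m0 fm0 fA0 l) (le_trans _ c1C); rewrite /c1 ler_pM2r ?invr_gt0 // ler_pM2r // lerDl ltW.
- by move=> l; apply: le_trans (drift0_le PP m0 fm0 fA0 uM l) c1C.
- by move=> a; have [h _] := hT a.
- by move=> a; have [_ h] := hT a.
- by move=> l; exact: (equation_first_order PP oO Hphi Ox diag Hf ecv eqn k0 m0 fm0 fA0).
- move=> D1; exact: (equation_second_order PP oO Hphi Ox diag Hf ecv eqn k0 m0 fm0 fA0 uM D1 kD).
- move=> D1 kn' i1; exists (fun l => fpart P phi x0 [:: l; i1; i1]).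
  exists (fun l => \sum_c fpart P phi x0 [:: l; c; c] - fpart P phi x0 [:: l; i1; i1]).
    by move=> l _; rewrite addrC subrK.
  exact: (equation_second_order_full PP oO Hphi Ox diag Hf ecv eqn m0 fm0 fA0 uM i1 kn' D1 kD).
Qed.

End AtMaximum.

(** * Existence of the maximum point *)

Section Topology.
Context {R : realType} {n : nat}.
Implicit Types (W : set 'rV[R]_n) (phi : 'rV[R]_n -> R).

Lemma closed_sublevel (T : topologicalType) (W : set T) (phi : T -> R) c :
  {within closure W, continuous phi} -> closed (closure W `&` [set y | phi y <= c]).
Proof.
move=> /subspace_continuousP cphi y clK.
have Wy : closure W y.
  by apply: closed_closure; apply: closureS clK => z [].
split=> //=; rewrite leNgt; apply/negP => cy.
have : \forall z \near within (closure W) (nbhs y), c < phi z.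
  by apply: (cphi y Wy [set z | c < z]); apply: open_nbhs_nbhs; split; [exact: open_gt | ].
by move=> /clK[z [[Wz /= zc]]] /(_ Wz); rewrite ltNge zc.
Qed.

Lemma cvg_sum_at (V : normedModType R) (I : finType) (g : I -> V -> R) y :
  (forall i, g i z @[z --> y] --> g i y) -> \sum_i g i z @[z --> y] --> \sum_i g i y.
Proof. by move=> H; apply: cvg_big => [|i _]; [exact: add_continuous | exact: H]. Qed.

Lemma cvg_exprn_at (V : normedModType R) (g : V -> R) N y :
  g z @[z --> y] --> g y -> g z ^+ N @[z --> y] --> g y ^+ N.
Proof.
move=> h; apply: (@cvg_comp _ _ _ g (fun r : R => r ^+ N) _ (nbhs (g y))) => //.
exact: exprn_continuous.
Qed.

Lemma cvg_scale_at (V : normedModType R) (g : V -> R) c y :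
  g z @[z --> y] --> g y -> c * g z @[z --> y] --> c * g y.
Proof.
move=> h; apply: (@cvg_comp _ _ _ g ( *%R c) _ (nbhs (g y))) => //.
exact: mulrl_continuous.
Qed.

Lemma cvg_mul_at (V : normedModType R) (f g : V -> R) y :
  f z @[z --> y] --> f y -> g z @[z --> y] --> g y -> f z * g z @[z --> y] --> f y * g y.
Proof. by move=> hf hg; exact: (cvgM hf hg). Qed.

Lemma closed_norm_le (V : normedModType R) (r : R) : closed [set v : V | `|v| <= r].
Proof.
apply: (@preimage_closed _ _ (fun v : V => `|v|) [set x | x <= r]); last exact: closed_le.
by move=> v _; exact: norm_continuous.
Qed.

Lemma bounded_closure W : bounded_set W -> exists2 r : R, 0 <= r & forall y, closure W y -> `|y| <= r.
Proof.
case=> r [rr hr]; exists (`|r| + 1) => [|y]; first by rewrite addr_ge0.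
have h : W `<=` [set v | `|v| <= `|r| + 1].
  by move=> v Wv; apply: hr Wv; rewrite (le_lt_trans (ler_norm r)) // ltrDl.
by move=> /(closureS h)/closed_norm_le.
Qed.

Lemma mx_norm_leP (v : 'rV[R]_n) (r : R) : 0 <= r -> (forall i, `|v 0 i| <= r) <-> `|v| <= r.
Proof.
move=> r0; have -> : `|v| = mx_norm v by []; rewrite mx_normrE; split=> [h|/bigmax_leP[_ h] i]; last exact: (h (0, i)).
by apply/bigmax_leP; split=> // -[i j] _ /=; rewrite ord1.
Qed.

Lemma compact_norm_le (r : R) : compact [set v : 'rV[R]_n | `|v| <= r].
Proof.
apply: bounded_closed_compact; last exact: closed_norm_le.
by exists r; split; rewrite ?num_real // => x rx v /= /le_trans; apply; exact: ltW.
Qed.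

Lemma compact_closure_bounded W : bounded_set W -> compact (closure W).
Proof.
move=> /bounded_closure[r _ hr]; apply: bounded_closed_compact; last exact: closed_closure.
by exists r; split; rewrite ?num_real // => x rx v /hr /le_trans; apply; exact: ltW.
Qed.

Lemma sigma1_eta phi x : (hess phi x)^T = hess phi x ->
  sigma 1 (eigenvals (eta_mx phi x)) = n%:R * laplacian phi x - laplacian phi x.
Proof.
move=> hs; have es : (eta_mx phi x)^T = eta_mx phi x by rewrite /eta_mx linearB /= tr_scalar_mx hs.
have [P [d PP eE]] := real_sym_spectral es.
rewrite (sigma_eigenvals 1 PP eE) esf1.
transitivity (\tr (eta_mx phi x)).
  rewrite eE mxtrace_mulC mulmxA PP mul1mx /mxtrace; apply: eq_big => [i|i _]; first by rewrite finset.in_setT.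
  by rewrite mxE eqxx.
rewrite /eta_mx linearB /= mxtrace_scalar mulr_natl; congr (_ - _).
by apply: eq_bigr => i _; rewrite mxE.
Qed.

End Topology.

(** * From the norms to pointwise bounds *)

Section Norms.
Context {R : realType} {n : nat}.

Lemma Cnorm_sup_le (V : normedModType R) (I : finType) (m : nat) (A : set V) (D : seq I -> V -> R) (M : R) j x :
  Cnorm m A D = M%:E -> (j <= m)%N -> A x ->
  Num.sqrt (\sum_(s : j.-tuple I) D s x ^+ 2) <= M.
Proof.
rewrite /Cnorm => h jm Ax.
pose S j := ereal_sup [set (Num.sqrt (\sum_(s : j.-tuple I) D s x ^+ 2))%:E | x in A].
have S0 i : (0 <= S i)%E.
  by apply: le_trans (ereal_sup_ubound _); last (exists x => //); rewrite lee_fin sqrtr_ge0.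
rewrite -lee_fin -h (bigD1 (Ordinal (jm : (j < m.+1)%N))) //=.
apply: le_trans (leeDl _ _); last by apply: sume_ge0 => i _; exact: S0.
by apply: ereal_sup_ubound; exists x.
Qed.

Lemma Cnorm_le (V : normedModType R) (I : finType) (m : nat) (A : set V) (D : seq I -> V -> R) (M : R) s x :
  Cnorm m A D = M%:E -> (size s <= m)%N -> A x -> `|D s x| <= M.
Proof.
move=> h hs Ax; apply: le_trans (Cnorm_sup_le h hs Ax); rewrite -sqrtr_sqr ler_sqrt.
  by rewrite (bigD1 (in_tuple s)) //= lerDl sumr_ge0 // => t _; rewrite sqr_ge0.
by apply: sumr_ge0 => t _; rewrite sqr_ge0.
Qed.

Lemma sum_1tuple (I : finType) (g : seq I -> R) : \sum_(s : 1.-tuple I) g s = \sum_i g [:: i].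
Proof.
rewrite (reindex (fun i : I => [tuple i])) //; exists (fun s : 1.-tuple I => thead s) => s _.
  by rewrite /thead (tnth_nth s).
by apply/val_inj; case: s => -[|a []].
Qed.

Lemma ext_interior (V : normedModType R) (W : set V) (h : V -> R) x : open W -> W x ->
  {for x, continuous h} -> ext W h x = h x.
Proof.
move=> oW Wx ch; rewrite /ext within_interior; last first.
  by move: oW => /interior_id ->.
exact: cvg_lim.
Qed.

End Norms.

Section Domain.
Context {R : realType} {n : nat} (Omega : set 'rV[R]_n).
Hypothesis (O0 : Omega !=set0) (oO : open Omega) (bO : bounded_set Omega).

Lemma norm_le_enorm (p : 'rV[R]_n) : `|p| <= enorm p.
Proof.
apply/mx_norm_leP; first exact: sqrtr_ge0.
move=> i; rewrite -sqrtr_sqr ler_sqrt ?sumr_ge0 // => [|j _]; last exact: sqr_ge0.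
by rewrite (bigD1 i) //= lerDl sumr_ge0 // => j _; exact: sqr_ge0.
Qed.

Lemma closure_jet y z p : closure Omega y -> closure (jet Omega) (y, z, p).
Proof.
move=> cy U Un.
have [[U1 U2] /= [n1 n2] hU] := Un; have [[V1 V2] /= [m1 m2] hV] := n1.
have [v [Ov Vv]] := cy _ m1; exists (v, z, p); split=> //.
by apply: (hU (v, z, p)); split=> /=; [apply: hV; split=> //=; exact: nbhs_singleton | exact: nbhs_singleton].
Qed.

(** [jetK], defined with the Euclidean norm, lies in the product [K] built with the sup norm, whose
    compactness is at hand; there the continuous [f] attains a positive minimum. *)
Lemma jet_inf_gt0 (f : 'rV[R]_n * R * 'rV[R]_n -> R) (M m : R) : 0 <= M ->
  {within closure (jet Omega), continuous f} -> (forall q, closure (jet Omega) q -> 0 < f q) ->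
  ereal_inf [set (f q)%:E | q in jetK Omega M] = m%:E -> 0 < m.
Proof.
move=> M0 cf f0 fm.
pose K : set ('rV[R]_n * R * 'rV[R]_n) := closure Omega `*` [set z : R | `|z| <= M] `*` [set p : 'rV[R]_n | `|p| <= M].
have cK : compact K.
  apply: compact_setX; last exact: compact_norm_le.
  apply: compact_setX; first exact: compact_closure_bounded.
  have -> : [set z : R | `|z| <= M] = [set` `[- M, M]].
    by apply/seteqP; split=> z /=; rewrite in_itv /= ler_norml.
  exact: segment_compact.
have KJ : K `<=` closure (jet Omega).
  by move=> [[y z] p] [[/= cy _] _]; exact: closure_jet.
have K0 : K !=set0.
  have [x Ox] := O0; exists (x, 0, 0); split; [split|] => /=; rewrite ?normr0 //.
  exact: subset_closure.
have [q] := compact_EVT_min K0 cK (continuous_subspaceW KJ cf).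
rewrite inE => Kq hq; apply: lt_le_trans (f0 q (KJ q Kq)) _.
rewrite -lee_fin -fm; apply: le_ereal_inf_tmp => _ [[[y z] p] [[/= cy zM] pM] <-].
rewrite lee_fin; apply: hq; rewrite inE; split=> //=.
exact: le_trans (norm_le_enorm p) pM.
Qed.

Context (phi : 'rV[R]_n -> R).
Hypothesis (cphi : {within closure Omega, continuous phi}) (Hphi : Cm evec 4 Omega phi).
Hypothesis phi_bd : forall x, boundary Omega x -> phi x = 0.

Lemma interior_max_laplacian_le0 z : Omega z -> (forall y, Omega y -> phi y <= phi z) ->
  laplacian phi z <= 0.
Proof.
move=> Oz hz; apply: sumr_le0 => l _.
have [r r0 hr] := near_line (evec l) (open_nbhs_nbhs (conj oO Oz)).
have H := jet2_line oO Hphi (s := [::]) l isT Oz.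
have [t /hr Oy|_ //] := jet2_max r0 H.
by rewrite /partial /= scale0r add0r; exact: hz.
Qed.

Lemma closure_boundary y : closure Omega y -> Omega y \/ phi y = 0.
Proof.
move=> cy; have [Oy|nOy] := pselect (Omega y); [by left | right].
by apply: phi_bd; split=> //; move: oO => /interior_id ->.
Qed.

(** A positive Laplacian excludes interior maxima, so the maximum over the closure is a boundary
    value, 0; then [0 <= phi x] would make [x] itself an interior maximum. *)
Lemma subharmonic_lt0 : (forall x, Omega x -> 0 < laplacian phi x) -> forall x, Omega x -> phi x < 0.
Proof.
move=> lap0 x Ox; rewrite ltNge; apply/negP => x0.
have c0 : closure Omega !=set0 by exists x; exact: subset_closure.
have [z] := compact_EVT_max c0 (compact_closure_bounded bO) cphi.
rewrite inE => cz hz.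
have hz' y : Omega y -> phi y <= phi z by move=> Oy; apply: hz; rewrite inE; exact: subset_closure.
have contra v : Omega v -> (forall y, Omega y -> phi y <= phi v) -> False.
  by move=> Ov /(interior_max_laplacian_le0 Ov); rewrite leNgt lap0.
have [Oz|z0] := closure_boundary cz; first exact: contra Oz hz'.
by apply: (contra x Ox) => y /hz'; rewrite z0 => /le_trans; apply.
Qed.

(** The boundary value 0 exceeds [- delta], so the set stays inside [Omega], where the derivatives
    of [phi] are continuous. *)
Lemma compact_superlevel (delta : R) : 0 < delta ->
  let K := closure Omega `&` [set y | phi y <= - delta] in compact K /\ K `<=` Omega.
Proof.
move=> d0 K; split.
  have clK : closed K by exact: closed_sublevel.
  by apply: (subclosed_compact clK (compact_closure_bounded bO)) => y [].
move=> y [cy /= yd]; have [//|y0] := closure_boundary cy.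
by move: yd; rewrite y0; lra.
Qed.

Lemma continuous_partial s x : (size s <= 4)%N -> Omega x -> {for x, continuous (partial evec s phi)}.
Proof. by move=> hs Ox; have [] := Hphi hs Ox. Qed.

(** The exponential [Q] of the test function is maximized, because [ln] has only a default value at
    0: [Q] is continuous on the whole compact set and, as [0 < N], vanishes where [- phi - delta]
    does, so a positive maximum avoids that edge. *)
Lemma test_function_max_exists (N : nat) (B K delta : R) x : (0 < N)%N -> 0 < delta -> Omega x ->
  (forall y, Omega y -> 0 < laplacian phi y) ->
  (forall y, Omega y -> \sum_i partial evec [:: i] phi y ^+ 2 < K) ->
  0 < - phi x - delta ->
  exists x0, [/\ Omega x0, 0 < - phi x0 - delta & forall y, Omega y -> 0 < - phi y - delta ->
    test_function N%:R B K delta phi y <= test_function N%:R B K delta phi x0].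
Proof.
move=> N0 d0 Ox lap0 gK wx.
have [cK KO] := compact_superlevel d0; set S := _ `&` _ in cK KO.
pose h (y : 'rV[R]_n) : R := - (1 / 3 * ln (K - \sum_i partial evec [:: i] phi y ^+ 2)) + B / 2 * \sum_i y 0 i ^+ 2.
pose Q (y : 'rV[R]_n) : R := (- phi y - delta) ^+ N * laplacian phi y * expR (h y).
have inS y : Omega y -> 0 < - phi y - delta -> S y.
  by move=> Oy wy; split; [exact: subset_closure | rewrite /=; lra].
have Q0 y : Omega y -> 0 < - phi y - delta -> 0 < Q y.
  by move=> Oy wy; rewrite !mulr_gt0 ?exprn_gt0 ?expR_gt0 ?lap0.
have lnQ y : Omega y -> 0 < - phi y - delta -> ln (Q y) = test_function N%:R B K delta phi y.
  move=> Oy wy; rewrite /Q lnM ?posrE ?mulr_gt0 ?exprn_gt0 ?expR_gt0 ?lap0 //.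
  rewrite lnM ?posrE ?exprn_gt0 ?lap0 // expRK lnXn // /test_function /h mulr_natl; ring.
have cQ : {in S, continuous Q}.
  move=> y; rewrite inE => /KO Oy.
  have c1 : (fun z => - phi z - delta) @ y --> - phi y - delta.
    have c0 : phi @ y --> phi y := continuous_partial (s := [::]) isT Oy.
    exact: (cvgB (cvgN c0) (cvg_cst delta)).
  have c2 : laplacian phi @ y --> laplacian phi y.
    apply: cvg_sum_at => i.
    exact: (continuous_partial (s := [:: i; i]) isT Oy).
  have c3 : (fun z => \sum_i partial evec [:: i] phi z ^+ 2) @ y --> \sum_i partial evec [:: i] phi y ^+ 2.
    apply: cvg_sum_at => i.
    by apply: cvg_exprn_at; exact: (continuous_partial (s := [:: i]) isT Oy).
  have c4 : (fun z : 'rV[R]_n => \sum_i z 0 i ^+ 2) @ y --> \sum_i y 0 i ^+ 2.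
    apply: cvg_sum_at => i.
    by apply: cvg_exprn_at; exact: coord_continuous.
  have c5 : ln (K - \sum_i partial evec [:: i] phi z ^+ 2) @[z --> y] --> ln (K - \sum_i partial evec [:: i] phi y ^+ 2).
    apply: (@cvg_comp _ _ _ (fun z => K - \sum_i partial evec [:: i] phi z ^+ 2) (@ln R) _
      (nbhs (K - \sum_i partial evec [:: i] phi y ^+ 2))); first exact: (cvgB (cvg_cst K) c3).
    by apply: continuous_ln; rewrite subr_gt0 gK.
  have c6 : h z @[z --> y] --> h y.
    have d1 : 1 / 3 * ln (K - \sum_i partial evec [:: i] phi z ^+ 2) @[z --> y] -->
        1 / 3 * ln (K - \sum_i partial evec [:: i] phi y ^+ 2).
      exact: (cvg_scale_at (g := fun z => ln (K - \sum_i partial evec [:: i] phi z ^+ 2))).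
    have d2 : B / 2 * (\sum_i z 0 i ^+ 2) @[z --> y] --> B / 2 * (\sum_i y 0 i ^+ 2).
      exact: (cvg_scale_at (g := fun z : 'rV[R]_n => \sum_i z 0 i ^+ 2)).
    exact: (cvgD (cvgN d1) d2).
  have c7 : expR (h z) @[z --> y] --> expR (h y).
    by apply: (@cvg_comp _ _ _ h expR _ (nbhs (h y))) => //; exact: continuous_expR.
  have c8 : (- phi z - delta) ^+ N @[z --> y] --> (- phi y - delta) ^+ N.
    exact: (cvg_exprn_at (g := fun z => - phi z - delta)).
  have c9 : (- phi z - delta) ^+ N * laplacian phi z @[z --> y] --> (- phi y - delta) ^+ N * laplacian phi y.
    exact: (cvg_mul_at (f := fun z => (- phi z - delta) ^+ N)).
  have c10 : Q z @[z --> y] --> Q y.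
    exact: (cvg_mul_at (f := fun z => (- phi z - delta) ^+ N * laplacian phi z) (g := fun z => expR (h z))).
  exact: c10.
have S0 : S !=set0 by exists x; exact: inS.
have [x0] := compact_EVT_max S0 cK (continuous_in_subspaceT cQ).
rewrite inE => Sx0 hx0; have Ox0 := KO _ Sx0; exists x0.
have w0 : 0 < - phi x0 - delta.
  have w0 : 0 <= - phi x0 - delta by case: Sx0 => _ /=; lra.
  rewrite lt_neqAle w0 andbT; apply/eqP => e.
  have := hx0 x; rewrite inE => /(_ (inS x Ox wx)); rewrite {2}/Q -e expr0n eqn0Ngt N0 !mul0r.
  by rewrite leNgt Q0.
split=> // y Oy wy; rewrite -!lnQ // ler_ln ?posrE ?Q0 //.
by apply: hx0; rewrite inE; exact: inS.
Qed.

End Domain.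

(** * Transfer of the bound from the maximum to an arbitrary point *)

Lemma laplacian_gt0 {R : realType} {n k : nat} (Omega : set 'rV[R]_n) (phi : 'rV[R]_n -> R) x :
  (2 <= n)%N -> (0 < k)%N -> open Omega -> Cm evec 4 Omega phi -> eta_convex k Omega phi -> Omega x ->
  0 < laplacian phi x /\ laplacian phi x <= sigma 1 (eigenvals (eta_mx phi x)).
Proof.
move=> n2 k0 oO Hphi ecv Ox; have := ecv x Ox 1%N k0.
rewrite (sigma1_eta (hess_sym oO Hphi Ox)) => h.
have n2' : (2 : R) <= n%:R by rewrite ler_nat.
have l0 : 0 < laplacian phi x.
  by rewrite -(pmulr_rgt0 _ (_ : 0 < n%:R - 1)) ?mulrBl ?mul1r //; lra.
split=> //; set l := laplacian phi x in l0 *; nra.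
Qed.

Lemma test_function_compare {R : realFieldType} (a l k s a' l' k' s' x y t c K r : R) :
  a + l - 1 / 3 * k + s <= a' + l' - 1 / 3 * k' + s' -> k <= K -> 0 <= k' -> t + l' <= c ->
  x <= y -> 0 <= s -> s' <= r -> a' = x + t -> a + l <= y + c + 1 / 3 * K + r.
Proof. by lra. Qed.

Lemma pogorelov_bound {R : realType} (n k : nat) (M m A rad : R) :
  (2 <= k <= n)%N -> 0 < M -> 0 < m -> m <= A -> 0 <= rad ->
  exists (C : R) (be : nat),
  forall (Omega : set 'rV[R]_n) (f : 'rV[R]_n * R * 'rV[R]_n -> R) (phi : 'rV[R]_n -> R),
    Omega !=set0 -> open Omega -> bounded_set Omega ->
    Cm jvec 2 (jet Omega) f -> Cm evec 4 Omega phi -> eta_convex k Omega phi ->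
    {within closure Omega, continuous phi} -> (forall x, boundary Omega x -> phi x = 0) ->
    (forall x, Omega x -> sigma k (eigenvals (eta_mx phi x)) = f (jpt phi x)) ->
    (forall x, Omega x -> m <= f (jpt phi x)) ->
    (forall s x, (size s <= 2)%N -> Omega x -> `|partial jvec s f (jpt phi x)| <= A) ->
    (forall x, Omega x -> `|phi x| <= M) ->
    (forall x, Omega x -> \sum_i partial evec [:: i] phi x ^+ 2 <= M ^+ 2) ->
    (forall x i, Omega x -> `|x 0 i| <= rad) ->
    forall x, Omega x -> (- phi x) ^+ be * laplacian phi x <= C.
Proof.
move=> /[dup] hk /andP[k2 kn] M0 m0 mA r0.
have n2 : (2 <= n)%N := leq_trans k2 kn.
have [C [B [be [B0 be0 H]]]] := pogorelov_at_max hk M0 m0 mA r0.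
pose K := M ^+ 2 + 1; pose C' := Num.max C 1.
have C'0 : 0 < C' by rewrite lt_max ltr01 orbT.
(* One of the [be] factors [- phi x0 - delta] is paired with the Laplacian and bounded by [C'], made
   positive for the logarithm; the other [be.-1] are at most [M]. The factor [2 ^+ be] below
   compensates [- phi x - delta = - phi x / 2]. *)
pose L := be.-1%:R * ln M + ln C' + 1 / 3 * ln K + B / 2 * (n%:R * rad ^+ 2).
exists (2 ^+ be * expR L), be => Omega f phi O0 oO bO Hf Hphi ecv cphi bd eqn fm fA phiM gM xr x Ox.
have lap0 y : Omega y -> 0 < laplacian phi y.
  by move=> Oy; have [] := laplacian_gt0 n2 (ltnW k2) oO Hphi ecv Oy.
have neg := subharmonic_lt0 oO bO cphi Hphi bd lap0.
have gK y : Omega y -> \sum_i partial evec [:: i] phi y ^+ 2 < K.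
  by move=> /gM h; rewrite /K; lra.
pose delta := - phi x / 2.
have d0 : 0 < delta by rewrite divr_gt0 // oppr_gt0 neg.
have wx : - phi x - delta = - phi x / 2 by rewrite /delta; lra.
have wx0 : 0 < - phi x - delta by rewrite wx.
have [x0 [Ox0 w0 hmax]] := test_function_max_exists oO bO cphi Hphi bd B be0 d0 Ox lap0 gK wx0.
have hC := H Omega f phi x0 delta oO Hf Hphi ecv eqn fm fA phiM gM xr Ox0 (ltW d0) w0 hmax.
have w0M : - phi x0 - delta <= M.
  by have := phiM x0 Ox0; rewrite ler_norml => /andP[h _]; lra.
have := hmax x Ox wx0; rewrite /test_function wx -/K.
set v := \sum_i _; set s := \sum_i _; set v0 := \sum_i _; set s0 := \sum_i _ => hle.
have K0 : 0 < K by rewrite /K ltr_wpDl ?sqr_ge0.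
have b1 : ln (K - v) <= ln K.
  rewrite ler_ln ?posrE ?subr_gt0 ?gK // gerDl oppr_le0.
  by apply: sumr_ge0 => i _; rewrite sqr_ge0.
have b2 : 0 <= ln (K - v0).
  by apply: ln_ge0; rewrite /K lerBrDr addrC lerD2r; exact: gM.
have b3 : 0 <= s by apply: sumr_ge0 => i _; rewrite sqr_ge0.
have b4 : s0 <= n%:R * rad ^+ 2.
  rewrite mulr_natl -[X in _ *+ X]card_ord -sumr_const; apply: ler_sum => i _.
  by apply: sqr_le_bound; exact: xr.
have b5 : ln (- phi x0 - delta) <= ln M by rewrite ler_ln ?posrE.
have b6 : ln (- phi x0 - delta) + ln (laplacian phi x0) <= ln C'.
  rewrite -lnM ?posrE ?lap0 // ler_ln ?posrE ?mulr_gt0 ?lap0 //.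
  by apply: le_trans hC _; rewrite le_max lexx.
have b7 := ler_wpM2l (ler0n R be.-1) b5.
have b8 : 0 <= B / 2 * s by rewrite mulr_ge0 // divr_ge0 // ltW.
have b9 : B / 2 * s0 <= B / 2 * (n%:R * rad ^+ 2) by rewrite ler_wpM2l // divr_ge0 // ltW.
have e1 : be%:R * ln (- phi x0 - delta) = be.-1%:R * ln (- phi x0 - delta) + ln (- phi x0 - delta).
  by rewrite -{1}(prednK be0) -natr1 mulrDl mul1r.
have w2 : 0 < - phi x / 2 by rewrite -wx.
have : ln ((- phi x / 2) ^+ be * laplacian phi x) <= L.
  rewrite lnM ?posrE ?exprn_gt0 ?lap0 // lnXn // -[_ *+ be]mulr_natl /L.
  exact: (test_function_compare hle b1 b2 b6 b7 b8 b9 e1).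
rewrite -ler_expR lnK ?posrE ?mulr_gt0 ?exprn_gt0 ?lap0 // => h.
have -> : (- phi x) ^+ be * laplacian phi x = 2 ^+ be * ((- phi x / 2) ^+ be * laplacian phi x).
  by rewrite mulrA -exprMn mulrC [2 * _]mulrC divfK // mulrC.
by rewrite ler_wpM2l ?exprn_ge0.
Qed.

Theorem theorem1p5 (R : realType) (n k : nat) (hn : (2 <= n)%N)
    (hk : (1 <= k <= n)%N) (Omega : set 'rV[R]_n)
    (hOmega : bounded_domain Omega) (M m A : R) :
  exists C beta : R,
    forall (f : 'rV[R]_n * R * 'rV[R]_n -> R) (phi : 'rV[R]_n -> R),
      (forall p, closure (jet Omega) p -> 0 < f p) ->
      Cm_closure jvec 2 (jet Omega) f ->
      Cm evec 4 Omega phi ->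
      {within closure Omega, continuous phi} ->
      eta_convex k Omega phi ->
      (forall x, Omega x ->
         sigma k (eigenvals (eta_mx phi x)) = f (x, phi x, grad phi x)) ->
      (forall x, boundary Omega x -> phi x = 0) ->
      C1norm Omega phi = M%:E ->
      ereal_inf [set (f p)%:E | p in jetK Omega M] = m%:E ->
      C2norm Omega M f = A%:E ->
      (ereal_sup
         [set ((- phi x) `^ beta * laplacian phi x)%:E | x in Omega] <= C%:E)%E.
Proof.
case: hOmega => O0 oO _ bO; have [k0 kn] := andP hk.
have [r r0 hr] := bounded_closure bO.
(* The norm and infimum hypotheses enter only through these pointwise bounds and the relations
   [0 < M], [0 < m], [m <= A], all derived from them first. *)
have [C [beta H]] : exists C beta : R, forall f phi,
    Cm jvec 2 (jet Omega) f -> Cm evec 4 Omega phi -> {within closure Omega, continuous phi} ->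
    eta_convex k Omega phi ->
    (forall x, Omega x -> sigma k (eigenvals (eta_mx phi x)) = f (jpt phi x)) ->
    (forall x, boundary Omega x -> phi x = 0) ->
    (forall x, Omega x -> m <= f (jpt phi x)) ->
    (forall s x, (size s <= 2)%N -> Omega x -> `|partial jvec s f (jpt phi x)| <= A) ->
    (forall x, Omega x -> `|phi x| <= M) ->
    (forall x, Omega x -> \sum_i partial evec [:: i] phi x ^+ 2 <= M ^+ 2) ->
    0 < M -> 0 < m -> m <= A ->
    forall x, Omega x -> (- phi x) `^ beta * laplacian phi x <= C; last first.
  exists C, beta => f phi f0 [Hf cf _] Hphi cphi ecv eqn bd hM hm hA.
  have phiM x : Omega x -> `|phi x| <= M.
    by move=> Ox; exact: (Cnorm_le (s := [::]) hM).
  have gM x : Omega x -> enorm (grad phi x) <= M.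
    move=> Ox; have := Cnorm_sup_le hM (isT : (1 <= 1)%N) Ox.
    rewrite (sum_1tuple (fun s => partial evec s phi x ^+ 2)) => h.
    apply: le_trans h; rewrite /enorm; apply: eq_leW; congr Num.sqrt.
    by apply: eq_bigr => i _; rewrite mxE.
  have Jx x : Omega x -> jetK Omega M (jpt phi x).
    by move=> Ox; split; [split; [exact: subset_closure | exact: phiM] | exact: gM].
  have fm x : Omega x -> m <= f (jpt phi x).
    move=> Ox; rewrite -lee_fin -hm; apply: ereal_inf_lbound.
    by exists (jpt phi x) => //; exact: Jx.
  have fA s x : (size s <= 2)%N -> Omega x -> `|partial jvec s f (jpt phi x)| <= A.
    move=> hs Ox; have := Cnorm_le hA hs (Jx x Ox).
    have Jo : jet Omega (jpt phi x) by [].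
    have [cs _] := Hf s hs _ Jo.
    by rewrite ext_interior //; exact: open_jet.
  have lap x : Omega x -> 0 < laplacian phi x.
    by move=> Ox; have [] := laplacian_gt0 hn k0 oO Hphi ecv Ox.
  have neg := subharmonic_lt0 oO bO cphi Hphi bd lap.
  have [x1 Ox1] := O0.
  have M0 : 0 < M.
    by apply: lt_le_trans (phiM x1 Ox1); rewrite normr_gt0 lt_eqF // neg.
  have m0 : 0 < m := jet_inf_gt0 O0 bO (ltW M0) cf f0 hm.
  have mA : m <= A.
    apply: le_trans (fm x1 Ox1) (le_trans (ler_norm _) _); exact: (fA [::]).
  apply: ge_ereal_sup => _ [x Ox <-]; rewrite lee_fin.
  apply: (H f phi) => // x' Ox'.
  have := gM x' Ox'; rewrite -(@ler_pXn2r _ 2) ?nnegrE ?sqrtr_ge0 ?(ltW M0) // sqr_sqrtr; last first.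
    by apply: sumr_ge0 => i _; rewrite sqr_ge0.
  by under eq_bigr do rewrite mxE.
(* [C] and [beta] must exist for all real [M], [m], [A], before [f] and [phi] are given; for
   impossible signs or order the hypotheses are contradictory and any constants do. *)
have [M0|M0] := ltP 0 M; last first.
  by exists 0, 0 => f phi _ _ _ _ _ _ _ _ _ _.
have [m0|m0] := ltP 0 m; last first.
  by exists 0, 0 => f phi _ _ _ _ _ _ _ _ _ _ _.
have [mA|mA] := leP m A; last first.
  by exists 0, 0 => f phi _ _ _ _ _ _ _ _ _ _ _ _.
have neg phi : Cm evec 4 Omega phi -> {within closure Omega, continuous phi} -> eta_convex k Omega phi ->
    (forall x, boundary Omega x -> phi x = 0) -> forall x, Omega x -> phi x < 0.
  move=> Hphi cphi ecv bd; apply: subharmonic_lt0 => // x Ox.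
  by have [] := laplacian_gt0 hn k0 oO Hphi ecv Ox.
(* For [k = 1] the equation itself bounds the Laplacian by [A], and [beta = 1] suffices. *)
have [k1|k1] := eqVneq k 1%N.
  exists (M * A), 1 => f phi _ Hphi cphi ecv eqn bd fm fA phiM _ _ _ _ x Ox.
  have px := neg phi Hphi cphi ecv bd x Ox.
  have [l0 l1] := laplacian_gt0 hn k0 oO Hphi ecv Ox.
  rewrite powRr1 ?oppr_ge0 ?(ltW px) //; apply: ler_pM; rewrite ?oppr_ge0 ?(ltW px) ?(ltW l0) //.
    by apply: le_trans (phiM x Ox); rewrite -normrN ler_norm.
  apply: le_trans l1 _; rewrite -{1}k1 eqn //.
  by apply: le_trans (ler_norm _) _; exact: (fA [::]).
have k2 : (2 <= k <= n)%N by rewrite kn andbT ltn_neqAle eq_sym k1.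
have [C [be H]] := pogorelov_bound k2 M0 m0 mA r0.
exists C, be%:R => f phi Hf Hphi cphi ecv eqn bd fm fA phiM gM _ _ _ x Ox.
have px := neg phi Hphi cphi ecv bd x Ox.
rewrite powR_mulrn ?oppr_ge0 ?(ltW px) //; apply: (H Omega f phi) => // y i Oy.
by apply: (mx_norm_leP y r0).2; apply: hr; exact: subset_closure.
Qed.
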